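(* The convex matrices belonging to $B_4^+\subset SO_4$ and the convex spins belonging to $\tilde B_4^+\subset\mathbb S^3\times\mathbb S^3$ are exactly the 24 matrices and the 24 spins of the following list, where each entry gives the convex spin $(z_l,z_r)$ and the corresponding convex matrix $\Pi_4(z_l,z_r)=(\epsilon_1e_{\pi(1)},\epsilon_2e_{\pi(2)},\epsilon_3e_{\pi(3)},\epsilon_4e_{\pi(4)})$ written as $[\pi;\epsilon_1\epsilon_2\epsilon_3\epsilon_4]$ (column $j$ is $\epsilon_je_{\pi(j)}$, $\pi\in S_4$ in cycle notation, $e$ the identity permutation), ordered by the dimension of the Bruhat cell. Dimension 0: 1. $(\mathbf 1,-\mathbf 1)$, $[e;----]$. Dimension 1: 2. $\left(\frac{\mathbf 1-\mathbf i}{\sqrt2},\frac{-\mathbf 1-\mathbf i}{\sqrt2}\right)$, $[(12);+---]$. 3. $\left(\frac{\mathbf 1-\mathbf k}{\sqrt2},\frac{-\mathbf 1+\mathbf k}{\sqrt2}\right)$, $[(23);-+--]$. 4. $\left(\frac{\mathbf 1-\mathbf i}{\sqrt2},\frac{-\mathbf 1+\mathbf i}{\sqrt2}\right)$, $[(34);--+-]$. Dimension 2: 5. $\left(\frac{\mathbf 1-\mathbf i+\mathbf j-\mathbf k}{2},\frac{-\mathbf 1+\mathbf i-\mathbf j+\mathbf k}{2}\right)$, $[(234);-++-]$. 6. $\left(\frac{\mathbf 1-\mathbf i-\mathbf j-\mathbf k}{2},\frac{-\mathbf 1+\mathbf i+\mathbf j+\mathbf k}{2}\right)$, $[(243);----]$.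 7. $\left(\frac{\mathbf 1-\mathbf i-\mathbf j-\mathbf k}{2},\frac{-\mathbf 1-\mathbf i-\mathbf j+\mathbf k}{2}\right)$, $[(123);++--]$. 8. $\left(\frac{\mathbf 1-\mathbf i+\mathbf j-\mathbf k}{2},\frac{-\mathbf 1-\mathbf i+\mathbf j+\mathbf k}{2}\right)$, $[(132);----]$. 9. $(-\mathbf i,-\mathbf 1)$, $[(12)(34);+-+-]$. Dimension 3: 10. $\left(\frac{-\mathbf i-\mathbf k}{\sqrt2},\frac{-\mathbf i+\mathbf k}{\sqrt2}\right)$, $[(13);-+--]$. 11. $\left(\frac{-\mathbf i-\mathbf k}{\sqrt2},\frac{\mathbf i+\mathbf k}{\sqrt2}\right)$, $[(24);--+-]$. 12. $\left(\frac{-\mathbf i-\mathbf k}{\sqrt2},\frac{-\mathbf 1-\mathbf j}{\sqrt2}\right)$, $[(1234);+++-]$. 13. $\left(\frac{-\mathbf i-\mathbf k}{\sqrt2},\frac{-\mathbf 1+\mathbf j}{\sqrt2}\right)$, $[(1432);+---]$. 14. $\left(\frac{-\mathbf i-\mathbf j}{\sqrt2},\frac{-\mathbf 1+\mathbf k}{\sqrt2}\right)$, $[(1243);+---]$. 15. $\left(\frac{-\mathbf i+\mathbf j}{\sqrt2},\frac{-\mathbf 1+\mathbf k}{\sqrt2}\right)$, $[(1342);--+-]$. Dimension 4: 16. $\left(\frac{-\mathbf 1-\mathbf i+\mathbf j-\mathbf k}{2},\frac{-\mathbf 1-\mathbf i-\mathbf j+\mathbf k}{2}\right)$, $[(134);-++-]$.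 17. $\left(\frac{-\mathbf 1-\mathbf i-\mathbf j-\mathbf k}{2},\frac{-\mathbf 1+\mathbf i-\mathbf j+\mathbf k}{2}\right)$, $[(124);+-+-]$. 18. $(-\mathbf i,\mathbf k)$, $[(13)(24);----]$. 19. $\left(\frac{-\mathbf 1-\mathbf i-\mathbf j-\mathbf k}{2},\frac{-\mathbf 1-\mathbf i+\mathbf j+\mathbf k}{2}\right)$, $[(143);++--]$. 20. $\left(\frac{-\mathbf 1-\mathbf i+\mathbf j-\mathbf k}{2},\frac{-\mathbf 1+\mathbf i+\mathbf j+\mathbf k}{2}\right)$, $[(142);+-+-]$. Dimension 5: 21. $\left(\frac{-\mathbf 1-\mathbf k}{\sqrt2},\frac{-\mathbf 1+\mathbf k}{\sqrt2}\right)$, $[(14);+++-]$. 22. $\left(\frac{-\mathbf 1-\mathbf i}{\sqrt2},\frac{-\mathbf j+\mathbf k}{\sqrt2}\right)$, $[(1324);--+-]$. 23. $\left(\frac{-\mathbf 1-\mathbf i}{\sqrt2},\frac{\mathbf j+\mathbf k}{\sqrt2}\right)$, $[(1423);+---]$. Dimension 6: 24. $(-\mathbf 1,\mathbf k)$, $[(14)(23);+-+-]$.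
   Context: A smooth curve $\gamma:[0,1]\to\mathbb S^3\subset\mathbb R^4$ is locally convex if $\det(\gamma(t),\gamma'(t),\gamma''(t),\gamma'''(t))>0$ for all $t\in[0,1]$; its Frenet frame $\mathcal F_\gamma(t)\in SO_4$ is the Gram–Schmidt orthonormalization of $(\gamma(t),\gamma'(t),\gamma''(t),\gamma'''(t))$. $\mathcal L\mathbb S^3$ is the set of locally convex curves with $\mathcal F_\gamma(0)=I$. $\mathbb H$ denotes the quaternions with basis $\mathbf 1,\mathbf i,\mathbf j,\mathbf k$, $\mathbb S^3$ the unit quaternions, and $\mathrm{Spin}_4\simeq\mathbb S^3\times\mathbb S^3$ with covering $\Pi_4:\mathbb S^3\times\mathbb S^3\to SO_4$, $\Pi_4(z_l,z_r)q=z_lq\bar z_r$ for $q\in\mathbb H\simeq\mathbb R^4$ (basis $\mathbf 1,\mathbf i,\mathbf j,\mathbf k$ corresponding to $e_1,e_2,e_3,e_4$). For $\gamma\in\mathcal L\mathbb S^3$, $\tilde{\mathcal F}_\gamma:[0,1]\to\mathbb S^3\times\mathbb S^3$ is the continuous lift of $\mathcal F_\gamma$ with $\tilde{\mathcal F}_\gamma(0)=(\mathbf 1,\mathbf 1)$. $B_4^+\subset SO_4$ is the group of signed permutation matrices of determinant $1$ and $\tilde B_4^+=\Pi_4^{-1}(B_4^+)$. With $Up_4^+$ the group of upper triangular $4\times4$ matrices with positive diagonal, the Bruhat cell of $Q\in SO_4$ is $\{UQU'\in SO_4: U,U'\in Up_4^+\}$. An arc $\gamma:[t_0,t_1]\to\mathbb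 S^3$ is convex if every hyperplane $H\subset\mathbb R^4$ through the origin meets it in at most $3$ points counted with multiplicity, where endpoints are not counted and, for $t\in(t_0,t_1)$ with $\gamma(t)\in H$, the multiplicity is the smallest $k\ge1$ such that $\gamma^{(j)}(t)\in H$ for $0\le j\le k-1$ and $\gamma^{(k)}(t)\notin H$. A matrix $Q\in SO_4$ (resp. a spin $z\in\mathbb S^3\times\mathbb S^3$) is convex if there exist a curve $\gamma\in\mathcal L\mathbb S^3$ and $0\le t_0<t_1\le1$ such that the arc $\gamma|_{[t_0,t_1]}$ is convex and $(\mathcal F_\gamma(t_0))^{-1}\mathcal F_\gamma(t_1)=Q$ (resp. $(\tilde{\mathcal F}_\gamma(t_0))^{-1}\tilde{\mathcal F}_\gamma(t_1)=z$). *)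

(* Defs.v *)
From HB Require Import structures.
From mathcomp Require Import all_boot all_order all_algebra all_fingroup.
From mathcomp Require Import all_classical all_reals all_analysis.
Set Implicit Arguments.
Unset Strict Implicit.
Unset Printing Implicit Defensive.
Import Order.TTheory GRing.Theory Num.Theory.
Import numFieldNormedType.Exports.
Local Open Scope classical_set_scope.
Local Open Scope ring_scope.

Section Euclidean.
Variable R : realType.

(* The norm of the library on matrices is the sup norm; the Euclidean
   structure of R^4 is given by dot. *)
Definition dot (u v : 'cV[R]_4) : R := (u^T *m v) 0 0.

Definition S3 : set 'cV[R]_4 := [set q | dot q q = 1].

Definition SO4 : set 'M[R]_4 := [set Q | Q^T *m Q = 1%:M /\ \det Q = 1].

(* [es] accumulates the vectors that are already orthonormalized. *)
Fixpoint gram_schmidt_seq (es vs : seq 'cV[R]_4) : seq 'cV[R]_4 :=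
  if vs is v :: vs' then
    let u := v - \sum_(e <- es) dot e v *: e in
    gram_schmidt_seq (rcons es ((Num.sqrt (dot u u))^-1 *: u)) vs'
  else es.

Definition gram_schmidt (A : 'M[R]_4) : 'M[R]_4 :=
  \matrix_(i, j) (gram_schmidt_seq [::] [seq col k A | k <- enum 'I_4])`_j i 0.

End Euclidean.

Section Quaternions.
Variable R : realType.

(* Quaternions are identified with R^4, the basis 1, i, j, k being
   e_1, e_2, e_3, e_4. *)
Definition quat (a b c d : R) : 'cV[R]_4 := \col_i [:: a; b; c; d]`_i.

Definition q1 : 'cV[R]_4 := quat 1 0 0 0.
Definition qi : 'cV[R]_4 := quat 0 1 0 0.
Definition qj : 'cV[R]_4 := quat 0 0 1 0.
Definition qk : 'cV[R]_4 := quat 0 0 0 1.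

Definition qcoord (q : 'cV[R]_4) (n : nat) : R := q (inord n) 0.

Definition qmul (p q : 'cV[R]_4) : 'cV[R]_4 :=
  let a := qcoord p in let b := qcoord q in
  quat (a 0%N * b 0%N - a 1%N * b 1%N - a 2%N * b 2%N - a 3%N * b 3%N)
       (a 0%N * b 1%N + a 1%N * b 0%N + a 2%N * b 3%N - a 3%N * b 2%N)
       (a 0%N * b 2%N - a 1%N * b 3%N + a 2%N * b 0%N + a 3%N * b 1%N)
       (a 0%N * b 3%N + a 1%N * b 2%N - a 2%N * b 1%N + a 3%N * b 0%N).

Definition qconj (q : 'cV[R]_4) : 'cV[R]_4 :=
  let a := qcoord q in quat (a 0%N) (- a 1%N) (- a 2%N) (- a 3%N).

Definition qinv (q : 'cV[R]_4) : 'cV[R]_4 := (dot q q)^-1 *: qconj q.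

Definition quat_pair : Type := ('cV[R]_4 * 'cV[R]_4)%type.

Definition spin4 : set quat_pair := [set z | S3 z.1 /\ S3 z.2].

Definition spin_mul (z w : quat_pair) : quat_pair :=
  (qmul z.1 w.1, qmul z.2 w.2).
Definition spin_inv (z : quat_pair) : quat_pair := (qinv z.1, qinv z.2).

(* Column j is the image of e_j under q |-> z_l q \bar z_r. *)
Definition Pi4 (z : quat_pair) : 'M[R]_4 :=
  \matrix_(i, j) qmul (qmul z.1 (delta_mx j 0)) (qconj z.2) i 0.

End Quaternions.

Section SignedPermutations.
Variable R : realType.

(* Column j is eps_j e_(pi j). *)
Definition signed_perm_mx (pi : 'I_4 -> 'I_4) (eps : 'I_4 -> R) : 'M[R]_4 :=
  \matrix_(i, j) (if i == pi j then eps j else 0).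

Definition B4plus : set 'M[R]_4 :=
  [set Q | (exists (s : 'S_4) (eps : 'I_4 -> R),
              (forall j, eps j = 1 \/ eps j = -1) /\ Q = signed_perm_mx s eps)
           /\ \det Q = 1].

Definition B4plus_spin : set (quat_pair R) :=
  [set z | spin4 z /\ B4plus (Pi4 z)].

(* Product of disjoint cycles on {1, 2, 3, 4}; ordinals start at 0, whence the
   shift. *)
Definition cycles_fun (cs : seq (seq nat)) (j : 'I_4) : 'I_4 :=
  inord (foldr (@next nat) j.+1 cs).-1.

Definition bracket (cs : seq (seq nat)) (eps : seq R) : 'M[R]_4 :=
  signed_perm_mx (cycles_fun cs) (fun j => eps`_j).

End SignedPermutations.

Section BruhatCells.
Variable R : realType.

Definition Up4plus : set 'M[R]_4 :=
  [set U | (forall i j : 'I_4, (j < i)%N -> U i j = 0) /\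
           (forall i, 0 < U i i)].

Definition bruhat_cell (Q : 'M[R]_4) : set 'M[R]_4 :=
  [set P | SO4 P /\
           exists U U', [/\ Up4plus U, Up4plus U' & P = U *m Q *m U']].

Definition homeomorphic_to_Rn (d : nat) (S : set 'M[R]_4) : Prop :=
  exists (f : 'rV[R]_d -> 'M[R]_4) (g : 'M[R]_4 -> 'rV[R]_d),
    [/\ continuous f, {within S, continuous g},
        (forall x, S (f x)),
        (forall x, g (f x) = x) &
        (forall P, S P -> f (g P) = P)].

(* Dimension in the sense of topological manifolds. *)
Definition has_dimension (S : set 'M[R]_4) (d : nat) : Prop :=
  S !=set0 /\
  forall P, S P ->
    exists V : set 'M[R]_4, [/\ open V, V P & homeomorphic_to_Rn d (S `&` V)].

End BruhatCells.

Section Curves.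
Variable R : realType.
Implicit Types (gamma : R -> 'cV[R]_4) (t : R).

Definition smooth gamma : Prop :=
  forall (n : nat) (t : R), derivable (derive1n n gamma) t 1.

Definition jet_mx gamma t : 'M[R]_4 := \matrix_(i, j) derive1n j gamma t i 0.

(* A smooth curve on [0, 1] is represented by a smooth extension to R, of which
   only the restriction to [0, 1] is constrained or used: the derivatives at
   the endpoints are then the one-sided derivatives of the restriction. *)
Definition locally_convex gamma : Prop :=
  [/\ smooth gamma,
      (forall t, 0 <= t <= 1 -> S3 (gamma t)) &
      (forall t, 0 <= t <= 1 -> 0 < \det (jet_mx gamma t))].

Definition frenet gamma t : 'M[R]_4 := gram_schmidt (jet_mx gamma t).

Definition LS3 : set (R -> 'cV[R]_4) :=
  [set gamma | locally_convex gamma /\ frenet gamma 0 = 1%:M].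

Definition is_frenet_lift gamma (z : R -> quat_pair R) : Prop :=
  [/\ {within [set t : R | 0 <= t <= 1], continuous z},
      z 0 = (q1 R, q1 R),
      (forall t, 0 <= t <= 1 -> spin4 (z t)) &
      (forall t, 0 <= t <= 1 -> Pi4 (z t) = frenet gamma t)].

Definition has_multiplicity gamma (H : {vspace 'cV[R]_4}) t (k : nat) : Prop :=
  [/\ (1 <= k)%N,
      (forall j : nat, (j < k)%N -> derive1n j gamma t \in H) &
      derive1n k gamma t \notin H].

Definition convex_arc gamma (t0 t1 : R) : Prop :=
  forall H : {vspace 'cV[R]_4}, \dim H = 3%N ->
    exists (s : seq R) (m : R -> nat),
      [/\ uniq s,
          (forall t, (t \in s) <-> (t0 < t < t1 /\ gamma t \in H)),
          (forall t, t \in s -> has_multiplicity gamma H t (m t)) &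
          (\sum_(t <- s) m t <= 3)%N].

Definition convex_mx : set 'M[R]_4 :=
  [set Q | SO4 Q /\
    exists (gamma : R -> 'cV[R]_4) (t0 t1 : R),
      [/\ LS3 gamma, 0 <= t0, t0 < t1 & t1 <= 1] /\
      convex_arc gamma t0 t1 /\
      invmx (frenet gamma t0) *m frenet gamma t1 = Q].

Definition convex_spin : set (quat_pair R) :=
  [set z | spin4 z /\
    exists (gamma : R -> 'cV[R]_4) (zt : R -> quat_pair R) (t0 t1 : R),
      [/\ LS3 gamma, 0 <= t0, t0 < t1 & t1 <= 1] /\
      convex_arc gamma t0 t1 /\
      is_frenet_lift gamma zt /\
      spin_mul (spin_inv (zt t0)) (zt t1) = z].

End Curves.

Section ConvexList.
Variable R : realType.

Local Notation "''1'" := (q1 R) : ring_scope.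
Local Notation "''i'" := (qi R) : ring_scope.
Local Notation "''j'" := (qj R) : ring_scope.
Local Notation "''k'" := (qk R) : ring_scope.
Local Notation "q '//2'" := (2^-1 *: q) (at level 40).
Local Notation "q '//r2'" := ((Num.sqrt 2)^-1 *: q) (at level 40).
Local Notation "[p c ; a , b , d , e ]" := (bracket c%N [:: a; b; d; e])
  (at level 0, c at level 99).

(* Entries are (dimension of the Bruhat cell, convex spin, convex matrix). *)
Definition convex_list : seq (nat * quat_pair R * 'M[R]_4) :=
  [:: (0%N, ('1, - '1), [p [::]; -1, -1, -1, -1]);

      (1%N, (('1 - 'i) //r2, (- '1 - 'i) //r2), [p [:: [:: 1; 2]]; 1, -1, -1, -1]);
      (1%N, (('1 - 'k) //r2, (- '1 + 'k) //r2), [p [:: [:: 2; 3]]; -1, 1, -1, -1]);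
      (1%N, (('1 - 'i) //r2, (- '1 + 'i) //r2), [p [:: [:: 3; 4]]; -1, -1, 1, -1]);

      (2%N, (('1 - 'i + 'j - 'k) //2, (- '1 + 'i - 'j + 'k) //2),
         [p [:: [:: 2; 3; 4]]; -1, 1, 1, -1]);
      (2%N, (('1 - 'i - 'j - 'k) //2, (- '1 + 'i + 'j + 'k) //2),
         [p [:: [:: 2; 4; 3]]; -1, -1, -1, -1]);
      (2%N, (('1 - 'i - 'j - 'k) //2, (- '1 - 'i - 'j + 'k) //2),
         [p [:: [:: 1; 2; 3]]; 1, 1, -1, -1]);
      (2%N, (('1 - 'i + 'j - 'k) //2, (- '1 - 'i + 'j + 'k) //2),
         [p [:: [:: 1; 3; 2]]; -1, -1, -1, -1]);
      (2%N, (- 'i, - '1), [p [:: [:: 1; 2]; [:: 3; 4]]; 1, -1, 1, -1]);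

      (3%N, ((- 'i - 'k) //r2, (- 'i + 'k) //r2), [p [:: [:: 1; 3]]; -1, 1, -1, -1]);
      (3%N, ((- 'i - 'k) //r2, ('i + 'k) //r2), [p [:: [:: 2; 4]]; -1, -1, 1, -1]);
      (3%N, ((- 'i - 'k) //r2, (- '1 - 'j) //r2),
         [p [:: [:: 1; 2; 3; 4]]; 1, 1, 1, -1]);
      (3%N, ((- 'i - 'k) //r2, (- '1 + 'j) //r2),
         [p [:: [:: 1; 4; 3; 2]]; 1, -1, -1, -1]);
      (3%N, ((- 'i - 'j) //r2, (- '1 + 'k) //r2),
         [p [:: [:: 1; 2; 4; 3]]; 1, -1, -1, -1]);
      (3%N, ((- 'i + 'j) //r2, (- '1 + 'k) //r2),
         [p [:: [:: 1; 3; 4; 2]]; -1, -1, 1, -1]);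

      (4%N, ((- '1 - 'i + 'j - 'k) //2, (- '1 - 'i - 'j + 'k) //2),
         [p [:: [:: 1; 3; 4]]; -1, 1, 1, -1]);
      (4%N, ((- '1 - 'i - 'j - 'k) //2, (- '1 + 'i - 'j + 'k) //2),
         [p [:: [:: 1; 2; 4]]; 1, -1, 1, -1]);
      (4%N, (- 'i, 'k), [p [:: [:: 1; 3]; [:: 2; 4]]; -1, -1, -1, -1]);
      (4%N, ((- '1 - 'i - 'j - 'k) //2, (- '1 - 'i + 'j + 'k) //2),
         [p [:: [:: 1; 4; 3]]; 1, 1, -1, -1]);
      (4%N, ((- '1 - 'i + 'j - 'k) //2, (- '1 + 'i + 'j + 'k) //2),
         [p [:: [:: 1; 4; 2]]; 1, -1, 1, -1]);

      (5%N, ((- '1 - 'k) //r2, (- '1 + 'k) //r2), [p [:: [:: 1; 4]]; 1, 1, 1, -1]);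
      (5%N, ((- '1 - 'i) //r2, (- 'j + 'k) //r2),
         [p [:: [:: 1; 3; 2; 4]]; -1, -1, 1, -1]);
      (5%N, ((- '1 - 'i) //r2, ('j + 'k) //r2),
         [p [:: [:: 1; 4; 2; 3]]; 1, -1, -1, -1]);

      (6%N, (- '1, 'k), [p [:: [:: 1; 4]; [:: 2; 3]]; 1, -1, 1, -1]) ].

End ConvexList.

(* Main.v *)
(* Write [F] for the Frenet frame of a curve and [h = F(s)^T F(t)] for the
   frame transported along an arc.

   Necessity, matrices.  If the arc is convex on [t0, t1], no hyperplane contains
   both the [k]-jet at [s] and the [4-k]-jet at [t], so the south-west minors of
   [F(s)^T J(t)] ([J] the matrix of derivatives) do not vanish for
   [t0 < s < t < t1]; they are positive for [t] close to [s], hence everywhere.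
   Let [s] tend to [t0].  If [F(t0)^T F(t1)] is a signed permutation matrix, the
   rows of [F(t0)^T J(t)] vanish to prescribed orders at [t1], so that each minor
   is there equivalent to a Vandermonde determinant in these orders times signs
   of the matrix.  Positivity selects 24 matrices.

   Necessity, spins.  Let [(a+bi+cj+dk, p+qi+rj+sk)] be a lift of [h].  The
   function [s |a+bi| - a |rj+sk|] has no zero where the minors are positive, and
   it is positive when the arc is short; so it is positive for all [t < t1], and
   its sign just before [t1] tells the two lifts of the matrix apart.

   Existence.  Each matrix is reached by an explicit polynomial curve, normalized
   to the sphere, whose coordinates form a Chebyshev system on ]0, 1[: the
   Wronskians of the last [k] coordinates are positive, as their coefficients in
   [t/(1-t)] show, and Rolle's theorem bounds the number of zeros of a linear
   combination by 3.  A lift is a product of values of a local section of [Pi4].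

   Dimension.  [P] is in the Bruhat cell of a signed permutation matrix [Q] iff
   [Q^T P = L V] with [V] in [Up4plus] and [L] lower unipotent, supported on the
   inversions of the permutation; the entries of [L] are global coordinates. *)

Require Import Defs.
From HB Require Import structures.
From mathcomp Require Import all_boot all_order all_algebra all_fingroup.
From mathcomp Require Import all_classical all_reals all_analysis.
From mathcomp Require Import ring lra zify ssrZ.
Set Implicit Arguments.
Unset Strict Implicit.
Unset Printing Implicit Defensive.
Import Order.TTheory GRing.Theory Num.Theory.
Import numFieldNormedType.Exports.
Local Open Scope classical_set_scope.
Local Open Scope ring_scope.

(** The minors control the frame only at interior points: convexity does not count the endpoints of
    an arc, and at a signed permutation matrix most minors may vanish. The start [t0] therefore
    yields weak inequalities only; strictness is recovered near [t1], where the expansion shows that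
    no minor vanishes on a punctured neighbourhood. For spins, evaluating the separating function at
    the end of the arc is not enough: it is zero at eleven of the 24 spins. For these its sign just
    before [t1] is read off the leading terms of the frame, including the entries above the
    diagonal. The spins reached by the explicit curves are never computed. Each curve ends at the
    prescribed matrix and is convex, so the necessity argument forces its lift to end at the listed
    spin rather than at the opposite one. The discrete facts (selection of the 24 matrices,
    agreement of spins and matrices, jets and Wronskians of the curves, numbers of inversions) are
    settled by computation on integers; those that concern real matrices or polynomials are then
    carried to [R] by ring morphisms. *)

Notation o0 := (@Ordinal 4 0 isT).
Notation o1 := (@Ordinal 4 1 isT).
Notation o2 := (@Ordinal 4 2 isT).
Notation o3 := (@Ordinal 4 3 isT).

(** * Indices and determinants of size 4 *)

Lemma forall_ord4 (P : 'I_4 -> Prop) : P o0 -> P o1 -> P o2 -> P o3 -> forall i, P i.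
Proof.
move=> P0 P1 P2 P3 [[|[|[|[|//]]]] ltm].
- by rewrite (_ : Ordinal _ = o0)//; apply: val_inj.
- by rewrite (_ : Ordinal _ = o1)//; apply: val_inj.
- by rewrite (_ : Ordinal _ = o2)//; apply: val_inj.
- by rewrite (_ : Ordinal _ = o3)//; apply: val_inj.
Qed.

Lemma sum_ord4 (V : nmodType) (F : 'I_4 -> V) :
  \sum_i F i = F o0 + F o1 + F o2 + F o3.
Proof.
rewrite !big_ord_recl big_ord0 addr0 !addrA.
by do !(congr (_ + _); last by congr F; apply: val_inj); congr F; apply: val_inj.
Qed.

Lemma enum_ord4 : enum 'I_4 = [:: o0; o1; o2; o3].
Proof. by apply: (inj_map val_inj); rewrite val_enum_ord. Qed.

Lemma inord4 : (inord 0 = o0 :> 'I_4) * (inord 1 = o1 :> 'I_4) *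
  (inord 2 = o2 :> 'I_4) * (inord 3 = o3 :> 'I_4).
Proof. by do !split; apply: val_inj; rewrite /= inordK. Qed.

Section Det4.
Variable R : comNzRingType.

Lemma det_mx_fun2 (f : nat -> nat -> R) :
  \det (\matrix_(i < 2, j < 2) f i j) = f 0%N 0%N * f 1%N 1%N - f 0%N 1%N * f 1%N 0%N.
Proof.
rewrite (expand_det_row _ ord0) !big_ord_recl big_ord0 /cofactor !det_mx11 !mxE.
by rewrite /= /bump /= !(expr0, exprS); ring.
Qed.

(** Matrices given by functions on [nat] keep this form when a row and a column are deleted, so the
    Laplace expansion can be iterated. *)
Lemma minor_mx_fun n (f : nat -> nat -> R) (j : 'I_n.+1) :
  row' ord0 (col' j (\matrix_(i < n.+1, k < n.+1) f i k))
  = \matrix_(i < n, k < n) f i.+1 (bump j k).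
Proof. by apply/matrixP => i k; rewrite !mxE. Qed.

Lemma det_mx_fun3 (f : nat -> nat -> R) :
  \det (\matrix_(i < 3, j < 3) f i j) =
    f 0%N 0%N * (f 1%N 1%N * f 2%N 2%N - f 1%N 2%N * f 2%N 1%N)
  - f 0%N 1%N * (f 1%N 0%N * f 2%N 2%N - f 1%N 2%N * f 2%N 0%N)
  + f 0%N 2%N * (f 1%N 0%N * f 2%N 1%N - f 1%N 1%N * f 2%N 0%N).
Proof.
rewrite (expand_det_row _ ord0) !big_ord_recl big_ord0 /cofactor !minor_mx_fun.
by rewrite !(det_mx_fun2 (fun i k => f i.+1 (bump _ k))) !mxE /= /bump /= !(expr0, exprS); ring.
Qed.

Lemma det4 (A : 'M[R]_4) : \det A =
  A o0 o0 * (A o1 o1 * (A o2 o2 * A o3 o3 - A o2 o3 * A o3 o2)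
    - A o1 o2 * (A o2 o1 * A o3 o3 - A o2 o3 * A o3 o1)
    + A o1 o3 * (A o2 o1 * A o3 o2 - A o2 o2 * A o3 o1))
  - A o0 o1 * (A o1 o0 * (A o2 o2 * A o3 o3 - A o2 o3 * A o3 o2)
    - A o1 o2 * (A o2 o0 * A o3 o3 - A o2 o3 * A o3 o0)
    + A o1 o3 * (A o2 o0 * A o3 o2 - A o2 o2 * A o3 o0))
  + A o0 o2 * (A o1 o0 * (A o2 o1 * A o3 o3 - A o2 o3 * A o3 o1)
    - A o1 o1 * (A o2 o0 * A o3 o3 - A o2 o3 * A o3 o0)
    + A o1 o3 * (A o2 o0 * A o3 o1 - A o2 o1 * A o3 o0))
  - A o0 o3 * (A o1 o0 * (A o2 o1 * A o3 o2 - A o2 o2 * A o3 o1)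
    - A o1 o1 * (A o2 o0 * A o3 o2 - A o2 o2 * A o3 o0)
    + A o1 o2 * (A o2 o0 * A o3 o1 - A o2 o1 * A o3 o0)).
Proof.
pose f k l := A (inord k) (inord l).
have -> : A = \matrix_(i, j) f i j by apply/matrixP => i j; rewrite mxE /f !inord_val.
rewrite (expand_det_row _ ord0) !big_ord_recl big_ord0 /cofactor !minor_mx_fun.
rewrite !(det_mx_fun3 (fun i k => f i.+1 (bump _ k))) !mxE; move: f => f.
by rewrite /= /bump /= !(expr0, exprS); ring.
Qed.

End Det4.

(** * Gram-Schmidt orthonormalization *)

Section GramSchmidt.
Variable R : realType.
Implicit Types (u v w : 'cV[R]_4) (A B Q : 'M[R]_4).

Lemma dotE u v : dot u v =
  u o0 0 * v o0 0 + u o1 0 * v o1 0 + u o2 0 * v o2 0 + u o3 0 * v o3 0.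
Proof. by rewrite /dot !mxE sum_ord4 !mxE. Qed.

Lemma dotC u v : dot u v = dot v u.
Proof. by rewrite !dotE; ring. Qed.

Lemma dotBr u v w : dot u (v - w) = dot u v - dot u w.
Proof. by rewrite !dotE !mxE; ring. Qed.

Lemma dotZr c u v : dot u (c *: v) = c * dot u v.
Proof. by rewrite !dotE !mxE; ring. Qed.

Lemma dotZl c u v : dot (c *: u) v = c * dot u v.
Proof. by rewrite !dotE !mxE; ring. Qed.

Lemma dot_ge0 u : 0 <= dot u u.
Proof. by rewrite dotE !addr_ge0 // -expr2 sqr_ge0. Qed.

Lemma dot_eq0 u : dot u u = 0 -> u = 0.
Proof.
rewrite dotE => /eqP.
rewrite !paddr_eq0 ?addr_ge0 -?expr2 ?sqr_ge0 // !sqrf_eq0 => /andP[/andP[/andP[/eqP h0 /eqP h1] /eqP h2] /eqP h3].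
by apply/matrixP => i j; rewrite (ord1 j) !mxE; move: i; apply: forall_ord4.
Qed.

Definition normalize u : 'cV[R]_4 := (Num.sqrt (dot u u))^-1 *: u.
Definition reject (es : seq 'cV[R]_4) v : 'cV[R]_4 :=
  v - \sum_(e <- es) dot e v *: e.

Lemma normalizeK u : Num.sqrt (dot u u) *: normalize u = u.
Proof.
rewrite /normalize scalerA; have [/eqP h|h] := boolP (dot u u == 0).
  by rewrite (dot_eq0 h) scaler0.
by rewrite divff ?scale1r // sqrtr_eq0 -ltNge lt_neqAle eq_sym h dot_ge0.
Qed.

Lemma dot_normalize u : dot u u != 0 -> dot (normalize u) (normalize u) = 1.
Proof.
move=> h; have gt0 : 0 < dot u u by rewrite lt_neqAle eq_sym h dot_ge0.
rewrite /normalize dotZl dotZr mulrA -expr2 exprVn sqr_sqrtr ?dot_ge0 //.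
by rewrite mulVf.
Qed.

Lemma reject_nil v : reject [::] v = v.
Proof. by rewrite /reject big_nil subr0. Qed.

Lemma reject_cons e es v : reject (e :: es) v = reject es v - dot e v *: e.
Proof. by rewrite /reject big_cons opprD addrA addrAC. Qed.

Lemma dot_reject_cons u e es v :
  dot u (reject (e :: es) v) = dot u (reject es v) - dot e v * dot u e.
Proof. by rewrite reject_cons dotBr dotZr. Qed.

Lemma reject_cons_entry e es v i :
  reject (e :: es) v i 0 = reject es v i 0 - dot e v * e i 0.
Proof. by rewrite reject_cons !mxE. Qed.

Lemma dot_normalize_eq0 u v : dot u v = 0 -> dot u (normalize v) = 0.
Proof. by move=> h; rewrite /normalize dotZr h mulr0. Qed.

Definition gs0 A := normalize (reject [::] (col o0 A)).
Definition gs1 A := normalize (reject [:: gs0 A] (col o1 A)).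
Definition gs2 A := normalize (reject [:: gs0 A; gs1 A] (col o2 A)).
Definition gs3 A := normalize (reject [:: gs0 A; gs1 A; gs2 A] (col o3 A)).

Lemma gram_schmidtE A i j :
  gram_schmidt A i j = [:: gs0 A; gs1 A; gs2 A; gs3 A]`_j i 0.
Proof. by rewrite mxE enum_ord4. Qed.

Definition gs_diag A (j : 'I_4) : R :=
  let u := [:: reject [::] (col o0 A); reject [:: gs0 A] (col o1 A);
    reject [:: gs0 A; gs1 A] (col o2 A); reject [:: gs0 A; gs1 A; gs2 A] (col o3 A)]`_j
  in Num.sqrt (dot u u).

Definition gs_upper A : 'M[R]_4 := \matrix_(j, k)
  if (j < k)%N then dot ([:: gs0 A; gs1 A; gs2 A; gs3 A]`_j) (col k A)
  else if j == k then gs_diag A j else 0.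

(** The QR factorization. It covers singular matrices too, as [normalizeK] holds for the zero
    vector; invertibility can thus be read off the factors afterwards. *)
Lemma gram_schmidtK A : gram_schmidt A *m gs_upper A = A.
Proof.
apply/matrixP => i k; rewrite mxE sum_ord4 !gram_schmidtE ![gs_upper _ _ _]mxE.
have H u : normalize u i 0 * Num.sqrt (dot u u) = u i 0.
  by have /(congr1 (fun v : 'cV[R]_4 => v i 0)) := normalizeK u; rewrite mxE mulrC.
have colE l : col l A i 0 = A i l by rewrite mxE.
have := (H (reject [::] (col o0 A)), H (reject [:: gs0 A] (col o1 A)),
  H (reject [:: gs0 A; gs1 A] (col o2 A)), H (reject [:: gs0 A; gs1 A; gs2 A] (col o3 A))).
rewrite -/(gs0 A) -/(gs1 A) -/(gs2 A) -/(gs3 A) !reject_cons_entry !reject_nil !colE.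
move=> [[[h0 h1] h2] h3].
move: k; apply: (forall_ord4 (P := fun k => _ = A i k)); rewrite /gs_diag.
- by rewrite /= !mulr0 !addr0 !reject_nil h0.
- by rewrite /= !mulr0 !addr0 h1; ring.
- by rewrite /= !mulr0 !addr0 h2; ring.
- by rewrite /= h3; ring.
Qed.

Lemma det_upper A : (forall i j : 'I_4, (j < i)%N -> A i j = 0) ->
  \det A = A o0 o0 * A o1 o1 * A o2 o2 * A o3 o3.
Proof.
move=> h; rewrite det4 (h o1 o0) // (h o2 o0) // (h o3 o0) // (h o2 o1) //.
by rewrite (h o3 o1) // (h o3 o2) //; ring.
Qed.

Lemma gs_upper_low A (i j : 'I_4) : (j < i)%N -> gs_upper A i j = 0.
Proof.
by move=> ji; rewrite mxE ltnNge (ltnW ji) /= -val_eqE /= gtn_eqF.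
Qed.

(** Taking determinants in the factorization, each diagonal coefficient of the triangular factor is
    a factor of [\det A]. Orthogonality of the other factor is deduced from this. *)
Lemma gs_diag_neq0 A : \det A != 0 -> forall j, gs_diag A j != 0.
Proof.
rewrite -{1}(gram_schmidtK A) det_mulmx (det_upper (@gs_upper_low A)).
rewrite !mxE ltnn !eqxx !mulf_eq0 !negb_or => /andP[_ /andP[/andP[/andP[h0 h1] h2] h3]].
exact: (forall_ord4 (P := fun j => gs_diag A j != 0) h0 h1 h2 h3).
Qed.

Lemma Up4plus_gs_upper A : \det A != 0 -> Up4plus (gs_upper A).
Proof.
move=> dA; split=> [i j|i]; first exact: gs_upper_low.
by rewrite mxE ltnn eqxx lt_neqAle eq_sym (gs_diag_neq0 dA) sqrtr_ge0.
Qed.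

Lemma gram_schmidt_orth A : \det A != 0 ->
  (gram_schmidt A)^T *m gram_schmidt A = 1%:M.
Proof.
move=> dA; have dg := gs_diag_neq0 dA.
have nz u : Num.sqrt (dot u u) != 0 -> dot u u != 0.
  by apply: contra_neq => ->; rewrite sqrtr0.
have n0 := dot_normalize (nz _ (dg o0)); have n1 := dot_normalize (nz _ (dg o1)).
have n2 := dot_normalize (nz _ (dg o2)); have n3 := dot_normalize (nz _ (dg o3)).
rewrite /= -?/(gs0 A) -?/(gs1 A) -?/(gs2 A) -?/(gs3 A) in n0 n1 n2 n3.
have o01 : dot (gs0 A) (gs1 A) = 0.
  by apply: dot_normalize_eq0; rewrite dot_reject_cons reject_nil n0; ring.
have o02 : dot (gs0 A) (gs2 A) = 0.
  by apply: dot_normalize_eq0; rewrite !dot_reject_cons reject_nil n0 o01; ring.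
have o12 : dot (gs1 A) (gs2 A) = 0.
  by apply: dot_normalize_eq0; rewrite !dot_reject_cons reject_nil n1 (dotC _ (gs0 A)) o01; ring.
have o03 : dot (gs0 A) (gs3 A) = 0.
  by apply: dot_normalize_eq0; rewrite !dot_reject_cons reject_nil n0 o01 o02; ring.
have o13 : dot (gs1 A) (gs3 A) = 0.
  apply: dot_normalize_eq0; rewrite !dot_reject_cons reject_nil n1 (dotC _ (gs0 A)) o01 o12.
  by ring.
have o23 : dot (gs2 A) (gs3 A) = 0.
  apply: dot_normalize_eq0; rewrite !dot_reject_cons reject_nil n2 (dotC (gs2 A) (gs0 A)).
  by rewrite (dotC (gs2 A) (gs1 A)) o02 o12; ring.
apply/matrixP => i j; rewrite !mxE sum_ord4 ![_^T _ _]mxE !gram_schmidtE.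
rewrite -dotE; move: (gs0 A) (gs1 A) (gs2 A) (gs3 A) n0 n1 n2 n3 o01 o02 o12 o03 o13 o23.
move=> e0 e1 e2 e3 n0 n1 n2 n3 o01 o02 o12 o03 o13 o23.
move: i j; apply: forall_ord4; apply: forall_ord4; rewrite /= ?mulr1n ?mulr0n //.
all: by rewrite dotC.
Qed.

Lemma det_orth_sqr Q : Q^T *m Q = 1%:M -> \det Q ^+ 2 = 1.
Proof. by move=> /(congr1 determinant); rewrite det_mulmx det_tr det1 expr2. Qed.

Lemma Up4plus_det_gt0 A : Up4plus A -> 0 < \det A.
Proof. by move=> [lo di]; rewrite det_upper // !mulr_gt0. Qed.

Lemma gram_schmidt_det A : 0 < \det A -> \det (gram_schmidt A) = 1.
Proof.
move=> dA; have d0 : \det A != 0 by rewrite gt_eqF.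
have := Up4plus_det_gt0 (Up4plus_gs_upper d0); move: dA.
rewrite -{1}(gram_schmidtK A) det_mulmx => dA dU.
have dE : 0 < \det (gram_schmidt A) by rewrite -(pmulr_lgt0 _ dU).
by have /eqP := det_orth_sqr (gram_schmidt_orth d0); rewrite sqrf_eq1 => /orP[/eqP //|/eqP h]; move: dE; rewrite h; lra.
Qed.

Lemma SO4_gram_schmidt A : 0 < \det A -> SO4 (gram_schmidt A).
Proof.
by move=> h; split; [apply: gram_schmidt_orth; rewrite gt_eqF|apply: gram_schmidt_det].
Qed.

Lemma Up4plusM A B : Up4plus A -> Up4plus B -> Up4plus (A *m B).
Proof.
move=> [Al Ad] [Bl Bd]; split=> [i j ij|i]; rewrite mxE.
  rewrite big1 // => k _; have [ki|ik] := ltnP k i; first by rewrite Al ?mul0r.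
  by rewrite Bl ?mulr0 // (leq_trans ij).
rewrite (bigD1 i) //= big1 ?addr0 ?mulr_gt0 // => k ki.
have [lt|le] := ltnP k i; first by rewrite Al ?mul0r.
by rewrite Bl ?mulr0 // ltn_neqAle le andbT eq_sym val_eqE.
Qed.

Lemma Up4plus_unit A : Up4plus A -> A \in unitmx.
Proof. by move=> h; rewrite unitmxE unitfE gt_eqF // Up4plus_det_gt0. Qed.

(* Row [i] of [A^-1] is obtained by back substitution from [A^-1 A = 1]. *)
Lemma Up4plusV A : Up4plus A -> Up4plus (invmx A).
Proof.
move=> uA; have [lo di] := uA.
have E : forall i j, (invmx A *m A) i j = (i == j)%:R.
  by move=> i j; rewrite mulVmx ?Up4plus_unit // mxE.
set B := invmx A in E *.
have c0 : forall i, B i o0 = (i == o0)%:R / A o0 o0.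
  move=> i; have := E i o0; rewrite mxE sum_ord4 (lo o1) // (lo o2) // (lo o3) //.
  by rewrite !mulr0 !addr0 => <-; rewrite mulfK // gt_eqF.
have lower j : (forall i : 'I_4, (j <= i)%N -> forall k : 'I_4, (k < j)%N -> B i k = 0) ->
    forall i : 'I_4, (j <= i)%N -> forall jj : 'I_4, jj = j :> nat -> B i jj = (i == jj)%:R / A jj jj.
  move=> IH i ji jj jE; have := E i jj; rewrite mxE (bigD1 jj) //= big1 ?addr0.
    by move=> <-; rewrite mulfK // gt_eqF.
  move=> k kj; have [lt|le] := ltnP k j; first by rewrite IH ?mul0r.
  by rewrite lo ?mulr0 // jE ltn_neqAle le andbT -jE eq_sym val_eqE.
have low : forall j : nat, forall i : 'I_4, (j <= i)%N -> forall k : 'I_4, (k < j)%N -> B i k = 0.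
  elim=> [//|j IH] i ji k; rewrite ltnS leq_eqVlt => /orP[/eqP kj|kj].
    by rewrite (lower _ IH i (ltnW ji) k kj) -val_eqE /= kj gtn_eqF ?mul0r.
  by apply: IH; rewrite // ltnW.
split=> [i j|i]; first exact: low.
by rewrite (lower i (low i) i (leqnn _) i) // eqxx mul1r invr_gt0.
Qed.

Lemma orth_trmx_unit Q : Q^T *m Q = 1%:M -> invmx Q = Q^T.
Proof.
move=> h; have uQ : Q \in unitmx by have [] := mulmx1_unit h.
by rewrite -[RHS]mulmx1 -(mulmxV uQ) mulmxA h mul1mx.
Qed.

(** The inverse of [Q] is upper triangular and equals [Q^T], so [Q] is diagonal, with positive
    entries of square 1. *)
Lemma orth_Up4plus Q : Q^T *m Q = 1%:M -> Up4plus Q -> Q = 1%:M.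
Proof.
move=> oQ uQ; have [lo di] := uQ; have [lo' di'] := Up4plusV uQ.
rewrite orth_trmx_unit // in lo' di'.
have off i j : i != j -> Q i j = 0.
  rewrite -val_eqE neq_ltn => /orP[ij|ij]; last exact: lo.
  by have := lo' j i ij; rewrite mxE.
apply/matrixP => i j; rewrite !mxE; have [<-|ij] := eqVneq i j; last exact: off.
have /matrixP/(_ i i) := oQ; rewrite !mxE eqxx (bigD1 i) //= big1 ?addr0.
  rewrite mxE -expr2 => /eqP; rewrite sqrf_eq1 => /orP[/eqP //|/eqP h].
  by have := di i; rewrite h; lra.
by move=> k ki; rewrite mxE off ?mul0r.
Qed.

(** Uniqueness of the QR factorization: [Q'^T *m Q = U' *m invmx U] is both orthogonal and in
    [Up4plus]. *)
Lemma orth_factor_unique Q Q' U U' : Q^T *m Q = 1%:M -> Q'^T *m Q' = 1%:M ->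
  Up4plus U -> Up4plus U' -> Q *m U = Q' *m U' -> Q = Q'.
Proof.
move=> oQ oQ' uU uU' e.
have uQ' : Q' \in unitmx by have [] := mulmx1_unit oQ'.
have e2 : Q'^T *m Q = U' *m invmx U.
  by rewrite -[Q'^T *m Q]mulmx1 -(mulmxV (Up4plus_unit uU)) !mulmxA -[_ *m Q *m U]mulmxA e !mulmxA oQ' mul1mx.
have /orth_Up4plus h : (Q'^T *m Q)^T *m (Q'^T *m Q) = 1%:M.
  by rewrite trmx_mul trmxK mulmxA -[_ *m Q' *m Q'^T]mulmxA -(orth_trmx_unit oQ') mulmxV // mulmx1.
have {h} h : Q'^T *m Q = 1%:M by apply: h; rewrite e2; apply: Up4plusM => //; apply: Up4plusV.
by rewrite -[Q]mul1mx -(mulmxV uQ') (orth_trmx_unit oQ') -mulmxA h mulmx1.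
Qed.

(** The tool by which frames of explicit curves and points of Bruhat cells are identified:
    exhibiting a factorization replaces running the algorithm. *)
Lemma gram_schmidt_factor A Q U : Q^T *m Q = 1%:M -> Up4plus U -> A = Q *m U ->
  gram_schmidt A = Q.
Proof.
move=> oQ uU e; have dA : \det A != 0.
  rewrite e det_mulmx mulf_neq0 //; last by rewrite gt_eqF // Up4plus_det_gt0.
  by apply/eqP => h; have := det_orth_sqr oQ; rewrite h expr0n /= => /eqP; rewrite eq_sym oner_eq0.
apply: (orth_factor_unique (gram_schmidt_orth dA) oQ (Up4plus_gs_upper dA) uU).
by rewrite gram_schmidtK.
Qed.

(** * Continuity of the orthonormalization *)

Section Continuity.
Context {T : Type} (F : set_system T) {FF : Filter F}.

Definition cvg_vec (u : T -> 'cV[R]_4) (l : 'cV[R]_4) :=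
  forall i, u t i 0 @[t --> F] --> l i 0.

Lemma cvg_dot (u v : T -> 'cV[R]_4) lu lv : cvg_vec u lu -> cvg_vec v lv ->
  dot (u t) (v t) @[t --> F] --> dot lu lv.
Proof.
move=> hu hv; under eq_fun do rewrite dotE.
rewrite dotE; have c i : u t i 0 * v t i 0 @[t --> F] --> lu i 0 * lv i 0 by apply: cvgM.
by apply: cvgD => //; apply: cvgD => //; apply: cvgD.
Qed.

Lemma cvg_normalize (u : T -> 'cV[R]_4) lu : cvg_vec u lu -> dot lu lu != 0 ->
  cvg_vec (fun t => normalize (u t)) (normalize lu).
Proof.
move=> hu nz i; under eq_fun do rewrite mxE; rewrite mxE.
apply: cvgM => //; apply: cvgV.
  by rewrite sqrtr_eq0 -ltNge lt_neqAle eq_sym nz dot_ge0.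
by apply: (cvg_comp _ _ (cvg_dot hu hu)); exact: sqrt_continuous.
Qed.

Lemma cvg_reject_nil (v : T -> 'cV[R]_4) lv : cvg_vec v lv -> cvg_vec (fun t => reject [::] (v t)) (reject [::] lv).
Proof.
move=> h i; rewrite /reject; under eq_fun do rewrite big_nil subr0.
by rewrite big_nil subr0; exact: h.
Qed.

Lemma cvg_reject_cons (e : T -> 'cV[R]_4) le (es : T -> seq 'cV[R]_4) les (v : T -> 'cV[R]_4) lv :
  cvg_vec e le -> cvg_vec v lv ->
  cvg_vec (fun t => reject (es t) (v t)) (reject les lv) ->
  cvg_vec (fun t => reject (e t :: es t) (v t)) (reject (le :: les) lv).
Proof.
move=> he hv hes i; rewrite reject_cons_entry; under eq_fun do rewrite reject_cons_entry.
by apply: cvgB; [exact: hes | apply: cvgM; [exact: cvg_dot | exact: he]].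
Qed.

Lemma cvg_gram_schmidt (A : T -> 'M[R]_4) (A0 : 'M[R]_4) : \det A0 != 0 ->
  (forall i j, A t i j @[t --> F] --> A0 i j) ->
  forall i j, gram_schmidt (A t) i j @[t --> F] --> gram_schmidt A0 i j.
Proof.
move=> dA hA; have dg := gs_diag_neq0 dA.
have nz u : Num.sqrt (dot u u) != 0 -> dot u u != 0.
  by apply: contra_neq => ->; rewrite sqrtr0.
have hc k : cvg_vec (fun t => col k (A t)) (col k A0).
  by move=> i; under eq_fun do rewrite mxE; rewrite mxE; exact: hA.
have g0 : cvg_vec (fun t => gs0 (A t)) (gs0 A0).
  by apply: cvg_normalize; [exact: cvg_reject_nil | exact: nz _ (dg o0)].
have g1 : cvg_vec (fun t => gs1 (A t)) (gs1 A0).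
  apply: cvg_normalize; last exact: nz _ (dg o1).
  by apply: cvg_reject_cons => //; apply: cvg_reject_nil.
have g2 : cvg_vec (fun t => gs2 (A t)) (gs2 A0).
  apply: cvg_normalize; last exact: nz _ (dg o2).
  by do 2!apply: cvg_reject_cons => //; apply: cvg_reject_nil.
have g3 : cvg_vec (fun t => gs3 (A t)) (gs3 A0).
  apply: cvg_normalize; last exact: nz _ (dg o3).
  by do 3!apply: cvg_reject_cons => //; apply: cvg_reject_nil.
move=> i j; under eq_fun do rewrite gram_schmidtE; rewrite gram_schmidtE.
by move: j; apply: forall_ord4; [exact: g0|exact: g1|exact: g2|exact: g3].
Qed.

End Continuity.
End GramSchmidt.

(** * Smooth functions and their expansions *)

Section SmoothFunctions.
Variable R : realType.
Implicit Types (f g : R -> R) (p t : R).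

Definition smooth_fun f := forall n t, derivable (derive1n n f) t 1.

Lemma smooth_derive f n : smooth_fun f -> smooth_fun (derive1n n f).
Proof.
by move=> sf m t; rewrite /derive1n -iterD; exact: sf.
Qed.

Lemma smooth_is_derive f t : smooth_fun f -> is_derive t 1 f (derive1 f t).
Proof.
by move=> sf; rewrite derive1E; apply: derivableP; exact: (sf 0%N).
Qed.

Lemma smooth_continuous f : smooth_fun f -> continuous f.
Proof.
by move=> sf t; apply: differentiable_continuous; apply/derivable1_diffP; exact: (sf 0%N).
Qed.

Lemma cvg_at_dnbhs f p l : f p = l -> f t @[t --> p^'] --> l -> f t @[t --> p] --> l.
Proof.
move=> fp /cvgrPdist_le h; apply/cvgrPdist_le => e e0.
have := h e e0; rewrite near_withinE => H.
near=> x; have [->|xp] := eqVneq x p; first by rewrite fp subrr normr0 ltW.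
by move: xp; near: x.
Unshelve. all: by end_near. Qed.

Lemma cvg_expr {T : Type} (F : set_system T) {FF : Filter F} (u : T -> R) (l : R) n :
  u x @[x --> F] --> l -> u x ^+ n @[x --> F] --> l ^+ n.
Proof.
move=> ul; elim: n => [|n IH]; first by under eq_fun do rewrite expr0; exact: cvg_cst.
by under eq_fun do rewrite exprS; rewrite exprS; exact: cvgM.
Qed.

(** Induction on [n] by L'Hôpital's rule, applied to [f] and [(t - p) ^+ n.+1]. *)
Lemma taylor_lim f p n : smooth_fun f -> (forall j, (j < n)%N -> derive1n j f p = 0) ->
  f t / (t - p) ^+ n @[t --> p^'] --> derive1n n f p / n`!%:R.
Proof.
elim: n f => [|n IH] f sf f0.
  under eq_fun do rewrite expr0 divr1.
  rewrite fact0 divr1; apply: cvg_within_filter; exact: smooth_continuous.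
have {}IH : derive1n 1 f t / (t - p) ^+ n @[t --> p^'] -->
    derive1n n (derive1n 1 f) p / n`!%:R.
  apply: IH; first exact: smooth_derive.
  by move=> j jn; rewrite -derive1Sn; exact: f0.
set l := derive1n (n.+1) f p / _.
(* The rule asks for the limit of the quotient of the derivatives over a full neighbourhood of [p].
   At [p] itself the two derivatives are replaced by [l] and 1, whose quotient is the limit. *)
pose df x := if x == p then l else derive1 f x.
pose dg x := if x == p then 1 else n.+1%:R * (x - p) ^+ n.
apply: (@lhopital R f df (fun x => (x - p) ^+ n.+1) dg (p - 1) (p + 1)).
- by rewrite in_itv /=; apply/andP; split; lra.
- move=> x; rewrite !inE /= => -[_ /eqP/negbTE xp]; rewrite /df xp.
  exact: smooth_is_derive.
- move=> x; rewrite !inE /= => -[_ /eqP/negbTE xp]; rewrite /dg xp.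
  have -> : (fun y : R => (y - p) ^+ n.+1) = (id - cst p : R -> R) ^+ n.+1.
    by apply/funext => y; rewrite exprfctE.
  by apply: is_derive_eq; rewrite subr0 /GRing.scale /= mulr1 mulr_natl.
- have := smooth_continuous sf (x := p); rewrite /continuous_at.
  by have := f0 0%N isT; rewrite derive1n0 => ->.
- have : (x - p) ^+ n.+1 @[x --> p] --> (p - p) ^+ n.+1.
    by apply: cvg_expr; apply: cvgB; [exact: cvg_id|exact: cvg_cst].
  by rewrite subrr expr0n.
- move=> x; rewrite !inE /= => -[_ /eqP/negbTE xp]; rewrite /dg xp.
  by rewrite mulf_neq0 ?pnatr_eq0 // expf_neq0 // subr_eq0 xp.
apply: cvg_at_dnbhs; first by rewrite /df /dg eqxx divr1.
have -> : l = (n.+1%:R)^-1 * (derive1n n (derive1n 1 f) p / n`!%:R).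
  rewrite /l factS natrM invfM -derive1Sn; ring.
apply: (cvg_trans _ (cvgM (cvg_cst _) IH)).
apply: near_eq_cvg; rewrite near_withinE; near=> x => xp.
by rewrite /df /dg (negbTE xp) /= invfM mulrCA.
Unshelve. all: by end_near. Qed.

(* The derivatives of order larger than [n] are absorbed by powers of [t - p]. *)
Lemma taylor_lim_derive f p n j : smooth_fun f ->
  (forall i, (i < n)%N -> derive1n i f p = 0) ->
  derive1n j f t * (t - p) ^+ j / (t - p) ^+ n @[t --> p^'] -->
    (n ^_ j)%:R * (derive1n n f p / n`!%:R).
Proof.
move=> sf f0; have [jn|nj] := leqP j n.
  have H := @taylor_lim (derive1n j f) p (n - j) (@smooth_derive _ j sf).
  have {}H := H _.
  have -> : (n ^_ j)%:R * (derive1n n f p / n`!%:R) = derive1n (n - j) (derive1n j f) p / (n - j)`!%:R :> R.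
    rewrite /derive1n -iterD subnK // -(ffact_fact jn) natrM invfM.
    by rewrite mulrCA mulVKf // pnatr_eq0 -lt0n ffact_gt0.
  apply: cvg_trans (H _).
    apply: near_eq_cvg; rewrite near_withinE; near=> x => xp.
    have xp0 : x - p != 0 by rewrite subr_eq0.
    rewrite -{2}(subnK jn) exprD invfM mulrA.
    by rewrite [X in _ = X / _]mulrAC mulfK ?expf_neq0.
  move=> i inj; rewrite /derive1n -iterD; by apply: f0; rewrite addnC -ltn_subRL.
rewrite ffact_small // mul0r.
apply: cvg_trans (_ : derive1n j f t * (t - p) ^+ (j - n) @[t --> p^'] --> _).
  apply: near_eq_cvg; rewrite near_withinE; near=> x => xp.
  have xp0 : x - p != 0 by rewrite subr_eq0.
  by rewrite -[X in _ = _ * _ ^+ X / _](subnK (ltnW nj)) exprD mulrA mulfK ?expf_neq0.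
have : derive1n j f t * (t - p) ^+ (j - n) @[t --> p] --> derive1n j f p * (p - p) ^+ (j - n).
  apply: cvgM; first exact: (smooth_continuous (@smooth_derive _ j sf)).
  by apply: cvg_expr; apply: cvgB; [exact: cvg_id|exact: cvg_cst].
rewrite subrr expr0n subn_eq0 leqNgt nj mulr0.
exact: cvg_within_filter.
Unshelve. all: by end_near. Qed.

Lemma smooth_lincomb (a : R) f g : smooth_fun f -> smooth_fun g ->
  (forall n, derive1n n (fun t => a * f t + g t) =
             fun t => a * derive1n n f t + derive1n n g t) /\
  smooth_fun (fun t => a * f t + g t).
Proof.
move=> sf sg.
have H n t : is_derive t 1 (fun t => a * derive1n n f t + derive1n n g t)
    (a * derive1n n.+1 f t + derive1n n.+1 g t).
  have df : is_derive t 1 (derive1n n f) (derive1n n.+1 f t).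
    by rewrite derive1nS derive1E; apply: derivableP; exact: sf.
  have dg : is_derive t 1 (derive1n n g) (derive1n n.+1 g t).
    by rewrite derive1nS derive1E; apply: derivableP; exact: sg.
  have -> : (fun t => a * derive1n n f t + derive1n n g t) = a *: derive1n n f + derive1n n g.
    by apply/funext.
  by apply: is_derive_eq.
have E n : derive1n n (fun t => a * f t + g t) =
             fun t => a * derive1n n f t + derive1n n g t.
  elim: n => [//|n IH]; rewrite derive1nS IH; apply/funext => t.
  by rewrite derive1E; case: (H n t).
by split=> [|n t]; [exact: E | rewrite E; case: (H n t)].
Qed.

Lemma smooth_cst (c : R) : smooth_fun (fun _ : R => c) /\
  (forall n, derive1n n (fun=> c) = if n == 0%N then fun=> c else fun=> 0 :> R).
Proof.
have D (d : R) : derive1 (fun _ : R => d) = fun _ : R => 0 :> R.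
  by apply/funext => t; exact: derive1_cst.
have E n : derive1n n (fun _ : R => c) = if n == 0%N then fun=> c else fun=> 0 :> R.
  by elim: n => [//|n IH]; rewrite derive1nS IH; case: eqP => _; rewrite D.
by split=> // n t; rewrite E; case: eqP => _; exact: derivable_cst.
Qed.

Implicit Types (gamma : R -> 'cV[R]_4).

Lemma derive1n_coord gamma n i : smooth gamma ->
  derive1n n (fun t => gamma t i 0) = fun t => derive1n n gamma t i 0.
Proof.
move=> sg; elim: n => [//|n IH]; rewrite derive1nS IH; apply/funext => t.
by rewrite derive1E derive1nS derive1E (derive_mx (sg n t)) mxE.
Qed.

Lemma smooth_coord gamma i : smooth gamma -> smooth_fun (fun t => gamma t i 0).
Proof.
move=> sg n t; rewrite derive1n_coord //.
by have /derivable_mxP := sg n t; apply.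
Qed.

Lemma smooth_of_coord gamma : (forall i, smooth_fun (fun t => gamma t i 0)) -> smooth gamma.
Proof.
move=> sc.
have C n i j : (fun t => (\col_k derive1n n (fun t => gamma t k 0) t : 'cV[R]_4) i j) =
    derive1n n (fun t => gamma t i 0).
  by apply/funext => t; rewrite mxE.
have E n : derive1n n gamma = fun t => \col_i derive1n n (fun t => gamma t i 0) t.
  elim: n => [|n IH]; first by apply/funext => t; apply/matrixP => i j; rewrite mxE (ord1 j).
  rewrite derive1nS IH; apply/funext => t; rewrite derive1E derive_mx.
    by apply/matrixP => i j; rewrite [LHS]mxE C mxE derive1nS derive1E.
  by apply/derivable_mxP => i j; rewrite C; exact: sc.
by move=> n t; rewrite E; apply/derivable_mxP => i j; rewrite C; exact: sc.
Qed.

Lemma jet_mxE gamma t i j : smooth gamma ->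
  jet_mx gamma t i j = derive1n j (fun t => gamma t i 0) t.
Proof. by move=> sg; rewrite mxE derive1n_coord. Qed.

Lemma smooth_mulmx (M : 'M[R]_4) gamma : smooth gamma ->
  smooth (fun t => M *m gamma t) /\
  forall t, jet_mx (fun t => M *m gamma t) t = M *m jet_mx gamma t.
Proof.
move=> sg; have sc i : smooth_fun (fun t => gamma t i 0) by exact: smooth_coord.
have [sz Ez] := smooth_cst 0.
(* Nested so that [smooth_lincomb] adds one coordinate at a time, starting from the constant 0. *)
pose h3 i t := M i o3 * gamma t o3 0 + 0.
pose h2 i t := M i o2 * gamma t o2 0 + h3 i t.
pose h1 i t := M i o1 * gamma t o1 0 + h2 i t.
pose h0 i t := M i o0 * gamma t o0 0 + h1 i t.
have H3 i := @smooth_lincomb (M i o3) _ _ (sc o3) sz.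
have H2 i := @smooth_lincomb (M i o2) _ _ (sc o2) (H3 i).2.
have H1 i := @smooth_lincomb (M i o1) _ _ (sc o1) (H2 i).2.
have H0 i := @smooth_lincomb (M i o0) _ _ (sc o0) (H1 i).2.
have E i : (fun t => (M *m gamma t) i 0) = h0 i.
  by apply/funext => t; rewrite mxE sum_ord4 /h0 /h1 /h2 /h3 addr0 !addrA.
have sM : smooth (fun t => M *m gamma t).
  by apply: smooth_of_coord => i; rewrite E; exact: (H0 i).2.
split=> // t; apply/matrixP => i j.
rewrite jet_mxE // E (H0 i).1 (H1 i).1 (H2 i).1 (H3 i).1 Ez mxE sum_ord4 !jet_mxE //.
by case: eqP; rewrite addr0 !addrA.
Qed.

(** [sw1], [sw2] and [sw3] are the minors on the last k rows and the first k columns, for k = 1, 2,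
    3. *)
Definition sw1 (A : 'M[R]_4) := A o3 o0.
Definition sw2 (A : 'M[R]_4) := A o2 o0 * A o3 o1 - A o2 o1 * A o3 o0.
Definition sw3 (A : 'M[R]_4) :=
  A o1 o0 * (A o2 o1 * A o3 o2 - A o2 o2 * A o3 o1)
  - A o1 o1 * (A o2 o0 * A o3 o2 - A o2 o2 * A o3 o0)
  + A o1 o2 * (A o2 o0 * A o3 o1 - A o2 o1 * A o3 o0).

(** Leading coefficients of the Wronskians of the last k monomials [c i * T ^+ a i]: the falling
    factorials [a i ^_ j] reduce by column operations to powers of [a i], whence the Vandermonde
    products. *)
Definition sw_cst (a : 'I_4 -> nat) (c : 'I_4 -> R) : R * R * R :=
  (c o3, c o2 * c o3 * ((a o3)%:R - (a o2)%:R),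
   c o1 * c o2 * c o3 * ((a o2)%:R - (a o1)%:R) * ((a o3)%:R - (a o1)%:R) *
     ((a o3)%:R - (a o2)%:R)).

Lemma ffact2 (n : nat) : (n ^_ 2)%:R = n%:R * (n%:R - 1) :> R.
Proof.
case: n => [|n]; first by rewrite mul0r.
by rewrite ffactnSr ffactn1 subSS subn0 natrM -[n.+1]addn1 natrD addrK.
Qed.

(* Rows that vanish to orders [a] at [p] have a Wronskian that behaves like
   that of the monomials [c i * (t - p) ^+ a i], i.e. like a Vandermonde
   determinant. *)
Lemma sw_near (K : R -> 'M[R]_4) p (a : 'I_4 -> nat) (c : 'I_4 -> R) :
  (forall i j, K t i j * (t - p) ^+ j / (t - p) ^+ a i @[t --> p^'] -->
     (a i ^_ j)%:R * c i) ->
  (forall i, c i != 0) -> injective a ->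
  \forall t \near p^',
    [/\ 0 < sw1 (K t) * (t - p) ^+ a o3 * (sw_cst a c).1.1,
        0 < sw2 (K t) * (t - p) ^+ (a o2 + a o3).+1 * (sw_cst a c).1.2 &
        0 < sw3 (K t) * (t - p) ^+ (a o1 + a o2 + a o3).+3 * (sw_cst a c).2].
Proof.
move=> H c0 ia.
pose g t i j := K t i j * (t - p) ^+ j / (t - p) ^+ a i.
have gE t i j : t != p -> K t i j * (t - p) ^+ j = (t - p) ^+ a i * g t i j.
  by move=> tp; rewrite /g [RHS]mulrC divfK // expf_neq0 // subr_eq0.
have aD (i j : 'I_4) : i != j -> (a i)%:R - (a j)%:R != 0 :> R.
  by rewrite subr_eq0 eqr_nat (inj_eq ia).
have pos (x : R) : x != 0 -> 0 < x * x by move=> h; rewrite -expr2 exprn_even_gt0.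
set C := sw_cst a c.
have C1 : C.1.1 != 0 by exact: c0.
have C2 : C.1.2 != 0 by rewrite /= !mulf_neq0 ?aD.
have C3 : C.2 != 0 by rewrite /= !mulf_neq0 ?aD.
have l1 : g t o3 o0 * C.1.1 @[t --> p^'] --> C.1.1 * C.1.1.
  by apply: cvgM; [have := H o3 o0; rewrite mul1r | exact: cvg_cst].
have l2 : (g t o2 o0 * g t o3 o1 - g t o2 o1 * g t o3 o0) * C.1.2 @[t --> p^'] --> C.1.2 * C.1.2.
  apply: cvgM; last exact: cvg_cst.
  have -> : C.1.2 = (a o2 ^_ o0)%:R * c o2 * ((a o3 ^_ o1)%:R * c o3) -
     (a o2 ^_ o1)%:R * c o2 * ((a o3 ^_ o0)%:R * c o3).
    by rewrite /C /= !ffactn0 !ffactn1; ring.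
  by apply: cvgB; apply: cvgM; exact: H.
have l3 : (g t o1 o0 * (g t o2 o1 * g t o3 o2 - g t o2 o2 * g t o3 o1)
  - g t o1 o1 * (g t o2 o0 * g t o3 o2 - g t o2 o2 * g t o3 o0)
  + g t o1 o2 * (g t o2 o0 * g t o3 o1 - g t o2 o1 * g t o3 o0)) * C.2
    @[t --> p^'] --> C.2 * C.2.
  apply: cvgM; last exact: cvg_cst.
  pose L i j := (a i ^_ j)%:R * c i.
  have -> : C.2 = L o1 o0 * (L o2 o1 * L o3 o2 - L o2 o2 * L o3 o1)
      - L o1 o1 * (L o2 o0 * L o3 o2 - L o2 o2 * L o3 o0)
      + L o1 o2 * (L o2 o0 * L o3 o1 - L o2 o1 * L o3 o0).
    by rewrite /C /L /= !ffactn0 !ffactn1 !ffact2; ring.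
  by apply: cvgD; [apply: cvgB|]; apply: cvgM; try exact: H; apply: cvgB; apply: cvgM; exact: H.
have n1 : \forall t \near p^', 0 < g t o3 o0 * C.1.1.
  by apply: (cvgr_gt (C.1.1 * C.1.1)) => //; exact: pos.
have {l2} /(_ _) n2 := cvgr_gt _ l2 _ (pos _ C2).
have {l3} /(_ _) n3 := cvgr_gt _ l3 _ (pos _ C3).
near=> t.
have tp : t != p by near: t; exact: nbhs_dnbhs_neq.
have t0 n : 0 < (t - p) ^+ n * (t - p) ^+ n by rewrite pos // expf_neq0 // subr_eq0.
have e0 i : K t i o0 = (t - p) ^+ a i * g t i o0 by rewrite -gE // expr0 mulr1.
have e1 i : K t i o1 * (t - p) = (t - p) ^+ a i * g t i o1 by rewrite -gE // expr1.
have e2 i : K t i o2 * (t - p) ^+ 2 = (t - p) ^+ a i * g t i o2 by rewrite -gE.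
(* A minor of size k has order the sum of its [a i] minus k(k-1)/2, that is minus 0, 1 or 3. The
   powers of [t - p] in the statement complete this to an even exponent, so that a square remains,
   times a factor with positive limit, on both sides of [p]. *)
rewrite -/C; split.
- have -> : sw1 (K t) * (t - p) ^+ a o3 * C.1.1 =
    (t - p) ^+ a o3 * (t - p) ^+ a o3 * (g t o3 o0 * C.1.1).
    by rewrite /sw1 e0; ring.
  by rewrite mulr_gt0 //; near: t.
- have -> : sw2 (K t) * (t - p) ^+ (a o2 + a o3).+1 * C.1.2 =
    (t - p) ^+ (a o2 + a o3) * (t - p) ^+ (a o2 + a o3) *
    ((g t o2 o0 * g t o3 o1 - g t o2 o1 * g t o3 o0) * C.1.2).
    rewrite exprS; transitivity ((K t o2 o0 * (K t o3 o1 * (t - p)) -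
      (K t o2 o1 * (t - p)) * K t o3 o0) * (t - p) ^+ (a o2 + a o3) * C.1.2).
      by rewrite /sw2; ring.
    by rewrite !e0 !e1 exprD; ring.
  by rewrite mulr_gt0 //; near: t.
have -> : sw3 (K t) * (t - p) ^+ (a o1 + a o2 + a o3).+3 * C.2 =
  (t - p) ^+ (a o1 + a o2 + a o3) * (t - p) ^+ (a o1 + a o2 + a o3) *
  ((g t o1 o0 * (g t o2 o1 * g t o3 o2 - g t o2 o2 * g t o3 o1)
  - g t o1 o1 * (g t o2 o0 * g t o3 o2 - g t o2 o2 * g t o3 o0)
  + g t o1 o2 * (g t o2 o0 * g t o3 o1 - g t o2 o1 * g t o3 o0)) * C.2).
  have -> : (t - p) ^+ (a o1 + a o2 + a o3).+3 =
      (t - p) * (t - p) ^+ 2 * (t - p) ^+ (a o1 + a o2 + a o3) by rewrite -exprS -exprD.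
  transitivity ((K t o1 o0 * (K t o2 o1 * (t - p) * (K t o3 o2 * (t - p) ^+ 2) -
      K t o2 o2 * (t - p) ^+ 2 * (K t o3 o1 * (t - p)))
    - K t o1 o1 * (t - p) * (K t o2 o0 * (K t o3 o2 * (t - p) ^+ 2) -
      K t o2 o2 * (t - p) ^+ 2 * K t o3 o0)
    + K t o1 o2 * (t - p) ^+ 2 * (K t o2 o0 * (K t o3 o1 * (t - p)) -
      K t o2 o1 * (t - p) * K t o3 o0)) * (t - p) ^+ (a o1 + a o2 + a o3) * C.2).
    by rewrite /sw3; ring.
  by rewrite !e0 !e1 !e2 !exprD; ring.
by rewrite mulr_gt0 //; near: t.
Unshelve. all: by end_near. Qed.

End SmoothFunctions.

(** * Convex arcs *)

Section Hyperplanes.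
Variable R : realType.
Implicit Types (n : 'rV[R]_4) (v : 'cV[R]_4) (H : {vspace 'cV[R]_4}).

Definition lform n : 'Hom('cV[R]_4, 'M[R]_1) := linfun (mulmx n).

Lemma memv_lform n v : (v \in lker (lform n)) = (n *m v == 0).
Proof. by rewrite memv_ker lfunE. Qed.

Lemma dim_lform n : n != 0 -> \dim (lker (lform n)) = 3%N.
Proof.
move=> n0; have := limg_ker_dim (lform n) fullv.
rewrite capfv dimvf dim_matrix.
suff -> : \dim (limg (lform n)) = 1%N by rewrite addn1 => -[].
apply/eqP; rewrite eqn_leq; apply/andP; split.
  by apply: leq_trans (dimvS (subvf _)) _; rewrite dimvf dim_matrix.
rewrite lt0n dimv_eq0; apply: contra n0 => /eqP im0.
apply/eqP/matrixP => i j; rewrite (ord1 i) mxE.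
have : lform n (delta_mx j 0) \in limg (lform n) by apply: memv_img; exact: memvf.
rewrite im0 memv0 lfunE /= -colE => /eqP/matrixP/(_ 0 0).
by rewrite !mxE.
Qed.

Lemma hyperplane_lform H : \dim H = 3%N ->
  exists2 n : 'rV[R]_4, n != 0 & forall v, (v \in H) = (n *m v == 0).
Proof.
move=> dH.
(* The basis has three vectors, so [nth] returns its default 0 for the last column. Thus [B] is
   singular, and a nonzero row killing its columns is an equation of [H]. *)
pose B : 'M[R]_4 := \matrix_(i, j) ((vbasis H)`_j i 0).
have sz : size (vbasis H) = 3%N by rewrite size_tuple.
have B3 i : B i o3 = 0 by rewrite mxE nth_default ?mxE // sz.
have /eqP/det0P[n n0 nB] : \det B = 0 by rewrite det4 !B3; ring.
exists n => // v; rewrite -memv_lform.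
suff /eqP -> : H == lker (lform n) by [].
rewrite eqEdim dim_lform // dH leqnn andbT.
apply/subvP => {}v vH; rewrite (coord_vbasis vH) rpred_sum // => k _.
rewrite rpredZ // memv_lform; apply/eqP/matrixP => i j; rewrite (ord1 i) (ord1 j).
have k4 : (k < 4)%N by rewrite (leq_trans (ltn_ord k)) // dH.
have /matrixP/(_ 0 (Ordinal k4)) := nB; rewrite mxE [RHS]mxE => e.
rewrite mxE [RHS]mxE -[RHS]e.
by apply: eq_bigr => l _; rewrite !mxE.
Qed.
End Hyperplanes.

Section SignConstancy.
Variable R : realType.
Implicit Types (f : R -> R) (a b p x : R).

Lemma near_dnbhs_right p (P : set R) : (\forall x \near p^', P x) -> \forall x \near p^'+, P x.
Proof.
by rewrite !near_withinE; apply: filterS => x Px px; apply: Px; rewrite gt_eqF.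
Qed.

Lemma near_dnbhs_left p (P : set R) : (\forall x \near p^', P x) -> \forall x \near p^'-, P x.
Proof.
by rewrite !near_withinE; apply: filterS => x Px px; apply: Px; rewrite lt_eqF.
Qed.

Lemma pos_of_pos_near f a b : (forall x, a < x < b -> {for x, continuous f}) ->
  (forall x, a < x < b -> f x != 0) ->
  (\forall x \near a^'+, 0 < f x) -> forall x, a < x < b -> 0 < f x.
Proof.
move=> cf nz fp x /andP[ax xb]; rewrite ltNge; apply/negP => fx.
have : \forall y \near a^'+, [/\ 0 < f y, a < y & y < x].
  near=> y; split; [by near: y|by near: y; exact: nbhs_right_gt|].
  by near: y; exact: nbhs_right_lt.
case/(@filter_ex _ _ (at_right_proper_filter a)) => y [fy ay yx].
have [||c] := @IVT R f y x 0 (ltW yx).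
- apply: continuous_in_subspaceT => z; rewrite inE /= in_itv /= => /andP[yz zx].
  by apply: cf; rewrite (lt_le_trans ay yz) (le_lt_trans zx xb).
- by rewrite ge_min fx orbT le_max (ltW fy).
rewrite in_itv /= => /andP[yc cx] fc.
have := nz c; rewrite fc eqxx (lt_le_trans ay yc) (le_lt_trans cx xb).
by move=> /(_ isT).
Unshelve. all: by end_near. Qed.

Lemma ge0_at_right f a : {for a, continuous f} -> (\forall x \near a^'+, 0 <= f x) -> 0 <= f a.
Proof. by move=> /cvg_at_right_filter /cvgr_to_ge h /h. Qed.

End SignConstancy.

Lemma sw_cst_id_gt0 (R : realType) (c : 'I_4 -> R) : (forall i, 0 < c i) ->
  [/\ 0 < (sw_cst (fun i => i : nat) c).1.1, 0 < (sw_cst (fun i => i : nat) c).1.2 &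
      0 < (sw_cst (fun i => i : nat) c).2].
Proof.
move=> c0; have d k l : (k < l)%N -> 0 < l%:R - k%:R :> R by move=> kl; rewrite subr_gt0 ltr_nat.
by split; rewrite /sw_cst; do ?apply: mulr_gt0; by [exact: c0 | exact: d].
Qed.

Lemma mul_trmx4 (R : pzSemiRingType) (A B : 'M[R]_4) i j : (A^T *m B) i j =
  A o0 i * B o0 j + A o1 i * B o1 j + A o2 i * B o2 j + A o3 i * B o3 j.
Proof. by rewrite mxE sum_ord4 !mxE. Qed.

Lemma cvg_trmx_mul (R : realType) (T : Type) (F : set_system T) {FF : Filter F}
  (A B : T -> 'M[R]_4) (A0 B0 : 'M[R]_4) :
  (forall i j, A t i j @[t --> F] --> A0 i j) -> (forall i j, B t i j @[t --> F] --> B0 i j) ->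
  forall i j, ((A t)^T *m B t) i j @[t --> F] --> (A0^T *m B0) i j.
Proof.
move=> hA hB i j; under eq_fun do rewrite mul_trmx4; rewrite mul_trmx4.
have c k : A t k i * B t k j @[t --> F] --> A0 k i * B0 k j by apply: cvgM.
by apply: cvgD => //; apply: cvgD => //; apply: cvgD.
Qed.

Section ConvexArcs.
Variable R : realType.
Variables (gamma : R -> 'cV[R]_4) (t0 t1 : R).
Hypothesis lc : Defs.locally_convex gamma.
Hypotheses (le0t0 : 0 <= t0) (lt01 : t0 < t1) (let1 : t1 <= 1).

Implicit Types (s t p : R).
Local Notation J := (jet_mx gamma).
Local Notation F := (frenet gamma).

Let sg : smooth gamma. Proof. by case: lc. Qed.

Lemma det_jet_gt0 t : 0 <= t <= 1 -> 0 < \det (J t).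
Proof. by case: lc => _ _ h /h. Qed.

Lemma jet_continuous t i j : J x i j @[x --> t] --> J t i j.
Proof.
under eq_fun do rewrite jet_mxE //; rewrite jet_mxE //.
apply: smooth_continuous; apply: smooth_derive; exact: smooth_coord.
Qed.

Lemma frenet_continuous t i j : 0 <= t <= 1 -> F x i j @[x --> t] --> F t i j.
Proof.
move=> t01; apply: cvg_gram_schmidt; first by rewrite gt_eqF // det_jet_gt0.
by move=> k l; exact: jet_continuous.
Qed.

Lemma frenet_orth t : 0 <= t <= 1 -> (F t)^T *m F t = 1%:M.
Proof. by move=> t01; apply: gram_schmidt_orth; rewrite gt_eqF // det_jet_gt0. Qed.

Lemma frenet_SO4 t : 0 <= t <= 1 -> SO4 (F t).
Proof. by move=> t01; apply: SO4_gram_schmidt; exact: det_jet_gt0. Qed.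

Lemma frenet_factor t : 0 <= t <= 1 -> exists2 U, Up4plus U & J t = F t *m U.
Proof.
move=> t01; exists (gs_upper (J t)); last by rewrite gram_schmidtK.
by apply: Up4plus_gs_upper; rewrite gt_eqF // det_jet_gt0.
Qed.

(* At an interior point [s], [F s]^T [J] is the jet of a curve whose [i]-th
   coordinate vanishes to order exactly [a i] there. *)
Lemma frame_cvg (M : 'M[R]_4) p (a : 'I_4 -> nat) :
  (forall i (j : 'I_4), (j < a i)%N -> (M *m J p) i j = 0) -> (forall i, (a i < 4)%N) ->
  forall i j : 'I_4, (M *m J t) i j * (t - p) ^+ j / (t - p) ^+ a i @[t --> p^'] -->
    (a i ^_ j)%:R * ((M *m J p) i (inord (a i)) / (a i)`!%:R).
Proof.
move=> h a4 i j; have [sM EM] := smooth_mulmx M sg.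
have E t k : (M *m J t) i k = derive1n k (fun t => (M *m gamma t) i 0) t.
  by rewrite -EM jet_mxE.
under eq_fun do rewrite E.
have -> : (M *m J p) i (inord (a i)) = derive1n (a i) (fun t => (M *m gamma t) i 0) p.
  by rewrite E inordK.
apply: taylor_lim_derive; first exact: smooth_coord.
move=> k ka; have k4 : (k < 4)%N := leq_trans ka (ltnW (a4 i)).
by have := h i (Ordinal k4) ka; rewrite E.
Qed.

Hypothesis conv : convex_arc gamma t0 t1.

(** The multiplicities at [s] and at [t] would add up to at least [k + l], more than the 3
    allowed. *)
Lemma convex_arc_no_hyperplane (n : 'rV[R]_4) s t (k l : nat) : n != 0 -> t0 < s -> s < t -> t < t1 ->
  (0 < k)%N -> (0 < l)%N -> (4 <= k + l)%N ->
  (forall j, (j < k)%N -> n *m derive1n j gamma s = 0) ->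
  (forall j, (j < l)%N -> n *m derive1n j gamma t = 0) -> False.
Proof.
move=> n0 t0s st tt1 k0 l0 kl hs ht.
have [ss [m [us ms hm sm]]] := conv (dim_lform n0).
have inH v : (v \in lker (lform n)) = (n *m v == 0) by rewrite memv_lform.
have ins : s \in ss.
  by apply/ms; rewrite t0s (lt_trans st tt1) inH; split=> //; apply/eqP; exact: (hs 0%N).
have int : t \in ss.
  by apply/ms; rewrite tt1 (lt_trans t0s st) inH; split=> //; apply/eqP; exact: (ht 0%N).
have mk : (k <= m s)%N.
  have [_ _] := hm s ins; rewrite inH leqNgt; apply: contra => h; apply/eqP; exact: hs.
have ml : (l <= m t)%N.
  have [_ _] := hm t int; rewrite inH leqNgt; apply: contra => h; apply/eqP; exact: ht.
have : (4 <= 3)%N.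
  apply: leq_trans sm; apply: leq_trans kl _; apply: leq_trans (leq_add mk ml) _.
  rewrite (big_rem s) //= leq_add2l (big_rem t) /= ?leq_addr //.
  by rewrite mem_rem_uniq // inE int andbT gt_eqF.
by [].
Qed.

Local Notation K s t := ((F s)^T *m J t).

Let le_s01 s t : t0 < s -> s < t -> t < t1 -> 0 <= s <= 1.
Proof.
move=> t0s st tt1; rewrite (le_trans le0t0 (ltW t0s)).
by rewrite (le_trans (ltW st)) // (le_trans (ltW tt1)).
Qed.

Definition two_jets (k : nat) s t : 'M[R]_4 :=
  \matrix_(i, j) if (j < k)%N then J s i j else J t i (inord (j - k)).

Lemma det_two_jets_neq0 k s t : t0 < s -> s < t -> t < t1 -> (0 < k < 4)%N ->
  \det (two_jets k s t) != 0.
Proof.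
move=> t0s st tt1 /andP[k0 k4]; apply/eqP => /eqP/det0P[n n0 nD].
have nDj j : \sum_i n 0 i * two_jets k s t i j = 0.
  by have /matrixP/(_ 0 j) := nD; rewrite !mxE.
have colJ u (j : 'I_4) : n *m derive1n j gamma u = 0 <-> \sum_i n 0 i * J u i j = 0.
  split=> [/matrixP/(_ 0 0)|h].
    by rewrite mxE [RHS]mxE => e; rewrite -[RHS]e; apply: eq_bigr => i _; rewrite mxE.
  apply/matrixP => i l; rewrite (ord1 i) (ord1 l) mxE [RHS]mxE -[RHS]h.
  by apply: eq_bigr => q _; rewrite mxE.
apply: (@convex_arc_no_hyperplane n s t k (4 - k) n0 t0s st tt1) => //.
- by rewrite subn_gt0.
- by rewrite subnKC // ltnW.
- move=> j jk; have j4 := ltn_trans jk k4.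
  apply/(colJ s (Ordinal j4)); rewrite -[RHS](nDj (Ordinal j4)).
  by apply: eq_bigr => i _; rewrite [in RHS]mxE /= jk.
- move=> j jk; have j4 : (j + k < 4)%N by rewrite addnC -ltn_subRL.
  have j4' : (j < 4)%N := leq_ltn_trans (leq_addr _ _) j4.
  apply/(colJ t (Ordinal j4')); rewrite -[RHS](nDj (Ordinal j4)).
  apply: eq_bigr => i _; rewrite [in RHS]mxE /= ltnNge leq_addl /= addnK.
  by congr (_ * J t i _); apply: val_inj; rewrite /= inordK.
Qed.

(** In the frame at [s] the jet at [s] is upper triangular with positive diagonal. The determinant
    of [two_jets k] is then the product of k positive diagonal entries and the south-west minor of
    size 4 - k of the jet at [t]. *)
Lemma sw_neq0 s t : t0 < s -> s < t -> t < t1 ->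
  [/\ sw1 (K s t) != 0, sw2 (K s t) != 0 & sw3 (K s t) != 0].
Proof.
move=> t0s st tt1; have s01 := le_s01 t0s st tt1.
have [U uU JE] := frenet_factor s01; have [Ul Ud] := uU.
have FJ : (F s)^T *m J s = U by rewrite JE mulmxA frenet_orth // mul1mx.
have E k i j : ((F s)^T *m two_jets k s t) i j =
    if (j < k)%N then U i j else K s t i (inord (j - k)).
  rewrite mxE; have [jk|jk] := ltnP j k.
    by rewrite -FJ mxE; apply: eq_bigr => l _; rewrite [two_jets _ _ _ _ _]mxE jk.
  rewrite [RHS]mxE; apply: eq_bigr => l _.
  by rewrite [two_jets _ _ _ _ _]mxE ltnNge jk.
have dF : \det (F s)^T = 1 by rewrite det_tr; have [] := frenet_SO4 s01.
have D k : (0 < k < 4)%N -> \det ((F s)^T *m two_jets k s t) != 0.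
  by move=> k4; rewrite det_mulmx dF mul1r det_two_jets_neq0.
have U10 := Ul o1 o0 isT; have U20 := Ul o2 o0 isT; have U30 := Ul o3 o0 isT.
have U21 := Ul o2 o1 isT; have U31 := Ul o3 o1 isT; have U32 := Ul o3 o2 isT.
split.
- have := D 3%N isT; rewrite det4 !E /= !inord4 U10 U20 U30 U21 U31 U32.
  by apply: contra => /eqP h; rewrite /sw1 in h; rewrite h; apply/eqP; ring.
- have := D 2%N isT; rewrite det4 !E /= !inord4 U10 U20 U30 U21 U31.
  apply: contra => /eqP h; apply/eqP.
  transitivity (U o0 o0 * U o1 o1 * sw2 (K s t)); first by rewrite /sw2; ring.
  by rewrite h mulr0.
- have := D 1%N isT; rewrite det4 !E /= !inord4 U10 U20 U30.
  apply: contra => /eqP h; apply/eqP.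
  transitivity (U o0 o0 * sw3 (K s t)); first by rewrite /sw3; ring.
  by rewrite h mulr0.
Qed.

Lemma K_continuous s t i j : K s x i j @[x --> t] --> K s t i j.
Proof.
have [sM EM] := smooth_mulmx ((F s)^T) sg.
under eq_fun do rewrite -EM jet_mxE //; rewrite -EM jet_mxE //.
apply: smooth_continuous; apply: smooth_derive; exact: smooth_coord.
Qed.

Lemma sw_continuous (A : R -> 'M[R]_4) t :
  (forall i j, A x i j @[x --> t] --> A t i j) ->
  [/\ {for t, continuous (fun x => sw1 (A x))}, {for t, continuous (fun x => sw2 (A x))} &
      {for t, continuous (fun x => sw3 (A x))}].
Proof.
move=> h; split; rewrite /prop_for /continuous_at; first exact: h.
  by apply: cvgB; apply: cvgM; exact: h.
by apply: cvgD; [apply: cvgB|]; apply: cvgM; try exact: h; apply: cvgB; apply: cvgM; exact: h.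
Qed.

Lemma sw_gt0 s t : t0 < s -> s < t -> t < t1 ->
  [/\ 0 < sw1 (K s t), 0 < sw2 (K s t) & 0 < sw3 (K s t)].
Proof.
move=> t0s st tt1; have s01 := le_s01 t0s st tt1.
have [U uU JE] := frenet_factor s01; have [Ul Ud] := uU.
have KE : K s s = U by rewrite JE mulmxA frenet_orth // mul1mx.
(* At [t = s] the matrix is upper triangular with positive diagonal: row [i] vanishes to order
   exactly [i], and all Vandermonde factors are positive. *)
pose a (i : 'I_4) := i : nat.
pose c (i : 'I_4) := K s s i (inord (a i)) / (a i)`!%:R.
have c0 i : 0 < c i.
  by rewrite /c KE /a inord_val divr_gt0 // ltr0n fact_gt0.
have h1 i (j : 'I_4) : (j < a i)%N -> K s s i j = 0 by move=> ji; rewrite KE Ul.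
have near_s := near_dnbhs_right (sw_near (frame_cvg h1 (fun i => ltn_ord i))
  (fun i => lt0r_neq0 (c0 i)) val_inj).
have pos : \forall x \near s^'+, [/\ 0 < sw1 (K s x), 0 < sw2 (K s x) & 0 < sw3 (K s x)].
  near=> x.
  have sx : 0 < x - s by rewrite subr_gt0; near: x; exact: nbhs_right_gt.
  have [] : [/\ 0 < sw1 (K s x) * (x - s) ^+ a o3 * (sw_cst a c).1.1,
        0 < sw2 (K s x) * (x - s) ^+ (a o2 + a o3).+1 * (sw_cst a c).1.2 &
        0 < sw3 (K s x) * (x - s) ^+ (a o1 + a o2 + a o3).+3 * (sw_cst a c).2] by near: x.
  have [C1 C2 C3] := sw_cst_id_gt0 c0.
  by rewrite !(pmulr_lgt0 _ C1) !(pmulr_lgt0 _ C2) !(pmulr_lgt0 _ C3) !pmulr_lgt0 ?exprn_gt0.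
have st1 : s < t < t1 by rewrite st.
have nz x : s < x < t1 -> _ := fun h => sw_neq0 t0s (andP h).1 (andP h).2.
have ct x := @sw_continuous (fun x => K s x) x (@K_continuous s x).
split.
- apply: (@pos_of_pos_near R (fun x => sw1 (K s x)) s t1 _ _ _ t st1) => [x _|x /nz[]//|]; first by case: (ct x).
  by apply: filterS pos => x [].
- apply: (@pos_of_pos_near R (fun x => sw2 (K s x)) s t1 _ _ _ t st1) => [x _|x /nz[]//|]; first by case: (ct x).
  by apply: filterS pos => x [].
- apply: (@pos_of_pos_near R (fun x => sw3 (K s x)) s t1 _ _ _ t st1) => [x _|x /nz[]//|]; first by case: (ct x).
  by apply: filterS pos => x [].
Unshelve. all: by end_near. Qed.

Let t001 : 0 <= t0 <= 1. Proof. by rewrite le0t0 (le_trans (ltW lt01)). Qed.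
Let t101 : 0 <= t1 <= 1. Proof. by rewrite let1 (le_trans le0t0) // ltW. Qed.

Lemma frame_continuous t i j (B : 'M[R]_4) : 0 <= t <= 1 ->
  ((F x)^T *m B) i j @[x --> t] --> ((F t)^T *m B) i j.
Proof.
move=> tI; apply: cvg_trmx_mul => k l; [exact: frenet_continuous | exact: cvg_cst].
Qed.

(** The point [t0] is an endpoint, whose contacts with hyperplanes are not counted. It is only
    approached by interior points, and strictness is lost in the limit. *)
Lemma sw_ge0 t : t0 < t -> t < t1 ->
  [/\ 0 <= sw1 (K t0 t), 0 <= sw2 (K t0 t) & 0 <= sw3 (K t0 t)].
Proof.
move=> t0t tt1.
have [c1 c2 c3] := @sw_continuous (fun x => K x t) t0
  (fun i j => @frame_continuous t0 i j (J t) t001).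
have near0 : \forall s \near t0^'+, t0 < s < t.
  near=> s; apply/andP; split; near: s; [exact: nbhs_right_gt | exact: nbhs_right_lt].
by split; [apply: (ge0_at_right c1)|apply: (ge0_at_right c2)|apply: (ge0_at_right c3)];
  apply: filterS near0 => s /andP[ts st]; have [? ? ?] := sw_gt0 ts st tt1; exact: ltW.
Unshelve. all: by end_near. Qed.

(** At [t1] row [i] is [e i] times row [a i] of an upper triangular matrix, so it vanishes to order
    [a i]. Near [t1] the minors are nonzero by [sw_near], which upgrades [sw_ge0] to strict
    positivity and determines the signs of the leading coefficients. *)
Lemma convex_signs (a : 'I_4 -> 'I_4) (e : 'I_4 -> R) : injective a ->
  (forall i, e i != 0) ->
  (forall i j, ((F t0)^T *m F t1) i j = if j == a i then e i else 0) ->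
  [/\ 0 < (-1) ^+ a o3 * (sw_cst a e).1.1, 0 < (-1) ^+ (a o2 + a o3).+1 * (sw_cst a e).1.2 &
      0 < (-1) ^+ (a o1 + a o2 + a o3).+3 * (sw_cst a e).2].
Proof.
move=> ia e0 QE; have [U uU JE] := frenet_factor t101; have [Ul Ud] := uU.
have KE i j : K t0 t1 i j = e i * U (a i) j.
  rewrite JE mulmxA mxE (bigD1 (a i)) //= big1 ?addr0 => [|k ki]; rewrite QE.
    by rewrite eqxx.
  by rewrite (negbTE ki) mul0r.
pose w i := U (a i) (a i) / (a i)`!%:R.
have w0 i : 0 < w i by rewrite divr_gt0 // ltr0n fact_gt0.
pose c i := K t0 t1 i (inord (a i)) / (a i)`!%:R.
have cE i : c i = e i * w i by rewrite /c KE inord_val mulrA.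
have c0 i : c i != 0 by rewrite cE mulf_neq0 // gt_eqF.
have h1 i (j : 'I_4) : (j < a i)%N -> K t0 t1 i j = 0 by move=> ji; rewrite KE Ul ?mulr0.
have iav : injective (fun i => a i : nat) by move=> i j /val_inj /ia.
have := near_dnbhs_left (sw_near (frame_cvg h1 (fun i => ltn_ord (a i))) c0 iav).
rewrite -/c => near1.
have : \forall x \near t1^'-, [/\ t0 < x, x < t1 & [/\ 0 < sw1 (K t0 x) * (x - t1) ^+ a o3 * (sw_cst a c).1.1,
        0 < sw2 (K t0 x) * (x - t1) ^+ (a o2 + a o3).+1 * (sw_cst a c).1.2 &
        0 < sw3 (K t0 x) * (x - t1) ^+ (a o1 + a o2 + a o3).+3 * (sw_cst a c).2]].
  near=> x; split; [| |by near: x]; near: x; [exact: nbhs_left_gt|exact: nbhs_left_lt].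
case/(@filter_ex _ _ (at_left_proper_filter t1)) => x [tx xt [p1 p2 p3]].
have [q1 q2 q3] := sw_ge0 tx xt.
have tx0 : 0 < t1 - x by rewrite subr_gt0.
(* To the left of [t1] the factor [x - t1] is negative, which produces [(-1) ^+ n]. The minor [X]
   cannot be zero because the whole product is positive. *)
have sgn n (X Y Z W : R) : 0 <= X -> 0 < W -> Y = W * Z -> 0 < X * (x - t1) ^+ n * Y ->
    0 < (-1) ^+ n * Z.
  move=> X0 W0 ->; have -> : x - t1 = -1 * (t1 - x) by ring.
  rewrite exprMn => p.
  have Xp : 0 < X by rewrite lt_neqAle X0 andbT eq_sym; apply: contraTneq p => ->; rewrite !mul0r ltxx.
  have : 0 < X * (t1 - x) ^+ n * W * ((-1) ^+ n * Z).
    by move: p; congr (_ < _); ring.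
  by rewrite pmulr_rgt0 // !mulr_gt0 // exprn_gt0.
split; [apply: sgn q1 _ _ p1|apply: sgn q2 _ _ p2|apply: sgn q3 _ _ p3].
- exact: (w0 o3).
- by rewrite /= cE mulrC.
- by apply: (mulr_gt0 (w0 o2) (w0 o3)).
- by rewrite /= !cE; ring.
- exact: (mulr_gt0 (mulr_gt0 (w0 o1) (w0 o2)) (w0 o3)).
- by rewrite /= !cE; ring.
Unshelve. all: by end_near. Qed.

End ConvexArcs.

(** * The list in integers *)

Section ListData.

(* Entries [(d, p, e, n, zl, zr)] encode, in integers, the dimension [d], the
   matrix with columns [e_j e_(p j)] and the spin [(zl, zr) / sqrt n]. *)
Definition entry : Type := (nat * seq nat * seq int * nat * seq int * seq int)%type.

Definition entries : seq entry :=
[:: (0%N, [:: 0; 1; 2; 3]%N, [:: -1; -1; -1; -1], 1%N, [:: 1; 0; 0; 0], [:: -1; 0; 0; 0]);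
  (1%N, [:: 1; 0; 2; 3]%N, [:: 1; -1; -1; -1], 2%N, [:: 1; -1; 0; 0], [:: -1; -1; 0; 0]);
  (1%N, [:: 0; 2; 1; 3]%N, [:: -1; 1; -1; -1], 2%N, [:: 1; 0; 0; -1], [:: -1; 0; 0; 1]);
  (1%N, [:: 0; 1; 3; 2]%N, [:: -1; -1; 1; -1], 2%N, [:: 1; -1; 0; 0], [:: -1; 1; 0; 0]);
  (2%N, [:: 0; 2; 3; 1]%N, [:: -1; 1; 1; -1], 4%N, [:: 1; -1; 1; -1], [:: -1; 1; -1; 1]);
  (2%N, [:: 0; 3; 1; 2]%N, [:: -1; -1; -1; -1], 4%N, [:: 1; -1; -1; -1], [:: -1; 1; 1; 1]);
  (2%N, [:: 1; 2; 0; 3]%N, [:: 1; 1; -1; -1], 4%N, [:: 1; -1; -1; -1], [:: -1; -1; -1; 1]);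
  (2%N, [:: 2; 0; 1; 3]%N, [:: -1; -1; -1; -1], 4%N, [:: 1; -1; 1; -1], [:: -1; -1; 1; 1]);
  (2%N, [:: 1; 0; 3; 2]%N, [:: 1; -1; 1; -1], 1%N, [:: 0; -1; 0; 0], [:: -1; 0; 0; 0]);
  (3%N, [:: 2; 1; 0; 3]%N, [:: -1; 1; -1; -1], 2%N, [:: 0; -1; 0; -1], [:: 0; -1; 0; 1]);
  (3%N, [:: 0; 3; 2; 1]%N, [:: -1; -1; 1; -1], 2%N, [:: 0; -1; 0; -1], [:: 0; 1; 0; 1]);
  (3%N, [:: 1; 2; 3; 0]%N, [:: 1; 1; 1; -1], 2%N, [:: 0; -1; 0; -1], [:: -1; 0; -1; 0]);
  (3%N, [:: 3; 0; 1; 2]%N, [:: 1; -1; -1; -1], 2%N, [:: 0; -1; 0; -1], [:: -1; 0; 1; 0]);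
  (3%N, [:: 1; 3; 0; 2]%N, [:: 1; -1; -1; -1], 2%N, [:: 0; -1; -1; 0], [:: -1; 0; 0; 1]);
  (3%N, [:: 2; 0; 3; 1]%N, [:: -1; -1; 1; -1], 2%N, [:: 0; -1; 1; 0], [:: -1; 0; 0; 1]);
  (4%N, [:: 2; 1; 3; 0]%N, [:: -1; 1; 1; -1], 4%N, [:: -1; -1; 1; -1], [:: -1; -1; -1; 1]);
  (4%N, [:: 1; 3; 2; 0]%N, [:: 1; -1; 1; -1], 4%N, [:: -1; -1; -1; -1], [:: -1; 1; -1; 1]);
  (4%N, [:: 2; 3; 0; 1]%N, [:: -1; -1; -1; -1], 1%N, [:: 0; -1; 0; 0], [:: 0; 0; 0; 1]);
  (4%N, [:: 3; 1; 0; 2]%N, [:: 1; 1; -1; -1], 4%N, [:: -1; -1; -1; -1], [:: -1; -1; 1; 1]);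
  (4%N, [:: 3; 0; 2; 1]%N, [:: 1; -1; 1; -1], 4%N, [:: -1; -1; 1; -1], [:: -1; 1; 1; 1]);
  (5%N, [:: 3; 1; 2; 0]%N, [:: 1; 1; 1; -1], 2%N, [:: -1; 0; 0; -1], [:: -1; 0; 0; 1]);
  (5%N, [:: 2; 3; 1; 0]%N, [:: -1; -1; 1; -1], 2%N, [:: -1; -1; 0; 0], [:: 0; 0; -1; 1]);
  (5%N, [:: 3; 2; 0; 1]%N, [:: 1; -1; -1; -1], 2%N, [:: -1; -1; 0; 0], [:: 0; 0; 1; 1]);
  (6%N, [:: 3; 2; 1; 0]%N, [:: 1; -1; 1; -1], 1%N, [:: -1; 0; 0; 0], [:: 0; 0; 0; 1])]
.

Definition ent (p : seq nat) (e : seq int) (i j : nat) : int :=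
  if i == nth 0%N p j then nth 0 e j else 0.

Variable R : realType.

Definition sgmx (p : seq nat) (e : seq int) : 'M[R]_4 :=
  \matrix_(i, j) (ent p e i j)%:~R.

Definition iquat (l : seq int) : 'cV[R]_4 :=
  quat (nth 0 l 0%N)%:~R (nth 0 l 1%N)%:~R (nth 0 l 2%N)%:~R (nth 0 l 3%N)%:~R.

Definition scal (n : nat) : R :=
  if n == 1%N then 1 else if n == 2%N then (Num.sqrt 2)^-1 else 2^-1.

Definition spin_of (n : nat) (zl zr : seq int) : quat_pair R :=
  (scal n *: iquat zl, scal n *: iquat zr).

Definition of_entry (x : entry) : nat * quat_pair R * 'M[R]_4 :=
  let: (d, p, e, n, zl, zr) := x in (d, spin_of n zl zr, sgmx p e).

Lemma bracketE cs l p (e : seq int) : l = [seq x%:~R | x <- e] -> size e = 4%N ->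
  [seq (foldr (@next nat) j.+1 cs).-1 | j <- iota 0 4] = p -> all (ltn^~ 4) p ->
  bracket cs l = sgmx p e.
Proof.
move=> -> se pE ap; apply/matrixP => i j; rewrite !mxE /ent.
have jp : nth 0%N p j = (foldr (@next nat) j.+1 cs).-1.
  by rewrite -pE (nth_map 0%N) ?size_iota // nth_iota.
have pj : (nth 0 p j < 4)%N by apply: (allP ap); apply: mem_nth; rewrite -pE size_map size_iota.
have -> : (i == cycles_fun cs j) = (i == nth 0%N p j :> nat).
  by rewrite -val_eqE /= /cycles_fun -jp inordK.
by case: eqP => // _; rewrite (nth_map 0) // se.
Qed.

Lemma quatD a b c d a' b' c' d' :
  quat a b c d + quat a' b' c' d' = quat (a + a') (b + b') (c + c') (d + d') :> 'cV[R]_4.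
Proof.
by apply/matrixP => i j; rewrite !mxE; move: i; apply: forall_ord4.
Qed.

Lemma quatN a b c d : - quat a b c d = quat (- a) (- b) (- c) (- d) :> 'cV[R]_4.
Proof.
by apply/matrixP => i j; rewrite !mxE; move: i; apply: forall_ord4.
Qed.

Lemma convex_listE : convex_list R = [seq of_entry x | x <- entries].
Proof.
rewrite /entries [RHS]/= /convex_list.
do !(congr (_ :: _); first by
  congr (_, (_, _), _);
  [ by rewrite /q1 /qi /qj /qk ?(quatN, quatD) /iquat /scal /= ?scale1r;
    do ?congr (_ *: _); congr quat; rewrite /=; ring
  | by rewrite /q1 /qi /qj /qk ?(quatN, quatD) /iquat /scal /= ?scale1r;
    do ?congr (_ *: _); congr quat; rewrite /=; ring
  | by apply: bracketE]).
Qed.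

End ListData.

(** * Quaternions and signed permutations *)

Section PiFour.

(** Stated over any ring, so that the same table serves for real spins and for integer computations
    on the list. *)
Definition pi4_entry (K : pzRingType) (a b c d p q r s : K) (i j : nat) : K :=
  nth 0 (nth [::] [:: [:: a * p + b * q + c * r + d * s;
     a * q - b * p - c * s + d * r;
     a * r + b * s - c * p - d * q;
     a * s - b * r + c * q - d * p];
   [:: - a * q + b * p - c * s + d * r;
     a * p + b * q - c * r - d * s;
     - a * s + b * r + c * q - d * p;
     a * r + b * s + c * p + d * q];
   [:: - a * r + b * s + c * p - d * q;
     a * s + b * r + c * q + d * p;
     a * p - b * q + c * r - d * s;
     - a * q - b * p + c * s + d * r];
   [:: - a * s - b * r + c * q + d * p;
     - a * r + b * s - c * p + d * q;
     a * q + b * p + c * s + d * r;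
     a * p - b * q - c * r + d * s]] i) j.

(** The linear inverse, up to the factor 4, of the passage from the outer product of [z.1] and [z.2]
    to the matrix [Pi4 z]. *)
Definition outer_entry (K : pzRingType) (P : 'M[K]_4) (i j : nat) : K :=
  nth 0 (nth [::] [:: [:: P o0 o0 + P o1 o1 + P o2 o2 + P o3 o3;
     P o0 o1 - P o1 o0 - P o2 o3 + P o3 o2;
     P o0 o2 + P o1 o3 - P o2 o0 - P o3 o1;
     P o0 o3 - P o1 o2 + P o2 o1 - P o3 o0];
   [:: - P o0 o1 + P o1 o0 - P o2 o3 + P o3 o2;
     P o0 o0 + P o1 o1 - P o2 o2 - P o3 o3;
     - P o0 o3 + P o1 o2 + P o2 o1 - P o3 o0;
     P o0 o2 + P o1 o3 + P o2 o0 + P o3 o1];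
   [:: - P o0 o2 + P o1 o3 + P o2 o0 - P o3 o1;
     P o0 o3 + P o1 o2 + P o2 o1 + P o3 o0;
     P o0 o0 - P o1 o1 + P o2 o2 - P o3 o3;
     - P o0 o1 - P o1 o0 + P o2 o3 + P o3 o2];
   [:: - P o0 o3 - P o1 o2 + P o2 o1 + P o3 o0;
     - P o0 o2 + P o1 o3 - P o2 o0 + P o3 o1;
     P o0 o1 + P o1 o0 + P o2 o3 + P o3 o2;
     P o0 o0 - P o1 o1 - P o2 o2 + P o3 o3]] i) j.

Variable R : realType.
Implicit Types (x y v : 'cV[R]_4) (z w : quat_pair R).

Lemma qmulE x y : qmul x y =
  quat (x o0 0 * y o0 0 - x o1 0 * y o1 0 - x o2 0 * y o2 0 - x o3 0 * y o3 0)
       (x o0 0 * y o1 0 + x o1 0 * y o0 0 + x o2 0 * y o3 0 - x o3 0 * y o2 0)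
       (x o0 0 * y o2 0 - x o1 0 * y o3 0 + x o2 0 * y o0 0 + x o3 0 * y o1 0)
       (x o0 0 * y o3 0 + x o1 0 * y o2 0 - x o2 0 * y o1 0 + x o3 0 * y o0 0).
Proof. by rewrite /qmul /qcoord !inord4. Qed.

Lemma quat_entries (a b c d : R) : ((quat a b c d) o0 0 = a) * ((quat a b c d) o1 0 = b) *
  ((quat a b c d) o2 0 = c) * ((quat a b c d) o3 0 = d).
Proof. by rewrite !mxE. Qed.

Lemma qconjE x : qconj x = quat (x o0 0) (- x o1 0) (- x o2 0) (- x o3 0).
Proof. by rewrite /qconj /qcoord !inord4. Qed.

Lemma Pi4E z (i j : 'I_4) : Pi4 z i j =
  pi4_entry (z.1 o0 0) (z.1 o1 0) (z.1 o2 0) (z.1 o3 0)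
    (z.2 o0 0) (z.2 o1 0) (z.2 o2 0) (z.2 o3 0) i j.
Proof.
case: z => x y /=; rewrite mxE /pi4_entry [qmul x _]qmulE qmulE qconjE !quat_entries.
by move: i j; apply: forall_ord4; apply: forall_ord4; rewrite quat_entries !mxE /=; ring.
Qed.

(* The products of a coordinate of [z.1] and one of [z.2] are linear in [Pi4 z]. *)
Lemma outer_Pi4 z (i j : 'I_4) : z.1 i 0 * z.2 j 0 = outer_entry (Pi4 z) i j / 4.
Proof.
rewrite /outer_entry; move: i j; apply: forall_ord4; apply: forall_ord4.
all: by rewrite /= !Pi4E /pi4_entry /=; field.
Qed.

Lemma qmulA x y v : qmul x (qmul y v) = qmul (qmul x y) v.
Proof. by rewrite !qmulE !quat_entries; congr quat; ring. Qed.

Lemma qconjM x y : qconj (qmul x y) = qmul (qconj y) (qconj x).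
Proof. by rewrite !qmulE !qconjE !quat_entries; congr quat; ring. Qed.

Lemma quat_eta x : x = quat (x o0 0) (x o1 0) (x o2 0) (x o3 0).
Proof.
by apply/matrixP => i j; rewrite (ord1 j) mxE; move: i; apply: forall_ord4.
Qed.

Lemma Pi4_act z v : Pi4 z *m v = qmul (qmul z.1 v) (qconj z.2).
Proof.
rewrite (quat_eta (Pi4 z *m v)) !qmulE !qconjE !quat_entries.
by congr quat; rewrite mxE sum_ord4 !Pi4E /pi4_entry /=; ring.
Qed.

Lemma Pi4M z w : Pi4 (spin_mul z w) = Pi4 z *m Pi4 w.
Proof.
apply/matrixP => i j; have E (A : 'M[R]_4) : A i j = (A *m delta_mx j (0 : 'I_1)) i 0.
  by rewrite -colE mxE.
rewrite E [RHS]E -mulmxA !Pi4_act /=; congr (fun_of_matrix _ i 0).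
by rewrite !qmulA qconjM !qmulA.
Qed.

Lemma spin_invE z : spin4 z -> spin_inv z = (qconj z.1, qconj z.2).
Proof. by case: z => x y [/= hx hy]; rewrite /spin_inv /qinv /= hx hy invr1 !scale1r. Qed.

Lemma Pi4V z : spin4 z -> Pi4 (spin_inv z) = (Pi4 z)^T.
Proof.
move=> sz; rewrite spin_invE //; apply/matrixP => i j; rewrite [RHS]mxE !Pi4E /=.
rewrite !qconjE !quat_entries.
by move: i j; apply: forall_ord4; apply: forall_ord4; rewrite /pi4_entry /=; ring.
Qed.

Lemma dot_qmul x y : dot (qmul x y) (qmul x y) = dot x x * dot y y.
Proof. by rewrite qmulE !dotE !quat_entries; ring. Qed.

Lemma dot_qconj x : dot (qconj x) (qconj x) = dot x x.
Proof. by rewrite qconjE !dotE !quat_entries; ring. Qed.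

Lemma spin4M z w : spin4 z -> spin4 w -> spin4 (spin_mul z w).
Proof.
by move=> [a b] [c d]; split; rewrite /S3 /= dot_qmul; [rewrite a c|rewrite b d]; rewrite mulr1.
Qed.

Lemma spin4V z : spin4 z -> spin4 (spin_inv z).
Proof.
by move=> sz; rewrite spin_invE //; case: sz => a b; split; rewrite /S3 /= dot_qconj.
Qed.

Lemma qconj_mul_norm x : S3 x -> qmul (qconj x) x = q1 R.
Proof.
rewrite /S3 /= dotE => h; rewrite qmulE qconjE !quat_entries /q1; congr quat; first by rewrite -h; ring.
all: ring.
Qed.

(** Equal images have equal outer products [z.1 i 0 * z.2 j 0], and these determine a pair of unit
    vectors up to a common sign. *)
Lemma Pi4_eq z w : spin4 z -> spin4 w -> Pi4 z = Pi4 w -> w = z \/ w = - z.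
Proof.
case: z w => [x y] [x' y'] [/= hx hy] [/= hx' hy'] e.
have O i j : x i 0 * y j 0 = x' i 0 * y' j 0.
  by have := outer_Pi4 (x, y) i j; rewrite /= e => ->; have := outer_Pi4 (x', y') i j.
rewrite /S3 /= in hx hy hx' hy'.
pose l := dot y y'.
have xE : x' = l *: x.
  apply/matrixP => i k; rewrite (ord1 k) mxE -[LHS]mulr1 -hy' /l !dotE.
  by rewrite !mulrDr !mulrA -!O; ring.
have yE : y' = l *: y.
  have -> : l = dot x x'.
    rewrite xE dotZr hx mulr1 //.
  apply/matrixP => i k; rewrite (ord1 k) mxE -[LHS]mulr1 -hx' !dotE.
  by rewrite mulrC !mulrDl -!mulrA -!O; ring.
have : l ^+ 2 = 1 by rewrite -hx' xE dotZl dotZr hx mulr1 expr2.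
move=> /eqP; rewrite sqrf_eq1 => /orP[/eqP l1|/eqP l1]; rewrite xE yE l1.
  by left; rewrite !scale1r.
by right; rewrite !scaleN1r.
Qed.

End PiFour.

(** * A function separating the two lifts of the open cell *)

Section SpinSign.
Variable R : realType.
Implicit Types (z : quat_pair R).

(* On the two components of the preimage of the open Bruhat cell this function
   has constant and opposite signs. *)
Definition spin_sign z : R :=
  z.2 o3 0 * Num.sqrt (z.1 o0 0 ^+ 2 + z.1 o1 0 ^+ 2) -
  z.1 o0 0 * Num.sqrt (z.2 o2 0 ^+ 2 + z.2 o3 0 ^+ 2).

Lemma spin_signN z : spin_sign (- z) = - spin_sign z.
Proof.
rewrite /spin_sign; case: z => x y /=; rewrite !mxE !sqrrN; ring.
Qed.

Lemma sw1_Pi4 z : sw1 (Pi4 z) = - z.1 o0 0 * z.2 o3 0 - z.1 o1 0 * z.2 o2 0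
  + z.1 o2 0 * z.2 o1 0 + z.1 o3 0 * z.2 o0 0.
Proof. by rewrite /sw1 Pi4E /pi4_entry /=; ring. Qed.

Lemma sw2_Pi4 z : sw2 (Pi4 z) =
  (z.1 o0 0 ^+ 2 + z.1 o1 0 ^+ 2) * (z.2 o2 0 ^+ 2 + z.2 o3 0 ^+ 2) -
  (z.1 o2 0 ^+ 2 + z.1 o3 0 ^+ 2) * (z.2 o0 0 ^+ 2 + z.2 o1 0 ^+ 2).
Proof. by rewrite /sw2 !Pi4E /pi4_entry /=; ring. Qed.

(** In a rotation a minor of size 3 equals, up to sign, the complementary entry: the right-hand side
    is minus the entry in the upper right corner. Multiplying it by the two norms, equal to 1, turns
    the claim into a polynomial identity. *)
Lemma sw3_Pi4 z : spin4 z -> sw3 (Pi4 z) = z.1 o3 0 * z.2 o0 0 + z.1 o1 0 * z.2 o2 0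
  - z.1 o0 0 * z.2 o3 0 - z.1 o2 0 * z.2 o1 0.
Proof.
move=> [h1 h2]; rewrite -[RHS]mulr1 -[X in _ = _ * X]h1 -[RHS]mulr1 -[X in _ = _ * X]h2 !dotE.
by rewrite /sw3 !Pi4E /pi4_entry /=; ring.
Qed.

(** The hypotheses are the three minors in the coordinates of a spin. If [sb = ar], the identity
    (a²+b²)(r²+s²) = (as+br)² + (ar-bs)² makes the first product in the minor of size 2 equal to
    (as+br)². The minor of size 1 gives dp+cq > as+br, while Cauchy-Schwarz bounds (dp+cq)² by the
    second product: a contradiction when as+br >= 0. If [sb = -ar], the same holds with as-br, dp-cq
    and the minor of size 3. *)
Lemma crossing_contradiction (a b c d p q r s : R) :
  0 < - a * s - b * r + c * q + d * p ->
  0 < (a ^+ 2 + b ^+ 2) * (r ^+ 2 + s ^+ 2) - (c ^+ 2 + d ^+ 2) * (p ^+ 2 + q ^+ 2) ->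
  0 < d * p + b * r - a * s - c * q ->
  0 <= a * s -> (s * b) ^+ 2 = (a * r) ^+ 2 -> False.
Proof.
move=> h1 h2 h3 A0 /eqP; rewrite eqf_sqr.
have cs (k : R) : k ^+ 2 = 1 -> (d * p + k * (c * q)) ^+ 2 <= (c ^+ 2 + d ^+ 2) * (p ^+ 2 + q ^+ 2).
  move=> k1; rewrite -subr_ge0; have -> : (c ^+ 2 + d ^+ 2) * (p ^+ 2 + q ^+ 2) -
      (d * p + k * (c * q)) ^+ 2 = (c * p - k * (d * q)) ^+ 2 + (1 - k ^+ 2) * ((c * q) ^+ 2 + (d * q) ^+ 2) by ring.
  by rewrite k1 subrr mul0r addr0 sqr_ge0.
have c1 := cs 1 (expr1n _ _); have c2 := cs (- 1) (etrans (sqrrN 1) (expr1n _ _)).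
have sq (x y : R) : 0 <= x -> x < y -> x ^+ 2 < y ^+ 2 by move=> x0 xy; rewrite ltr_pXn2r // ?nnegrE // (le_trans x0) // ltW.
case/orP => /eqP e.
  have AB : (a * s) * (b * r) = (a * r) ^+ 2 by rewrite expr2 -{2}e; ring.
  have E : (a ^+ 2 + b ^+ 2) * (r ^+ 2 + s ^+ 2) = (a * s + b * r) ^+ 2.
    have : (s * b) ^+ 2 = (a * r) ^+ 2 by rewrite e.
    by lra.
  have [S|S] := leP 0 (a * s + b * r).
    by have := sq _ (d * p + 1 * (c * q)) S; lra.
  (* When [as + br < 0], the inequalities [0 <= as] and [0 <= as * br] leave only [as = 0] and
     [br < 0]; the minor of size 3 then bounds [dp - cq] from below by [- br > 0]. *)
  have AB0 : 0 <= (a * s) * (b * r) by rewrite AB sqr_ge0.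
  have a0 : a * s = 0 by nra.
  have B : b * r < 0 by lra.
  have h : (- (b * r)) ^+ 2 < (d * p + -1 * (c * q)) ^+ 2 by apply: sq; lra.
  by rewrite a0 add0r in E; rewrite sqrrN in h; lra.
have AB : (a * s) * (b * r) = - (a * r) ^+ 2 by rewrite expr2 -{2}[a * r]opprK -e; ring.
have E : (a ^+ 2 + b ^+ 2) * (r ^+ 2 + s ^+ 2) = (a * s - b * r) ^+ 2.
  have : (s * b) ^+ 2 = (a * r) ^+ 2 by rewrite e sqrrN.
  by lra.
have [S|S] := leP 0 (a * s - b * r).
  by have := sq _ (d * p + -1 * (c * q)) S; lra.
have AB0 : (a * s) * (b * r) <= 0 by rewrite AB oppr_le0 sqr_ge0.
have a0 : a * s = 0 by nra.
have B : 0 < b * r by lra.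
have h : (b * r) ^+ 2 < (d * p + 1 * (c * q)) ^+ 2 by apply: sq; lra.
by rewrite a0 sub0r sqrrN in E; lra.
Qed.

(** A zero means s|a+bi| = a|rj+sk|. Hence [as >= 0], and squaring gives (sb)² = (ar)², which
    [crossing_contradiction] excludes. *)
Lemma spin_sign_neq0 z : spin4 z -> 0 < sw1 (Pi4 z) -> 0 < sw2 (Pi4 z) -> 0 < sw3 (Pi4 z) ->
  spin_sign z != 0.
Proof.
move=> sz; rewrite sw3_Pi4 // sw1_Pi4 sw2_Pi4 /spin_sign.
move: (z.1 o0 0) (z.1 o1 0) (z.1 o2 0) (z.1 o3 0) (z.2 o0 0) (z.2 o1 0) (z.2 o2 0) (z.2 o3 0).
move=> a b c d p q r s h1 h2 h3; rewrite subr_eq0; apply/eqP => e.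
have u0 : 0 <= a ^+ 2 + b ^+ 2 by rewrite addr_ge0 ?sqr_ge0.
have w0 : 0 <= r ^+ 2 + s ^+ 2 by rewrite addr_ge0 ?sqr_ge0.
have as0 : 0 <= a * s.
  have [->|a0] := eqVneq a 0; first by rewrite mul0r.
  have U0 : 0 < Num.sqrt (a ^+ 2 + b ^+ 2).
    by rewrite sqrtr_gt0 ltr_wpDr ?sqr_ge0 // exprn_even_gt0.
  rewrite -(pmulr_lge0 _ U0) -mulrA e mulrA -expr2 mulr_ge0 ?sqr_ge0 //; exact: sqrtr_ge0.
apply: (crossing_contradiction h1 h2 h3 as0).
have := congr1 (fun x => x ^+ 2) e; rewrite /= !exprMn !sqr_sqrtr //; lra.
Qed.

End SpinSign.

(** * The frame near a point *)

Lemma cvg_bigsum {K : numFieldType} {I : Type} {T : Type} (G : set_system T) {FG : Filter G} (r : seq I) (P : pred I)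
  (f : I -> T -> K) (l : I -> K) : (forall i, f i t @[t --> G] --> l i) ->
  \sum_(i <- r | P i) f i t @[t --> G] --> \sum_(i <- r | P i) l i.
Proof.
move=> h; elim: r => [|i r IH].
  by rewrite big_nil; under eq_fun do rewrite big_nil; exact: cvg_cst.
rewrite big_cons; under eq_fun do rewrite big_cons.
by case: (P i) => //; apply: cvgD.
Qed.

Lemma cvg_bigprod {K : numFieldType} {I : Type} {T : Type} (G : set_system T) {FG : Filter G} (r : seq I) (P : pred I)
  (f : I -> T -> K) (l : I -> K) : (forall i, f i t @[t --> G] --> l i) ->
  \prod_(i <- r | P i) f i t @[t --> G] --> \prod_(i <- r | P i) l i.
Proof.
move=> h; elim: r => [|i r IH].
  by rewrite big_nil; under eq_fun do rewrite big_nil; exact: cvg_cst.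
rewrite big_cons; under eq_fun do rewrite big_cons.
by case: (P i) => //; apply: cvgM.
Qed.

Lemma cvg_det {K : numFieldType} {T : Type} (G : set_system T) {FG : Filter G} n
  (A : T -> 'M[K]_n) (A0 : 'M[K]_n) : (forall i j, A t i j @[t --> G] --> A0 i j) ->
  \det (A t) @[t --> G] --> \det A0.
Proof.
move=> h; rewrite /determinant; apply: cvg_bigsum => s.
by apply: cvgM; [exact: cvg_cst | exact: cvg_bigprod].
Qed.

Section TriangularFrame.
Variable R : realType.
Variable p : R.

Let lim (f : R -> R) (l : R) : Prop := f t @[t --> p^'] --> l.

Let lim_eq f g l l' : lim g l' -> l' = l -> (\forall t \near p^', f t = g t) -> lim f l.
Proof. by move=> gl <- fg; apply: cvg_trans gl; apply: near_eq_cvg; apply: filterS fg. Qed.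

Let limM f g a b : lim f a -> lim g b -> lim (fun t => f t * g t) (a * b).
Proof. exact: cvgM. Qed.

Let limD f g a b : lim f a -> lim g b -> lim (fun t => f t + g t) (a + b).
Proof. exact: cvgD. Qed.

Let limN f a : lim f a -> lim (fun t => - f t) (- a).
Proof. exact: cvgN. Qed.

Variables (H K V : 'I_4 -> 'I_4 -> R -> R) (v : 'I_4 -> 'I_4 -> R).
Hypothesis v0 : forall i, 0 < v i i.
Hypothesis K_lim : forall i j : 'I_4, K i j t * (t - p) ^+ j / (t - p) ^+ i @[t --> p^'] -->
  (i ^_ j)%:R * (v i i / i`!%:R).
Hypothesis V_lim : forall i j, V i j t @[t --> p^'] --> v i j.
Hypothesis H_lim : forall i j, H i j t @[t --> p^'] --> ((i == j)%:R : R).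
Hypothesis good : \forall t \near p^', [/\ t - p != 0,
  [/\ K o1 o0 t = H o1 o0 t * V o0 o0 t,
      K o2 o0 t = H o2 o0 t * V o0 o0 t &
      K o3 o0 t = H o3 o0 t * V o0 o0 t],
  [/\ K o2 o1 t = H o2 o0 t * V o0 o1 t + H o2 o1 t * V o1 o1 t,
      K o3 o1 t = H o3 o0 t * V o0 o1 t + H o3 o1 t * V o1 o1 t &
      K o3 o2 t = H o3 o0 t * V o0 o2 t + H o3 o1 t * V o1 o2 t + H o3 o2 t * V o2 o2 t],
  (forall i j, H o0 i t * H o0 j t + H o1 i t * H o1 j t +
    H o2 i t * H o2 j t + H o3 i t * H o3 j t = (i == j)%:R) &
  ((forall i, V i i t != 0) /\ (forall i, H i i t != 0))].

(** The leading terms are those of exp((t-p)(N - N^T)), where [N] is subdiagonal with entries [k1],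
    [k2], [k3], the velocities of the frame at [p]. Entries below the diagonal are solved column by
    column from [K = H V]. *)
Lemma triangular_frame_lim : exists k : R * R * R, let: (k1, k2, k3) := k in
  [/\ 0 < k1, 0 < k2 & 0 < k3] /\
  let G i j n l := H i j t / (t - p) ^+ n @[t --> p^'] --> (l : R) in
  [/\ forall i, H i i t @[t --> p^'] --> (1 : R),
      [/\ G o1 o0 1%N k1, G o2 o1 1%N k2 & G o3 o2 1%N k3],
      [/\ G o2 o0 2%N (k1 * k2 / 2), G o3 o1 2%N (k2 * k3 / 2) & G o3 o0 3%N (k1 * k2 * k3 / 6)],
      [/\ G o0 o1 1%N (- k1), G o1 o2 1%N (- k2) & G o2 o3 1%N (- k3)] &
      [/\ G o0 o2 2%N (k1 * k2 / 2), G o1 o3 2%N (k2 * k3 / 2) &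
          G o0 o3 3%N (- (k1 * k2 * k3 / 6))]].
Proof.
have vn i : v i i != 0 by rewrite gt_eqF.
have T_lim : (t - p) @[t --> p^'] --> (0 : R).
  rewrite -(subrr p); apply: cvg_within_filter; apply: cvgB; [exact: cvg_id|exact: cvg_cst].
have Hd i : lim (H i i) 1 by have := @H_lim i i; rewrite eqxx.
have H02 : lim (H o0 o2) 0 by exact: (@H_lim o0 o2).
have H03 : lim (H o0 o3) 0 by exact: (@H_lim o0 o3).
have H13 : lim (H o1 o3) 0 by exact: (@H_lim o1 o3).
have V_inv i : lim (fun t => (V i i t)^-1) (v i i)^-1 by apply: cvgV.
have H_inv i : lim (fun t => (H i i t)^-1) 1^-1 by apply: cvgV; [exact: oner_neq0 | exact: Hd].
set k1 := v o1 o1 / v o0 o0; set k2 := v o2 o2 / v o1 o1; set k3 := v o3 o3 / v o2 o2.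
exists (k1, k2, k3); split; first by split; exact: divr_gt0.
pose G i j n t := H i j t / (t - p) ^+ n.
pose T t := t - p.
have lT : lim T 0 by [].
have lV i j : lim (V i j) (v i j) by exact: V_lim.
have lK i j : lim (fun t => K i j t * (t - p) ^+ j / (t - p) ^+ i) ((i ^_ j)%:R * (v i i / i`!%:R)).
  exact: K_lim.
have lK10 : lim (fun t => K o1 o0 t * (t - p) ^+ 0 / (t - p) ^+ 1) (v o1 o1).
  apply: (lim_eq (lK o1 o0)); last exact: nearW.
  by rewrite /= (_ : 1 ^_ 0 = 1)%N // (_ : 1`! = 1)%N //; field.
have lK20 : lim (fun t => K o2 o0 t * (t - p) ^+ 0 / (t - p) ^+ 2) (v o2 o2 / 2).
  apply: (lim_eq (lK o2 o0)); last exact: nearW.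
  by rewrite /= (_ : 2 ^_ 0 = 1)%N // (_ : 2`! = 2)%N //; field.
have lK30 : lim (fun t => K o3 o0 t * (t - p) ^+ 0 / (t - p) ^+ 3) (v o3 o3 / 6).
  apply: (lim_eq (lK o3 o0)); last exact: nearW.
  by rewrite /= (_ : 3 ^_ 0 = 1)%N // (_ : 3`! = 6)%N //; field.
have lK21 : lim (fun t => K o2 o1 t * (t - p) ^+ 1 / (t - p) ^+ 2) (v o2 o2).
  apply: (lim_eq (lK o2 o1)); last exact: nearW.
  by rewrite /= (_ : 2 ^_ 1 = 2)%N // (_ : 2`! = 2)%N //; field.
have lK31 : lim (fun t => K o3 o1 t * (t - p) ^+ 1 / (t - p) ^+ 3) (v o3 o3 / 2).
  apply: (lim_eq (lK o3 o1)); last exact: nearW.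
  by rewrite /= (_ : 3 ^_ 1 = 3)%N // (_ : 3`! = 6)%N //; field.
have lK32 : lim (fun t => K o3 o2 t * (t - p) ^+ 2 / (t - p) ^+ 3) (v o3 o3).
  apply: (lim_eq (lK o3 o2)); last exact: nearW.
  by rewrite /= (_ : 3 ^_ 2 = 6)%N // (_ : 3`! = 6)%N //; field.
have g10 : lim (G o1 o0 1%N) (k1).
  apply: (lim_eq (limM lK10 (V_inv o0))).
  - by rewrite /k1 /=; field; rewrite vn.
  - apply: filterS good => t [t0 [e _ _] _ _ [nV _]].
    by rewrite /G e; field; rewrite t0 nV.
have g20 : lim (G o2 o0 2%N) (k1 * k2 / 2).
  apply: (lim_eq (limM lK20 (V_inv o0))).
  - by rewrite /k1 /k2 /=; field; rewrite !vn.
  - apply: filterS good => t [t0 [_ e _] _ _ [nV _]].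
    by rewrite /G e; field; rewrite t0 nV.
have g30 : lim (G o3 o0 3%N) (k1 * k2 * k3 / 6).
  apply: (lim_eq (limM lK30 (V_inv o0))).
  - by rewrite /k1 /k2 /k3 /=; field; rewrite !vn.
  - apply: filterS good => t [t0 [_ _ e] _ _ [nV _]].
    by rewrite /G e; field; rewrite t0 nV.
have g21 : lim (G o2 o1 1%N) (k2).
  apply: (lim_eq (limM (limD lK21
    (limN (limM (limM g20 (lV o0 o1)) lT))) (V_inv o1))).
  - by rewrite /k1 /k2 /=; field; rewrite !vn.
  - apply: filterS good => t [t0 _ [e _ _] _ [nV _]].
    by rewrite /G /T e; field; rewrite t0 nV.
have g31 : lim (G o3 o1 2%N) (k2 * k3 / 2).
  apply: (lim_eq (limM (limD lK31
    (limN (limM (limM g30 (lV o0 o1)) lT))) (V_inv o1))).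
  - by rewrite /k1 /k2 /k3 /=; field; rewrite !vn.
  - apply: filterS good => t [t0 _ [_ e _] _ [nV _]].
    by rewrite /G /T e; field; rewrite t0 nV.
have g32 : lim (G o3 o2 1%N) (k3).
  apply: (lim_eq (limM (limD lK32
    (limN (limM (limD (limM (limM g30 (lV o0 o2)) lT)
       (limM g31 (lV o1 o2))) lT))) (V_inv o2))).
  - by rewrite /k1 /k2 /k3 /=; field; rewrite !vn.
  - apply: filterS good => t [t0 _ [_ _ e] _ [nV _]].
    by rewrite /G /T e; field; rewrite t0 nV.
clearbody k1 k2 k3.
(* Orthogonality of two columns is solved for an entry above the diagonal; its coefficient [H i i]
   tends to 1. *)
have solve (x y z : R) : x != 0 -> x * y + z = 0 -> y = - z / x.
  by move=> x0 e; rewrite -[y](mulKf x0) mulrC; congr (_ / _); lra.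
have g01 : lim (G o0 o1 1%N) (- k1).
  apply: (lim_eq (limM (limN (limD (limM g10 (Hd o1))
    (limM (limD (limM g20 g21) (limM (limM g30 g31) (limM lT lT)))
    (limM lT lT)))) (H_inv o0))); first by rewrite invr1; field.
  apply: filterS good => t [t0 _ _ oh [_ nH]].
  have e : H o0 o0 t * H o0 o1 t + (H o1 o0 t * H o1 o1 t + H o2 o0 t * H o2 o1 t + H o3 o0 t * H o3 o1 t) = 0.
    by rewrite !addrA; exact: (oh o0 o1).
  by rewrite /G /T (solve _ _ _ (nH o0) e); field; rewrite t0 nH.
have g12 : lim (G o1 o2 1%N) (- k2).
  apply: (lim_eq (limM (limN (limD (limD (limM g01 H02)
    (limM g21 (Hd o2))) (limM (limM g31 g32) (limM lT lT))))
    (H_inv o1))); first by rewrite invr1; field.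
  apply: filterS good => t [t0 _ _ oh [_ nH]].
  have e : H o1 o1 t * H o1 o2 t + (H o0 o1 t * H o0 o2 t + H o2 o1 t * H o2 o2 t + H o3 o1 t * H o3 o2 t) = 0.
    by rewrite -[RHS](oh o1 o2); ring.
  by rewrite /G /T (solve _ _ _ (nH o1) e); field; rewrite t0 nH.
have g02 : lim (G o0 o2 2%N) (k1 * k2 / 2).
  apply: (lim_eq (limM (limN (limD (limD (limM g10 g12)
    (limM g20 (Hd o2))) (limM (limM g30 g32) (limM lT lT))))
    (H_inv o0))); first by rewrite invr1; field.
  apply: filterS good => t [t0 _ _ oh [_ nH]].
  have e : H o0 o0 t * H o0 o2 t + (H o1 o0 t * H o1 o2 t + H o2 o0 t * H o2 o2 t + H o3 o0 t * H o3 o2 t) = 0.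
    by rewrite -[RHS](oh o0 o2); ring.
  by rewrite /G /T (solve _ _ _ (nH o0) e); field; rewrite t0 nH.
have g23 : lim (G o2 o3 1%N) (- k3).
  apply: (lim_eq (limM (limN (limD (limD (limM (limM g02 lT) H03)
    (limM g12 H13)) (limM g32 (Hd o3)))) (H_inv o2))); first by rewrite invr1; field.
  apply: filterS good => t [t0 _ _ oh [_ nH]].
  have e : H o2 o2 t * H o2 o3 t + (H o0 o2 t * H o0 o3 t + H o1 o2 t * H o1 o3 t + H o3 o2 t * H o3 o3 t) = 0.
    by rewrite -[RHS](oh o2 o3); ring.
  by rewrite /G /T (solve _ _ _ (nH o2) e); field; rewrite t0 nH.
(* A crude estimate of the corner entry, which is really of order 3: it suffices for [g13], on which
   the sharp estimate [g03] depends. *)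
have g03' : lim (G o0 o3 1%N) 0.
  apply: (lim_eq (limM (limN (limD (limM g10 H13)
    (limM (limD (limM g20 g23) (limM g30 (Hd o3))) (limM lT lT))))
    (H_inv o0))); first by rewrite invr1; field.
  apply: filterS good => t [t0 _ _ oh [_ nH]].
  have e : H o0 o0 t * H o0 o3 t + (H o1 o0 t * H o1 o3 t + H o2 o0 t * H o2 o3 t + H o3 o0 t * H o3 o3 t) = 0.
    by rewrite -[RHS](oh o0 o3); ring.
  by rewrite /G /T (solve _ _ _ (nH o0) e); field; rewrite t0 nH.
have g13 : lim (G o1 o3 2%N) (k2 * k3 / 2).
  apply: (lim_eq (limM (limN (limD (limD (limM g01 g03')
    (limM g21 g23)) (limM g31 (Hd o3)))) (H_inv o1))); first by rewrite invr1; field.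
  apply: filterS good => t [t0 _ _ oh [_ nH]].
  have e : H o1 o1 t * H o1 o3 t + (H o0 o1 t * H o0 o3 t + H o2 o1 t * H o2 o3 t + H o3 o1 t * H o3 o3 t) = 0.
    by rewrite -[RHS](oh o1 o3); ring.
  by rewrite /G /T (solve _ _ _ (nH o1) e); field; rewrite t0 nH.
have g03 : lim (G o0 o3 3%N) (- (k1 * k2 * k3 / 6)).
  apply: (lim_eq (limM (limN (limD (limD (limM g10 g13)
    (limM g20 g23)) (limM g30 (Hd o3)))) (H_inv o0))); first by rewrite invr1; field.
  apply: filterS good => t [t0 _ _ oh [_ nH]].
  have e : H o0 o0 t * H o0 o3 t + (H o1 o0 t * H o1 o3 t + H o2 o0 t * H o2 o3 t + H o3 o0 t * H o3 o3 t) = 0.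
    by rewrite -[RHS](oh o0 o3); ring.
  by rewrite /G /T (solve _ _ _ (nH o0) e); field; rewrite t0 nH.
by [].
Qed.

End TriangularFrame.

Section FrameAsymptotics.
Variable R : realType.
Variable gamma : R -> 'cV[R]_4.
Hypothesis lc : Defs.locally_convex gamma.
Variable p : R.
Hypothesis p01 : 0 <= p <= 1.

Local Notation J := (jet_mx gamma).
Local Notation F := (frenet gamma).
Local Notation h t := ((F p)^T *m F t).
Local Notation U t := ((F t)^T *m J t).

Let U_upper t : 0 <= t <= 1 -> Up4plus (U t).
Proof.
move=> t01; have [V uV JE] := frenet_factor lc t01.
by rewrite JE mulmxA frenet_orth // mul1mx.
Qed.


(* [h] is the orthonormalization of a matrix that looks like
   [exp ((t - p) N)] with [N] subdiagonal: its lower entries are read off Taylor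
   expansions, its upper entries follow from orthogonality. *)
Lemma frame_lim : exists k : R * R * R, let: (k1, k2, k3) := k in
  [/\ 0 < k1, 0 < k2 & 0 < k3] /\
  let G i j n l := h t i j / (t - p) ^+ n @[t --> p^'] --> (l : R) in
  [/\ forall i, h t i i @[t --> p^'] --> (1 : R),
      [/\ G o1 o0 1%N k1, G o2 o1 1%N k2 & G o3 o2 1%N k3],
      [/\ G o2 o0 2%N (k1 * k2 / 2), G o3 o1 2%N (k2 * k3 / 2) & G o3 o0 3%N (k1 * k2 * k3 / 6)],
      [/\ G o0 o1 1%N (- k1), G o1 o2 1%N (- k2) & G o2 o3 1%N (- k3)] &
      [/\ G o0 o2 2%N (k1 * k2 / 2), G o1 o3 2%N (k2 * k3 / 2) &
          G o0 o3 3%N (- (k1 * k2 * k3 / 6))]].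
Proof.
have [Ul Ud] := U_upper p01.
pose u i := U p i i.
have u0 i : 0 < u i by exact: Ud.
have un i : u i != 0 by rewrite gt_eqF.
have K_lim (i j : 'I_4) : ((F p)^T *m J t) i j * (t - p) ^+ j / (t - p) ^+ i @[t --> p^'] -->
    (i ^_ j)%:R * (u i / i`!%:R).
  have h1 (k l : 'I_4) : (l < k)%N -> ((F p)^T *m J p) k l = 0 by exact: Ul.
  have := @frame_cvg R gamma lc (F p)^T p (fun i => i : nat) h1 (fun i => ltn_ord i) i j.
  by rewrite inord_val.
have U_lim i j : U t i j @[t --> p^'] --> U p i j.
  apply: cvg_within_filter; apply: cvg_trmx_mul => k l.
    exact: frenet_continuous.
  exact: jet_continuous.
have h_lim i j : h t i j @[t --> p^'] --> ((i == j)%:R : R).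
  apply: cvg_within_filter.
  have -> : (i == j)%:R = h p i j by rewrite frenet_orth // mxE.
  apply: cvg_trmx_mul => k l; first exact: cvg_cst.
  exact: frenet_continuous.
have T_lim : (t - p) @[t --> p^'] --> (0 : R).
  rewrite -(subrr p); apply: cvg_within_filter; apply: cvgB; [exact: cvg_id|exact: cvg_cst].
have good : \forall t \near p^', [/\ t != p, (F p)^T *m J t = h t *m U t,
    (h t)^T *m h t = 1%:M, (forall i, U t i i != 0) & (forall i, h t i i != 0)] /\
    (forall i j : 'I_4, (j < i)%N -> U t i j = 0).
  have nz (f : R -> R) (l : R) : l != 0 -> f t @[t --> p^'] --> l -> \forall t \near p^', f t != 0.
    move=> l0 /cvgr_norm_gt/(_ 0); rewrite normr_gt0 => /(_ l0).
    by apply: filterS => t; rewrite normr_gt0.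
  have dJ : \forall t \near p^', \det (J t) != 0.
    apply: (nz (fun t => \det (J t)) (\det (J p))); first by rewrite gt_eqF // (det_jet_gt0 lc).
    by apply: cvg_det => i j; apply: cvg_within_filter; exact: jet_continuous.
  have nU i : \forall t \near p^', U t i i != 0 by exact: (nz (fun t => U t i i) (U p i i) (un i) (U_lim i i)).
  have nh i : \forall t \near p^', h t i i != 0.
    by apply: (nz (fun t => h t i i) _ _ (h_lim i i)); rewrite eqxx oner_eq0.
  have aU : \forall t \near p^', forall i, U t i i != 0 by apply: filter_forall => i; exact: nU.
  have ah : \forall t \near p^', forall i, h t i i != 0 by apply: filter_forall => i; exact: nh.
  near=> t.
  have oF : (F t)^T *m F t = 1%:M by apply: gram_schmidt_orth; near: t.
  have oF' : F t *m (F t)^T = 1%:M.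
    by rewrite -(orth_trmx_unit oF) mulmxV //; have [] := mulmx1_unit oF.
  have oP : F p *m (F p)^T = 1%:M.
    by have e := frenet_orth lc p01; rewrite -(orth_trmx_unit e) mulmxV //; have [] := mulmx1_unit e.
  split; last first.
    move=> i j ji; rewrite -[J t]gram_schmidtK mulmxA oF mul1mx; exact: gs_upper_low.
  split; [by near: t; exact: nbhs_dnbhs_neq| | |by near: t|by near: t].
  - by rewrite mulmxA -[_ *m F t *m _]mulmxA oF' mulmx1.
  - by rewrite trmx_mul trmxK mulmxA -[_ *m F p *m _]mulmxA oP mulmx1.
have {good} good : \forall t \near p^', [/\ t - p != 0,
    [/\ ((F p)^T *m J t) o1 o0 = h t o1 o0 * U t o0 o0,
        ((F p)^T *m J t) o2 o0 = h t o2 o0 * U t o0 o0 &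
        ((F p)^T *m J t) o3 o0 = h t o3 o0 * U t o0 o0],
    [/\ ((F p)^T *m J t) o2 o1 = h t o2 o0 * U t o0 o1 + h t o2 o1 * U t o1 o1,
        ((F p)^T *m J t) o3 o1 = h t o3 o0 * U t o0 o1 + h t o3 o1 * U t o1 o1 &
        ((F p)^T *m J t) o3 o2 = h t o3 o0 * U t o0 o2 + h t o3 o1 * U t o1 o2 + h t o3 o2 * U t o2 o2],
    (forall i j, h t o0 i * h t o0 j + h t o1 i * h t o1 j +
      h t o2 i * h t o2 j + h t o3 i * h t o3 j = (i == j)%:R) &
    ((forall i, U t i i != 0) /\ (forall i, h t i i != 0))].
  apply: filterS good => t [[tp KE oh nU nh] lo].
  have mE (A B : 'M[R]_4) i j : (A *m B) i j = A i o0 * B o0 j + A i o1 * B o1 j + A i o2 * B o2 j + A i o3 * B o3 j.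
    by rewrite mxE sum_ord4.
  have l10 := lo o1 o0 isT; have l20 := lo o2 o0 isT; have l30 := lo o3 o0 isT.
  have l21 := lo o2 o1 isT; have l31 := lo o3 o1 isT; have l32 := lo o3 o2 isT.
  split=> //; first by rewrite subr_eq0.
  - by rewrite KE; split; rewrite mE l10 l20 l30; ring.
  - by rewrite KE; split; rewrite mE ?l10 ?l20 ?l30 ?l21 ?l31 ?l32; ring.
  - by move=> i j; rewrite -mul_trmx4 oh mxE.
apply: (@triangular_frame_lim R p (fun i j t => h t i j) (fun i j t => ((F p)^T *m J t) i j)
  (fun i j t => U t i j) (fun i j => U p i j)).
- exact: u0.
- exact: K_lim.
- exact: U_lim.
- exact: h_lim.
- exact: good.
Unshelve. all: by end_near. Qed.

(** Multiplying entries of odd order by [t - p] states the signs on both sides of [p] at once. The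
    comparisons hold because an entry of order 1 dominates one of order 3. Together with the bounds
    by 1/2 they allow the sign of a sum of entries of the frame to be settled by linear
    arithmetic. *)
Lemma frame_signs : \forall t \near p^',
  [/\ [/\ 0 < h t o1 o0 * (t - p), 0 < h t o2 o1 * (t - p), 0 < h t o3 o2 * (t - p),
          0 < h t o2 o0 & 0 < h t o3 o1],
      [/\ 0 < - h t o0 o1 * (t - p), 0 < - h t o1 o2 * (t - p), 0 < - h t o2 o3 * (t - p),
          0 < h t o0 o2 & 0 < h t o1 o3],
      0 < h t o3 o0 * (t - p) /\ 0 < - h t o0 o3 * (t - p),
      [/\ 0 < (h t o2 o1 - h t o3 o0) * (t - p), 0 < (h t o0 o3 - h t o1 o2) * (t - p),
          `|h t o3 o0| < 1 / 2 & `|h t o0 o3| < 1 / 2] &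
      forall i, 1 / 2 < h t i i].
Proof.
have [[[k1 k2] k3] [[p1 p2 p3] [Hd [g10 g21 g32] [g20 g31 g30] [g01 g12 g23] [g02 g13 g03]]]] := frame_lim.
have T_lim : (t - p) @[t --> p^'] --> (0 : R).
  rewrite -(subrr p); apply: cvg_within_filter; apply: cvgB; [exact: cvg_id|exact: cvg_cst].
have pos (f : R -> R) (l : R) : f t @[t --> p^'] --> l -> 0 < l -> \forall t \near p^', 0 < f t.
  by move=> fl l0; apply: cvgr_gt fl _ l0.
have small (f : R -> R) (l : R) : f t @[t --> p^'] --> l -> l = 0 -> \forall t \near p^', `|f t| < 1 / 2.
  by move=> /cvgr_norm_lt fl l0; apply: fl; rewrite l0 normr0; lra.
have q12 : 0 < k1 * k2 / 2 by rewrite divr_gt0 // mulr_gt0.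
have q23 : 0 < k2 * k3 / 2 by rewrite divr_gt0 // mulr_gt0.
have q123 : 0 < k1 * k2 * k3 / 6 by rewrite divr_gt0 // !mulr_gt0.
have neg (f : R -> R) (l : R) : f t @[t --> p^'] --> - l -> 0 < l -> \forall t \near p^', 0 < - f t.
  by move=> fl; apply: pos; rewrite -[l]opprK; exact: cvgN.
have n10 := pos _ _ g10 p1; have n21 := pos _ _ g21 p2; have n32 := pos _ _ g32 p3.
have n20 := pos _ _ g20 q12; have n31 := pos _ _ g31 q23; have n30 := pos _ _ g30 q123.
have n01 := neg _ _ g01 p1; have n12 := neg _ _ g12 p2; have n23 := neg _ _ g23 p3.
have n02 := pos _ _ g02 q12; have n13 := pos _ _ g13 q23; have n03 := neg _ _ g03 q123.
have d1 : \forall t \near p^', 0 < h t o2 o1 / (t - p) ^+ 1 - h t o3 o0 / (t - p) ^+ 3 * ((t - p) * (t - p)).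
  apply: (pos _ (k2 - k1 * k2 * k3 / 6 * (0 * 0))); last by rewrite !mulr0 subr0.
  by apply: cvgB => //; apply: cvgM => //; apply: cvgM.
have d2 : \forall t \near p^', 0 < h t o0 o3 / (t - p) ^+ 3 * ((t - p) * (t - p)) - h t o1 o2 / (t - p) ^+ 1.
  apply: (pos _ (- (k1 * k2 * k3 / 6) * (0 * 0) - - k2)); last by rewrite !mulr0 sub0r opprK.
  by apply: cvgB => //; apply: cvgM => //; apply: cvgM.
have T3 : (t - p) * (t - p) * (t - p) @[t --> p^'] --> 0 * 0 * (0 : R) by do !apply: cvgM.
have s1 : \forall t \near p^', `|h t o3 o0 / (t - p) ^+ 3 * ((t - p) * (t - p) * (t - p))| < 1 / 2.
  by apply: (small _ _ (cvgM g30 T3)); rewrite !mulr0.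
have s2 : \forall t \near p^', `|h t o0 o3 / (t - p) ^+ 3 * ((t - p) * (t - p) * (t - p))| < 1 / 2.
  by apply: (small _ _ (cvgM g03 T3)); rewrite !mulr0.
have nd : \forall t \near p^', forall i, 1 / 2 < h t i i.
  by apply: filter_forall => i; apply: (cvgr_gt _ (Hd i)); lra.
near=> t.
have tp : t - p != 0 by rewrite subr_eq0; near: t; exact: nbhs_dnbhs_neq.
have T2 : 0 < (t - p) ^+ 2 by rewrite exprn_even_gt0.
have T4 : 0 < (t - p) ^+ 4 by rewrite exprn_even_gt0.
have m2 (x y : R) : x * (t - p) ^+ 2 = y -> 0 < x -> 0 < y by move=> <- x0; rewrite mulr_gt0.
have m4 (x y : R) : x * (t - p) ^+ 4 = y -> 0 < x -> 0 < y by move=> <- x0; rewrite mulr_gt0.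
split; first split.
- by apply: (m2 (h t o1 o0 / (t - p) ^+ 1)); [field | near: t].
- by apply: (m2 (h t o2 o1 / (t - p) ^+ 1)); [field | near: t].
- by apply: (m2 (h t o3 o2 / (t - p) ^+ 1)); [field | near: t].
- by apply: (m2 (h t o2 o0 / (t - p) ^+ 2)); [field | near: t].
- by apply: (m2 (h t o3 o1 / (t - p) ^+ 2)); [field | near: t].
- split.
  + by apply: (m2 (- (h t o0 o1 / (t - p) ^+ 1))); [field | near: t].
  + by apply: (m2 (- (h t o1 o2 / (t - p) ^+ 1))); [field | near: t].
  + by apply: (m2 (- (h t o2 o3 / (t - p) ^+ 1))); [field | near: t].
  + by apply: (m2 (h t o0 o2 / (t - p) ^+ 2)); [field | near: t].
  + by apply: (m2 (h t o1 o3 / (t - p) ^+ 2)); [field | near: t].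
- split.
  + by apply: (m4 (h t o3 o0 / (t - p) ^+ 3)); [field | near: t].
  + by apply: (m4 (- (h t o0 o3 / (t - p) ^+ 3))); [field | near: t].
- split.
  + by apply: (m2 (h t o2 o1 / (t - p) ^+ 1 - h t o3 o0 / (t - p) ^+ 3 * ((t - p) * (t - p)))); [field | near: t].
  + by apply: (m2 (h t o0 o3 / (t - p) ^+ 3 * ((t - p) * (t - p)) - h t o1 o2 / (t - p) ^+ 1)); [field | near: t].
  + have -> : h t o3 o0 = h t o3 o0 / (t - p) ^+ 3 * ((t - p) * (t - p) * (t - p)) by field.
    by near: t.
  + have -> : h t o0 o3 = h t o0 o3 / (t - p) ^+ 3 * ((t - p) * (t - p) * (t - p)) by field.
    by near: t.
- by near: t.
Unshelve. all: by end_near. Qed.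

End FrameAsymptotics.

(** * Convex matrices *)

Section MatrixNecessity.

Definition det4_fun (K : pzRingType) (f : nat -> nat -> K) : K :=
  f 0%N 0%N * (f 1%N 1%N * (f 2%N 2%N * f 3%N 3%N - f 2%N 3%N * f 3%N 2%N)
    - f 1%N 2%N * (f 2%N 1%N * f 3%N 3%N - f 2%N 3%N * f 3%N 1%N)
    + f 1%N 3%N * (f 2%N 1%N * f 3%N 2%N - f 2%N 2%N * f 3%N 1%N))
  - f 0%N 1%N * (f 1%N 0%N * (f 2%N 2%N * f 3%N 3%N - f 2%N 3%N * f 3%N 2%N)
    - f 1%N 2%N * (f 2%N 0%N * f 3%N 3%N - f 2%N 3%N * f 3%N 0%N)
    + f 1%N 3%N * (f 2%N 0%N * f 3%N 2%N - f 2%N 2%N * f 3%N 0%N))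
  + f 0%N 2%N * (f 1%N 0%N * (f 2%N 1%N * f 3%N 3%N - f 2%N 3%N * f 3%N 1%N)
    - f 1%N 1%N * (f 2%N 0%N * f 3%N 3%N - f 2%N 3%N * f 3%N 0%N)
    + f 1%N 3%N * (f 2%N 0%N * f 3%N 1%N - f 2%N 1%N * f 3%N 0%N))
  - f 0%N 3%N * (f 1%N 0%N * (f 2%N 1%N * f 3%N 2%N - f 2%N 2%N * f 3%N 1%N)
    - f 1%N 1%N * (f 2%N 0%N * f 3%N 2%N - f 2%N 2%N * f 3%N 0%N)
    + f 1%N 2%N * (f 2%N 0%N * f 3%N 1%N - f 2%N 1%N * f 3%N 0%N)).

Definition inv_list (p : seq nat) (i : nat) : nat := index i p.
Definition row_sign (p : seq nat) (e : seq int) (i : nat) : int := nth 0 e (inv_list p i).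

(** The conclusions of [convex_signs] and the value of the determinant, in integers, so that the
    selection becomes a finite check. *)
Definition sign_conditions (p : seq nat) (e : seq int) : bool :=
  let a i := inv_list p i in let c i := row_sign p e i in
  let d i j := (a i)%:Z - (a j)%:Z in
  [&& 0 < (-1) ^+ a 3%N * c 3%N,
      0 < (-1) ^+ (a 2%N + a 3%N).+1 * (c 2%N * c 3%N * d 3%N 2%N),
      0 < (-1) ^+ (a 1%N + a 2%N + a 3%N).+3 *
        (c 1%N * c 2%N * c 3%N * d 2%N 1%N * d 3%N 1%N * d 3%N 2%N) &
      det4_fun (ent p e) == 1].

Definition entry_mx (x : entry) : seq nat * seq int :=
  let: (d, p, e, n, zl, zr) := x in (p, e).

(** Exhaustion of the 24 permutations and the 16 choices of signs for each. *)
Lemma sign_conditions_entries : all (fun a => all (fun b => all (fun c => all (fun d =>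
    uniq [:: a; b; c; d] ==> all (fun x => all (fun y => all (fun z => all (fun w =>
      sign_conditions [:: a; b; c; d] [:: x; y; z; w] ==>
      (([:: a; b; c; d], [:: x; y; z; w]) \in map entry_mx entries))
    [:: 1; -1]) [:: 1; -1]) [:: 1; -1]) [:: 1; -1 : int])
  (iota 0 4)) (iota 0 4)) (iota 0 4)) (iota 0 4).
Proof. by vm_compute. Qed.

Variable R : realType.

Lemma det_sgmx p e : \det (sgmx R p e) = (det4_fun (ent p e))%:~R.
Proof. by rewrite det4 !mxE /det4_fun /= !(rmorphB, rmorphD, rmorphM). Qed.


Lemma signed_perm_sgmx (s : 'S_4) (eps : 'I_4 -> R) : (forall j, eps j = 1 \/ eps j = -1) ->
  exists e : seq int, [/\ size e = 4%N, all (mem [:: 1; -1]) e,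
    (forall j : 'I_4, eps j = (nth 0 e j)%:~R) &
    signed_perm_mx s eps = sgmx R [seq val (s j) | j <- enum 'I_4] e].
Proof.
move=> he; pose e := [seq (if eps j == 1 then 1 else -1 : int) | j <- enum 'I_4].
have sz : size e = 4%N by rewrite size_map size_enum_ord.
have eE (j : 'I_4) : nth 0 e j = if eps j == 1 then 1 else -1.
  by rewrite /e (nth_map o0) ?size_enum_ord // nth_ord_enum.
exists e; split=> //.
- by apply/allP => _ /mapP[j _ ->]; rewrite /=; case: ifP.
- move=> j; rewrite eE; case: eqP => [->//|ne]; case: (he j) => // ->.
- apply/matrixP => i j; rewrite !mxE /ent (nth_map o0) ?size_enum_ord // nth_ord_enum val_eqE.
  by case: ifP => // _; rewrite eE; case: eqP => [->//|ne]; case: (he j) => // ->.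
Qed.

Lemma sw_cst_int (a : 'I_4 -> 'I_4) (e : 'I_4 -> R) (p : seq nat) (q : seq int) :
  (forall i, a i = inv_list p i :> nat) -> (forall i, e i = (row_sign p q i)%:~R) ->
  let c i := row_sign p q i in let d i j := (inv_list p i)%:Z - (inv_list p j)%:Z in
  [/\ (sw_cst (fun i => a i : nat) e).1.1 = (c 3%N)%:~R,
      (sw_cst (fun i => a i : nat) e).1.2 = (c 2%N * c 3%N * d 3%N 2%N)%:~R &
      (sw_cst (fun i => a i : nat) e).2 =
        (c 1%N * c 2%N * c 3%N * d 2%N 1%N * d 3%N 1%N * d 3%N 2%N)%:~R].
Proof.
by move=> aE eE c d; split; rewrite /= ?aE ?eE // !rmorphM ?rmorphB.
Qed.

Lemma convex_B4plus_entry (Q : 'M[R]_4) gamma t0 t1 : Defs.locally_convex gamma ->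
  0 <= t0 -> t0 < t1 -> t1 <= 1 -> convex_arc gamma t0 t1 ->
  Q = (frenet gamma t0)^T *m frenet gamma t1 -> B4plus Q ->
  exists2 x, x \in entries & Q = (of_entry R x).2.
Proof.
move=> lc t00 t01 t11 cv QF [[s [eps [he QE]]] dQ].
have [e [se ae epsE QE']] := signed_perm_sgmx s he.
rewrite {}QE' in QE; set p := [seq val (s j) | j <- enum 'I_4] in QE.
have pE (j : 'I_4) : nth 0%N p j = s j.
  by rewrite /p (nth_map o0) ?size_enum_ord // nth_ord_enum.
have up : uniq p by rewrite map_inj_uniq ?enum_uniq // => i j /val_inj /perm_inj.
have szp : size p = 4%N by rewrite size_map size_enum_ord.
(* The nonzero entry of row [i] of [Q] lies in column [a i]; this is also the order to which the row
   vanishes at [t1]. *)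
pose a i := (s^-1)%g i.
have aE i : a i = inv_list p i :> nat.
  rewrite /inv_list -[i in RHS](permKV s) -/(a i) -pE index_uniq // szp; exact: ltn_ord.
pose c (i : 'I_4) : R := (row_sign p e i)%:~R.
have cE i : c i = eps (a i) by rewrite /c /row_sign -aE epsE.
have c0 i : c i != 0 by rewrite cE; case: (he (a i)) => ->; rewrite ?oppr_eq0 oner_eq0.
have ia : injective a by exact: perm_inj.
have QE2 i j : ((frenet gamma t0)^T *m frenet gamma t1) i j = if j == a i then c i else 0.
  rewrite -QF QE mxE /ent pE val_eqE.
  have -> : (i == s j) = (j == a i) by apply/eqP/eqP => ->; rewrite /a ?permK ?permKV.
  by case: eqP => [->|] //; rewrite cE epsE.
have [C1 C2 C3] := convex_signs lc t00 t01 t11 cv ia c0 QE2.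
have [E1 E2 E3] := sw_cst_int aE (fun i => erefl (c i)).
have m1 n (k : int) : (-1) ^+ n * k%:~R = ((-1) ^+ n * k)%:~R :> R.
  by rewrite rmorphM rmorphXn /= rmorphN1.
have ok : sign_conditions p e.
  rewrite E1 m1 ltr0z in C1; rewrite E2 m1 ltr0z in C2; rewrite E3 m1 ltr0z in C3.
  rewrite !aE in C1 C2 C3; apply/and4P; split=> //.
  by rewrite -(inj_eq (@intr_inj R)) -det_sgmx -QE dQ.
have := sign_conditions_entries.
have pl (j : 'I_4) : nth 0%N p j \in iota 0 4 by rewrite pE mem_iota ltn_ord.
have el (j : 'I_4) : nth 0 e j \in [:: 1; -1] by apply: (allP ae); apply: mem_nth; rewrite se.
(* Written out with four terms each, [p] and [e] become instances of the exhaustive check. *)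
move: up ok pl el QE; rewrite (_ : p = [:: nth 0%N p o0; nth 0%N p o1; nth 0%N p o2; nth 0%N p o3]); last first.
  by apply: (@eq_from_nth _ 0%N) => [|k]; rewrite szp //; do 4!case: k => [|k] //.
rewrite (_ : e = [:: nth 0 e o0; nth 0 e o1; nth 0 e o2; nth 0 e o3]); last first.
  by apply: (@eq_from_nth _ 0) => [|k]; rewrite se //; do 4!case: k => [|k] //.
set p0 := nth 0%N p o0; set p1 := nth 0%N p o1; set p2 := nth 0%N p o2; set p3 := nth 0%N p o3.
set e0 := nth 0 e o0; set e1 := nth 0 e o1; set e2 := nth 0 e o2; set e3 := nth 0 e o3.
move=> up ok pl el QE.
move=> /allP/(_ _ (pl o0))/allP/(_ _ (pl o1))/allP/(_ _ (pl o2))/allP/(_ _ (pl o3)).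
move=> /implyP/(_ up)/allP/(_ _ (el o0))/allP/(_ _ (el o1))/allP/(_ _ (el o2))/allP/(_ _ (el o3)).
move=> /implyP/(_ ok)/mapP[[[[[[d p'] e'] n] zl] zr] xin /= [pp ee]].
by exists (d, p', e', n, zl, zr) => //=; rewrite -pp -ee.
Qed.

End MatrixNecessity.

(** * Convex spins *)

Section EntrySpins.

(** The test on [n] is what makes [scal] the inverse of its square root: the last branch of [scal],
    1/2, is right for 4. *)
Definition entry_checks (x : entry) : bool :=
  let: (d, p, e, n, zl, zr) := x in
  [&& n \in [:: 1; 2; 4]%N,
      all (fun i => all (fun j => pi4_entry zl`_0 (nth 0 zl 1%N) (nth 0 zl 2%N) (nth 0 zl 3%N)
        zr`_0 (nth 0 zr 1%N) (nth 0 zr 2%N) (nth 0 zr 3%N) i j == n%:Z * ent p e i j)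
        (iota 0 4)) (iota 0 4),
      zl`_0 ^+ 2 + (nth 0 zl 1%N) ^+ 2 + (nth 0 zl 2%N) ^+ 2 + (nth 0 zl 3%N) ^+ 2 == n%:Z &
      zr`_0 ^+ 2 + (nth 0 zr 1%N) ^+ 2 + (nth 0 zr 2%N) ^+ 2 + (nth 0 zr 3%N) ^+ 2 == n%:Z].

Lemma entries_checked : all entry_checks entries.
Proof. by vm_compute. Qed.

Variable R : realType.

Lemma scal_gt0 n : 0 < scal R n.
Proof.
rewrite /scal; case: ifP => // _; case: ifP => _; last by rewrite invr_gt0.
by rewrite invr_gt0 sqrtr_gt0.
Qed.

Lemma scal_sqr n : n \in [:: 1; 2; 4]%N -> scal R n ^+ 2 * n%:R = 1.
Proof.
rewrite !inE => /or3P[] /eqP ->; rewrite /scal /=.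
- by rewrite expr1n mulr1.
- by rewrite exprVn sqr_sqrtr // mulVf.
- by field.
Qed.

Lemma pi4_entry_scale (c a b c' d p q r s : R) i j :
  pi4_entry (c * a) (c * b) (c * c') (c * d) (c * p) (c * q) (c * r) (c * s) i j =
  c ^+ 2 * pi4_entry a b c' d p q r s i j.
Proof.
rewrite /pi4_entry.
do 4?[case: i => [|i]]; do 4?[case: j => [|j]]; rewrite /= ?nth_nil ?mulr0 //; ring.
Qed.

Lemma pi4_entry_int (a b c' d p q r s : int) i j :
  pi4_entry a%:~R b%:~R c'%:~R d%:~R p%:~R q%:~R r%:~R s%:~R i j =
  (pi4_entry a b c' d p q r s i j)%:~R :> R.
Proof.
rewrite /pi4_entry.
do 4?[case: i => [|i]]; do 4?[case: j => [|j]]; rewrite /= ?nth_nil //;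
  by rewrite !(rmorphB, rmorphD, rmorphM, rmorphN).
Qed.

Lemma Pi4_of_entry x : x \in entries -> spin4 (of_entry R x).1.2 /\
  Pi4 (of_entry R x).1.2 = (of_entry R x).2.
Proof.
move=> /(allP entries_checked); case: x => [[[[[d p] e] n] zl] zr].
case/and4P => n124 /allP chk /eqP nl /eqP nr; have sn := scal_sqr n124.
rewrite /= /spin_of /iquat; split.
  split; rewrite /S3 /= dotE !mxE /=.
    transitivity (scal R n ^+ 2 * (zl`_0 ^+ 2 + (nth 0 zl 1%N) ^+ 2 + (nth 0 zl 2%N) ^+ 2 + (nth 0 zl 3%N) ^+ 2)%:~R).
      by rewrite !(rmorphD, rmorphXn) /=; ring.
    by rewrite nl.
  transitivity (scal R n ^+ 2 * (zr`_0 ^+ 2 + (nth 0 zr 1%N) ^+ 2 + (nth 0 zr 2%N) ^+ 2 + (nth 0 zr 3%N) ^+ 2)%:~R).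
    by rewrite !(rmorphD, rmorphXn) /=; ring.
  by rewrite nr.
apply/matrixP => i j; rewrite Pi4E /= !mxE /= pi4_entry_scale pi4_entry_int.
have io (k : 'I_4) : (k : nat) \in iota 0 4 by rewrite mem_iota ltn_ord.
have /eqP -> := allP (chk _ (io i)) _ (io j).
by rewrite rmorphM /= mulrA -pmulrn sn mul1r.
Qed.

End EntrySpins.

Section SpinSignLemmas.
Variable R : realType.
Implicit Types (z : quat_pair R).

Lemma sqrt_cmp (x y : R) : 0 <= x -> y ^+ 2 < x ^+ 2 -> y < x.
Proof.
move=> x0 yx; rewrite ltNge; apply/negP => xy.
by move: yx; rewrite ltNge; case/negP; rewrite lerXn2r // nnegrE // (le_trans x0).
Qed.

Let sq_mul (x u : R) : 0 <= u -> (x * Num.sqrt u) ^+ 2 = x ^+ 2 * u.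
Proof. by move=> u0; rewrite exprMn sqr_sqrtr. Qed.

Let sum_sq_ge0 (x y : R) : 0 <= x ^+ 2 + y ^+ 2.
Proof. by rewrite addr_ge0 ?sqr_ge0. Qed.

(** The squares of the two terms of [spin_sign] share the summand (as)²; their difference is (bs)² -
    (ar)². The larger of |bs| and |ar| thus tells which term dominates, and [s] or [a] gives its
    sign. *)
Lemma spin_sign_gt0_l z : 0 <= z.2 o3 0 ->
  (z.1 o0 0 * z.2 o2 0) ^+ 2 < (z.1 o1 0 * z.2 o3 0) ^+ 2 -> 0 < spin_sign z.
Proof.
move=> s0 h; rewrite /spin_sign subr_gt0; apply: sqrt_cmp.
  by rewrite mulr_ge0 // sqrtr_ge0.
by rewrite !sq_mul //; move: h; rewrite !exprMn; lra.
Qed.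

Lemma spin_sign_gt0_r z : z.1 o0 0 <= 0 ->
  (z.1 o1 0 * z.2 o3 0) ^+ 2 < (z.1 o0 0 * z.2 o2 0) ^+ 2 -> 0 < spin_sign z.
Proof.
move=> a0 h; rewrite /spin_sign subr_gt0 -ltrN2; apply: sqrt_cmp.
  by rewrite oppr_ge0 mulr_le0_ge0 // sqrtr_ge0.
by rewrite !sqrrN !sq_mul //; move: h; rewrite !exprMn; lra.
Qed.

Lemma spin_sign_gt0_m z : z.1 o0 0 <= 0 -> 0 < z.2 o3 0 -> 0 < z.1 o0 0 ^+ 2 + z.1 o1 0 ^+ 2 ->
  0 < spin_sign z.
Proof.
move=> a0 s0 u0; rewrite /spin_sign subr_gt0; apply: (@le_lt_trans _ _ 0).
  by rewrite mulr_le0_ge0 // sqrtr_ge0.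
by rewrite mulr_gt0 // sqrtr_gt0.
Qed.

(** The products [ar], [bs] and [as], which decide the sign of [spin_sign], are visible on the
    matrix. *)
Lemma Pi4_sums z : (Pi4 z o0 o2 + Pi4 z o1 o3 = 2 * (z.1 o0 0 * z.2 o2 0 + z.1 o1 0 * z.2 o3 0)) *
  (Pi4 z o2 o0 + Pi4 z o3 o1 = 2 * (z.1 o1 0 * z.2 o3 0 - z.1 o0 0 * z.2 o2 0)) *
  (Pi4 z o2 o1 - Pi4 z o3 o0 - Pi4 z o1 o2 + Pi4 z o0 o3 = 4 * (z.1 o0 0 * z.2 o3 0)).
Proof. by rewrite !Pi4E /pi4_entry /=; do !split; ring. Qed.

Lemma sqr_lt_of_sums_lt0 (x y : R) : x + y < 0 -> y - x < 0 -> x ^+ 2 < y ^+ 2.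
Proof.
move=> h1 h2; rewrite -subr_gt0 subr_sqr; have := mulr_gt0 (x := - (y - x)) (y := - (y + x)).
by rewrite !oppr_gt0 mulrNN addrC => ->; rewrite // addrC.
Qed.

Lemma sqr_lt_of_sums_opp (x y : R) : x + y < 0 /\ 0 < y - x \/ 0 < x + y /\ y - x < 0 ->
  y ^+ 2 < x ^+ 2.
Proof.
move=> h; rewrite -subr_gt0 subr_sqr; case: h => -[h1 h2].
  have := mulr_gt0 (x := y - x) (y := - (x + y)); rewrite oppr_gt0 => /(_ h2 h1); lra.
by rewrite mulr_gt0 //; lra.
Qed.

(** The situation of a short arc: the first three positivity conditions on pairs of entries give
    |ar| < bs, and the differences give [as > 0], hence [s > 0]. *)
Lemma spin_sign_start z : 0 < z.1 o0 0 -> 0 < Pi4 z o0 o2 -> 0 < Pi4 z o1 o3 ->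
  0 < Pi4 z o2 o0 -> 0 < Pi4 z o3 o1 -> 0 < Pi4 z o2 o1 - Pi4 z o3 o0 ->
  0 < Pi4 z o0 o3 - Pi4 z o1 o2 -> 0 < spin_sign z.
Proof.
have [[e1 e2] e3] := Pi4_sums z.
move=> a0 h02 h13 h20 h31 hs1 hs2.
have as0 : 0 < z.1 o0 0 * z.2 o3 0 by lra.
have s0 : 0 < z.2 o3 0 by rewrite -(pmulr_rgt0 _ a0).
apply: spin_sign_gt0_l; first exact: ltW.
rewrite -subr_gt0 subr_sqr mulr_gt0 //; lra.
Qed.

(** The form taken by [frame_signs] to the left of [p]. *)
Definition end_facts (h : 'M[R]_4) : Prop :=
  [/\ [/\ h o1 o0 < 0, h o2 o1 < 0, h o3 o2 < 0, 0 < h o2 o0 & 0 < h o3 o1],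
      [/\ 0 < h o0 o1, 0 < h o1 o2, 0 < h o2 o3, 0 < h o0 o2 & 0 < h o1 o3],
      h o3 o0 < 0 /\ 0 < h o0 o3,
      [/\ h o2 o1 < h o3 o0, h o0 o3 < h o1 o2, - (1 / 2) < h o3 o0 & h o0 o3 < 1 / 2] &
      forall i, 1 / 2 < h i i].

Definition same_signs (l : seq int) (y : 'cV[R]_4) : Prop :=
  forall i : 'I_4, (0 < nth 0 l i -> 0 < y i 0) /\ (nth 0 l i < 0 -> y i 0 < 0).

(** These conditions make [spin_sign] positive at the spin itself, so that continuity settles its
    sign before [t1]. At the eleven remaining spins of the list it vanishes. *)
Definition generic_entry (x : entry) : bool :=
  let: (d, p, e, n, zl, zr) := x in
  [&& zl`_0 <= 0, 0 < nth 0 zr 3%N & (zl`_0 != 0) || (nth 0 zl 1%N != 0)].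

(** Here the sign comes from two sources: the nonzero coordinates of the limit spin fix some signs
    of [z], and the expansion of the frame fixes those of [ar + bs], [bs - ar] and, when needed,
    [as]. *)
Lemma spin_sign_end x z h : x \in entries -> ~~ generic_entry x ->
  let: (d, p, e, n, zl, zr) := x in
  same_signs zl z.1 -> same_signs zr z.2 -> end_facts h -> Pi4 z = sgmx R p e *m h ->
  0 < spin_sign z.
Proof.
have [[e1 e2] e3] := Pi4_sums z.
pose P (x : entry) := ~~ generic_entry x ->
  let: (d, p, e, n, zl, zr) := x in
  same_signs zl z.1 -> same_signs zr z.2 -> end_facts h -> Pi4 z = sgmx R p e *m h ->
  0 < spin_sign z.
(* The membership is unfolded into a conjunction, so that every entry becomes a goal of its own. *)
suff H : foldr (fun x acc => P x /\ acc) True entries.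
  have : forall l : seq entry, foldr (fun x acc => P x /\ acc) True l -> forall x, x \in l -> P x.
    elim=> [//|y l IH] /= [Py Pl] {}x; rewrite inE => /orP[/eqP ->//|]; exact: IH.
  by move/(_ _ H x) => HP xin; exact: HP.
have M p e i j : (sgmx R p e *m h) i j = (ent p e i 0%N)%:~R * h o0 j + (ent p e i 1%N)%:~R * h o1 j +
    (ent p e i 2%N)%:~R * h o2 j + (ent p e i 3%N)%:~R * h o3 j.
  by rewrite mxE sum_ord4 !mxE.
rewrite /entries /=.
do 24?[split; first (rewrite /P; try (by []))]; last by [].
all: move=> _ sl sr [[h10 h21 h32 h20 h31] [h01 h12 h23 h02 h13] [h30 h03] [d1 d2 d3 d4] hd] PE.
all: have := sl o0; have := sl o1; have := sr o2; have := sr o3; move=> /= [s1 s2] [r1 r2] [b1 b2] [a1 a2].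
all: have h00 := hd o0; have h11 := hd o1; have h22 := hd o2; have h33 := hd o3.
all: rewrite PE !M /ent /= ?(mulr0z, mulr1z, mulrN1z, mul0r, mul1r, mulN1r, add0r, addr0) in e1 e2 e3.
all: move: (z.1 o0 0) (z.1 o1 0) (z.2 o2 0) (z.2 o3 0) e1 e2 e3 s1 s2 r1 r2 b1 b2 a1 a2
  (@spin_sign_gt0_l z) (@spin_sign_gt0_r z).
all: move=> a b r s e1 e2 e3 s1 s2 r1 r2 b1 b2 a1 a2 Gl Gr.
all: clear PE M P sl sr hd x.
(* In the nine cases of dimension at most 2, both [ar + bs] and [bs - ar] are negative, so [bs]
   dominates [ar] and only the sign of [s] is missing. It is known from the limit, or follows from
   [bs < 0] and the sign of [b], or, when the limit of [b] is zero as well, from [as > 0]. *)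
1-9: have E1 : a * r + b * s < 0
  by rewrite -(pmulr_rlt0 _ (ltr0n R 2)) -e1;
    clear -h20 h31 h02 h13 h10 h21 h32 h01 h12 h23 h00 h11 h22 h33 h30 h03 d1 d2 d3 d4; lra.
1-9: have E2 : b * s - a * r < 0
  by rewrite -(pmulr_rlt0 _ (ltr0n R 2)) -e2;
    clear -h20 h31 h02 h13 h10 h21 h32 h01 h12 h23 h00 h11 h22 h33 h30 h03 d1 d2 d3 d4; lra.
1-9: have bs0 : b * s < 0 by clear - E1 E2; lra.
1-9: apply: Gl (sqr_lt_of_sums_lt0 E1 E2); apply: ltW.
3: exact: s1.
3-8: by rewrite -(nmulr_rlt0 _ (b2 isT)).
- have as0 : 0 < a * s by lra.
  by rewrite -(pmulr_rgt0 _ (a1 isT)).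
- by rewrite -(nmulr_rlt0 _ (b2 isT)).
(* In the last two cases [ar] dominates; the sign of [a] follows from that of [ar] and the known
   sign of [r]. *)
- have E1 : 0 < a * r + b * s
  by rewrite -(pmulr_rgt0 _ (ltr0n R 2)) -e1;
    clear -h20 h31 h02 h13 h10 h21 h32 h01 h12 h23 h00 h11 h22 h33 h30 h03 d1 d2 d3 d4; lra.
  have E2 : b * s - a * r < 0
  by rewrite -(pmulr_rlt0 _ (ltr0n R 2)) -e2;
    clear -h20 h31 h02 h13 h10 h21 h32 h01 h12 h23 h00 h11 h22 h33 h30 h03 d1 d2 d3 d4; lra.
  apply: Gr; last by apply: sqr_lt_of_sums_opp; right.
  have ar0 : 0 < a * r by clear - E1 E2; lra.
  by rewrite ltW // -(nmulr_lgt0 _ (r2 isT)).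
- have E1 : a * r + b * s < 0
  by rewrite -(pmulr_rlt0 _ (ltr0n R 2)) -e1;
    clear -h20 h31 h02 h13 h10 h21 h32 h01 h12 h23 h00 h11 h22 h33 h30 h03 d1 d2 d3 d4; lra.
  have E2 : 0 < b * s - a * r
  by rewrite -(pmulr_rgt0 _ (ltr0n R 2)) -e2;
    clear -h20 h31 h02 h13 h10 h21 h32 h01 h12 h23 h00 h11 h22 h33 h30 h03 d1 d2 d3 d4; lra.
  apply: Gr; last by apply: sqr_lt_of_sums_opp; left.
  have ar0 : a * r < 0 by clear - E1 E2; lra.
  by rewrite ltW // -(pmulr_llt0 _ (r1 isT)).
Qed.

End SpinSignLemmas.

(** A lift is continuous on [0, 1] only. Composing it with the retraction of the line onto [0, 1]
    makes ordinary limits available at the endpoints too. *)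
Lemma clamp_continuous {R : realType} {T : topologicalType} (f : R -> T) :
  {within [set t : R | 0 <= t <= 1], continuous f} ->
  continuous (fun t : R => f (Num.max 0 (Num.min 1 t))).
Proof.
move=> cf t; set A := [set t : R | 0 <= t <= 1] in cf; pose c x : R := Num.max 0 (Num.min 1 x).
have cA x : A (c x) by rewrite /A /= /c le_max lexx /= ge_max ler01 ge_min lexx.
have cc : c @ t --> c t.
  by apply: continuous_max; [exact: cvg_cst | apply: continuous_min; [exact: cvg_cst | exact: cvg_id]].
have fc : f x @[x --> within A (nbhs (c t))] --> f (c t).
  by move/subspace_continuousP : cf; apply.
move=> P /fc P'.
have /cc P2 : nbhs (c t) (fun x => A x -> P (f x)) by exact: P'.
have P3 : \forall x \near t, A (c x) -> P (f (c x)) by exact: P2.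
have : \forall x \near t, P (f (c x)) by apply: filterS P3 => x; apply; exact: cA.
by [].
Qed.

Lemma clamp_id {R : realType} (t : R) : 0 <= t <= 1 -> Num.max 0 (Num.min 1 t) = t.
Proof. by move=> /andP[t0 t1]; rewrite (min_idPr t1) (max_idPr t0). Qed.

Section SwUpper.
Variable R : realType.
Implicit Types (A U : 'M[R]_4).

Lemma sw_mul_upper A U : Up4plus U ->
  [/\ sw1 (A *m U) = sw1 A * U o0 o0, sw2 (A *m U) = sw2 A * (U o0 o0 * U o1 o1) &
      sw3 (A *m U) = sw3 A * (U o0 o0 * U o1 o1 * U o2 o2)].
Proof.
move=> [l _].
have l10 := l o1 o0 isT; have l20 := l o2 o0 isT; have l30 := l o3 o0 isT.
have l21 := l o2 o1 isT; have l31 := l o3 o1 isT; have l32 := l o3 o2 isT.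
by split; rewrite /sw1 /sw2 /sw3 !(mxE, sum_ord4) l10 ?l20 ?l30 ?l21 ?l31 ?l32; ring.
Qed.

Lemma sw_mul_upper_gt0 A U : Up4plus U ->
  [/\ 0 < sw1 (A *m U), 0 < sw2 (A *m U) & 0 < sw3 (A *m U)] ->
  [/\ 0 < sw1 A, 0 < sw2 A & 0 < sw3 A].
Proof.
move=> uU; have [-> -> ->] := sw_mul_upper A uU; case: uU => _ d.
by rewrite !pmulr_lgt0 // !mulr_gt0.
Qed.

End SwUpper.

Lemma Pi4N (R : realType) (z : quat_pair R) : Pi4 (- z) = Pi4 z.
Proof.
by apply/matrixP; apply: forall_ord4; apply: forall_ord4; rewrite !Pi4E /pi4_entry /= !mxE; ring.
Qed.

(** * The transported spin along a convex arc *)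

Section SpinTracking.
Variable R : realType.
Implicit Types (f g : R -> 'cV[R]_4) (z w : quat_pair R).

Lemma cvg_qmul (T : Type) (F : set_system T) {FF : Filter F} (f g : T -> 'cV[R]_4) (x y : 'cV[R]_4) :
  cvg_vec F f x -> cvg_vec F g y -> cvg_vec F (fun t => qmul (f t) (g t)) (qmul x y).
Proof.
move=> hf hg; apply: forall_ord4; under eq_fun do rewrite qmulE !quat_entries;
  rewrite qmulE !quat_entries.
- by apply: cvgB; [apply: cvgB; [apply: cvgB|]|]; apply: cvgM.
- by apply: cvgB; [apply: cvgD; [apply: cvgD|]|]; apply: cvgM.
- by apply: cvgD; [apply: cvgD; [apply: cvgB|]|]; apply: cvgM.
- by apply: cvgD; [apply: cvgB; [apply: cvgD|]|]; apply: cvgM.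
Qed.

Lemma cvg_qconj (T : Type) (F : set_system T) {FF : Filter F} (f : T -> 'cV[R]_4) (x : 'cV[R]_4) :
  cvg_vec F f x -> cvg_vec F (fun t => qconj (f t)) (qconj x).
Proof.
move=> hf; apply: forall_ord4; under eq_fun do rewrite qconjE !quat_entries;
  by rewrite qconjE !quat_entries; try apply: cvgN; exact: hf.
Qed.

Lemma qconj_mul_cvg f g (F : set_system R) {FF : Filter F} (x y : 'cV[R]_4) :
  (forall i, f t i 0 @[t --> F] --> x i 0) -> (forall i, g t i 0 @[t --> F] --> y i 0) ->
  forall i, qmul (qconj (f t)) (g t) i 0 @[t --> F] --> qmul (qconj x) y i 0.
Proof. by move=> hf hg; apply: cvg_qmul => //; exact: cvg_qconj. Qed.

Lemma spin_sign_cvg (f : R -> quat_pair R) (F : set_system R) {FF : Filter F} z :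
  (forall i, (f t).1 i 0 @[t --> F] --> z.1 i 0) -> (forall i, (f t).2 i 0 @[t --> F] --> z.2 i 0) ->
  spin_sign (f t) @[t --> F] --> spin_sign z.
Proof.
have sq (u v : R -> R) (a b : R) : u t @[t --> F] --> a -> v t @[t --> F] --> b ->
    Num.sqrt (u t ^+ 2 + v t ^+ 2) @[t --> F] --> Num.sqrt (a ^+ 2 + b ^+ 2).
  move=> ua vb; apply: (continuous_cvg _ (@sqrt_continuous R _)).
  by apply: cvgD; rewrite expr2; under eq_fun do rewrite expr2; apply: cvgM.
by move=> h1 h2; apply: cvgB; apply: cvgM => //; exact: sq.
Qed.

Variables (gamma : R -> 'cV[R]_4) (t0 t1 : R) (zt : R -> quat_pair R).
Hypothesis lc : Defs.locally_convex gamma.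
Hypotheses (le0t0 : 0 <= t0) (lt01 : t0 < t1) (let1 : t1 <= 1).
Hypothesis cv : convex_arc gamma t0 t1.
Hypothesis zc1 : forall t i, (zt x).1 i 0 @[x --> t] --> (zt t).1 i 0.
Hypothesis zc2 : forall t i, (zt x).2 i 0 @[x --> t] --> (zt t).2 i 0.
Hypothesis zs : forall t, 0 <= t <= 1 -> spin4 (zt t).
Hypothesis zP : forall t, 0 <= t <= 1 -> Pi4 (zt t) = frenet gamma t.

Local Notation F := (frenet gamma).
(** Conjugates are polynomial in the coordinates, unlike [spin_inv]; the two agree on unit
    quaternions. *)
Let V s t : quat_pair R := (qmul (qconj (zt s).1) (zt t).1, qmul (qconj (zt s).2) (zt t).2).

Let VE s t : 0 <= s <= 1 -> V s t = spin_mul (spin_inv (zt s)) (zt t).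
Proof. by move=> s01; rewrite spin_invE //; exact: zs. Qed.

Let Vs s t : 0 <= s <= 1 -> 0 <= t <= 1 -> spin4 (V s t).
Proof. by move=> s01 t01; rewrite VE //; apply: spin4M; [apply: spin4V|]; exact: zs. Qed.

Let VP s t : 0 <= s <= 1 -> 0 <= t <= 1 -> Pi4 (V s t) = (F s)^T *m F t.
Proof. by move=> s01 t01; rewrite VE // Pi4M Pi4V ?zP //; exact: zs. Qed.

Let Vc1 s t i : (V s x).1 i 0 @[x --> t] --> (V s t).1 i 0.
Proof. by apply: qconj_mul_cvg => j; [exact: cvg_cst | exact: zc1]. Qed.
Let Vc2 s t i : (V s x).2 i 0 @[x --> t] --> (V s t).2 i 0.
Proof. by apply: qconj_mul_cvg => j; [exact: cvg_cst | exact: zc2]. Qed.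

Let Vsign_start s : 0 <= s < 1 -> \forall t \near s^'+, 0 < spin_sign (V s t).
Proof.
move=> /andP[s0 s1]; have s01 : 0 <= s <= 1 by rewrite s0 ltW.
pose h t := (F s)^T *m F t.
have facts : \forall t \near s^'+, 0 < t - s ->
    [/\ 0 < h t o2 o0 /\ 0 < h t o3 o1, 0 < h t o0 o2 /\ 0 < h t o1 o3 &
        0 < h t o2 o1 - h t o3 o0 /\ 0 < h t o0 o3 - h t o1 o2].
  apply: filterS (near_dnbhs_right (frame_signs lc s01)).
  move=> t [[_ _ _ a b] [_ _ _ c d] _ [e f _ _] _] T0.
  by rewrite pmulr_lgt0 // in e; rewrite pmulr_lgt0 // in f.
have Vss : (V s s).1 o0 0 = 1.
  by have [z1 _] := zs s01; rewrite /V /= qconj_mul_norm // /q1 quat_entries.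
have c0 : \forall t \near s^'+, 0 < (V s t).1 o0 0.
  have cV := cvg_at_right_filter (@Vc1 s s o0).
  by apply: (cvgr_gt _ cV); rewrite Vss.
have right : \forall t \near s^'+, s < t < 1.
  by near=> t; apply/andP; split; near: t; [exact: nbhs_right_gt | exact: nbhs_right_lt].
apply: filterS3 facts c0 right => t ft a0 /andP[st t1'].
have t01 : 0 <= t <= 1 by rewrite !ltW // (le_lt_trans s0).
move: ft; rewrite /h -VP // subr_gt0 => /(_ st)[[a b] [c d] [e f]].
exact: spin_sign_start.
Unshelve. all: by end_near. Qed.

(** The jet at [x] is the frame at [x] times a matrix in [Up4plus], so the minors of the transported
    frame are positive as well and [spin_sign] has no zero. It therefore keeps the sign it has on
    short arcs. *)
Let Vsign_gt0 s t : t0 < s -> s < t -> t < t1 -> 0 < spin_sign (V s t).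
Proof.
move=> t0s st tt1.
have s0 : 0 <= s by rewrite (le_trans le0t0) // ltW.
have s1 : s < 1 by rewrite (lt_le_trans _ let1) // (lt_trans st).
have s01 : 0 <= s <= 1 by rewrite s0 ltW.
apply: (@pos_of_pos_near R (fun t => spin_sign (V s t)) s t1); last by rewrite st.
- by move=> x _; apply: spin_sign_cvg => i; [exact: Vc1 | exact: Vc2].
- move=> x /andP[sx xt1].
  have x01 : 0 <= x <= 1 by rewrite (le_trans s0 (ltW sx)) (le_trans (ltW xt1)).
  have [U uU JE] := frenet_factor lc x01.
  have := sw_gt0 lc le0t0 let1 cv t0s sx xt1.
  rewrite JE mulmxA => /(sw_mul_upper_gt0 uU); rewrite -VP // => -[h1 h2 h3].
  by apply: spin_sign_neq0 => //; exact: Vs.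
- by apply: Vsign_start; rewrite s0.
Qed.

Let t001 : 0 <= t0 <= 1. Proof. by rewrite le0t0 (le_trans (ltW lt01)). Qed.
Let t101 : 0 <= t1 <= 1. Proof. by rewrite let1 (le_trans le0t0) // ltW. Qed.

Let Vsign_ge0 t : t0 < t -> t < t1 -> 0 <= spin_sign (V t0 t).
Proof.
move=> t0t tt1; apply: (@ge0_at_right R (fun s => spin_sign (V s t))).
  by apply: spin_sign_cvg; apply: qconj_mul_cvg => j; try exact: cvg_cst; [exact: zc1|exact: zc2].
have right : \forall s \near t0^'+, t0 < s < t.
  by near=> s; apply/andP; split; near: s; [exact: nbhs_right_gt | exact: nbhs_right_lt].
by apply: filterS right => s /andP[a b]; apply/ltW; exact: Vsign_gt0.
Unshelve. all: by end_near. Qed.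

Lemma end_facts_near : \forall t \near t1^'-, end_facts ((F t1)^T *m F t).
Proof.
have lt : \forall t \near t1^'-, t < t1 by exact: nbhs_left_lt.
apply: filterS2 lt (near_dnbhs_left (frame_signs lc t101)) => t tt1.
have T0 : t - t1 < 0 by rewrite subr_lt0.
case=> -[a1 a2 a3 a4 a5] [b1 b2 b3 b4 b5] [c1 c2] [d1 d2 d3 d4] dd.
rewrite nmulr_lgt0 // in a1; rewrite nmulr_lgt0 // in a2; rewrite nmulr_lgt0 // in a3.
rewrite nmulr_lgt0 // oppr_lt0 in b1; rewrite nmulr_lgt0 // oppr_lt0 in b2.
rewrite nmulr_lgt0 // oppr_lt0 in b3.
rewrite nmulr_lgt0 // in c1; rewrite nmulr_lgt0 // oppr_lt0 in c2.
rewrite nmulr_lgt0 // subr_lt0 in d1; rewrite nmulr_lgt0 // subr_lt0 in d2.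
rewrite ltr_norml in d3; rewrite ltr_norml in d4.
by case/andP: d3 => d3 _; case/andP: d4.
Qed.

(** If the arc ended at the opposite of the listed spin [w], then [- V t0 t] would tend to [w] and
    have positive [spin_sign] just before [t1]. This contradicts [Vsign_ge0]; the weak inequality at
    [t0] suffices because the sign at the other end is strict. *)
Lemma convex_spin_of_entry x : x \in entries ->
  Pi4 (spin_mul (spin_inv (zt t0)) (zt t1)) = (of_entry R x).2 ->
  spin_mul (spin_inv (zt t0)) (zt t1) = (of_entry R x).1.2.
Proof.
move=> xin PQ; have [sx Px] := Pi4_of_entry R xin.
rewrite -VE // in PQ *; have [-> //|Ve] : (V t0 t1) = (of_entry R x).1.2 \/ V t0 t1 = - (of_entry R x).1.2.
  by apply: Pi4_eq => //; [exact: Vs | rewrite Px PQ].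
set w := (of_entry R x).1.2 in sx Px Ve; exfalso; have e : w = - V t0 t1 by rewrite Ve opprK.
have wc1 i : (- V t0 t).1 i 0 @[t --> t1^'-] --> w.1 i 0.
  rewrite e /= mxE; under eq_fun do rewrite mxE; apply: cvgN; apply: cvg_at_left_filter; exact: (@Vc1 t0 t1 i).
have wc2 i : (- V t0 t).2 i 0 @[t --> t1^'-] --> w.2 i 0.
  rewrite e /= mxE; under eq_fun do rewrite mxE; apply: cvgN; apply: cvg_at_left_filter; exact: (@Vc2 t0 t1 i).
have t0t : \forall t \near t1^'-, t0 < t by exact: nbhs_left_gt.
have tt1 : \forall t \near t1^'-, t < t1 by exact: nbhs_left_lt.
suff : \forall t \near t1^'-, 0 < spin_sign (- V t0 t).
  move=> pos; have [t [a [b c]]] : exists t, 0 < spin_sign (- V t0 t) /\ t0 < t /\ t < t1.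
    by apply: (@filter_ex _ _ (at_left_proper_filter t1)); apply: filterS3 pos t0t tt1 => t.
  by move: a; rewrite spin_signN oppr_gt0 ltNge Vsign_ge0.
(* At a generic spin the value at the limit is already positive. *)
have [gx|ngx] := boolP (generic_entry x).
  apply: (cvgr_gt (spin_sign w)); first exact: spin_sign_cvg.
  case: x @w xin gx {PQ sx Px Ve e wc1 wc2} => [[[[[d p] es] n] zl] zr] w xin /and3P[a b c].
  have s0 := scal_gt0 R n.
  apply: spin_sign_gt0_m; rewrite /w /= /iquat !mxE /=.
  - by rewrite pmulr_rle0 // lerz0.
  - by rewrite pmulr_rgt0 // ltr0z.
  - case/orP: c => c; [apply: ltr_wpDr|apply: ltr_wpDl]; rewrite ?sqr_ge0 //.
      by rewrite exprn_even_gt0 //= mulf_eq0 negb_or gt_eqF //= intr_eq0.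
    by rewrite exprn_even_gt0 //= mulf_eq0 negb_or gt_eqF //= intr_eq0.
(* Otherwise the limit only supplies the signs of its nonzero coordinates, and the frame at [t1] the
   rest. *)
have signs (l : seq int) n (f : R -> 'cV[R]_4) :
    (forall i, f t i 0 @[t --> t1^'-] --> (scal R n *: iquat R l) i 0) ->
    \forall t \near t1^'-, same_signs l (f t).
  move=> fl; apply: filter_forall => i.
  have lE : (scal R n *: iquat R l) i 0 = scal R n * (nth 0 l i)%:~R.
    by rewrite mxE; congr (_ * _); move: i; apply: forall_ord4; rewrite mxE.
  have {}fl := fl i; rewrite lE in fl.
  have [l0|l0|l0] := ltgtP (nth 0 l i) 0; last by near=> t.
    have : \forall t \near t1^'-, f t i 0 < 0.
      by apply: (cvgr_lt _ fl); rewrite pmulr_rlt0 ?scal_gt0 // ltrz0.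
    by apply: filterS => t.
  have : \forall t \near t1^'-, 0 < f t i 0.
    by apply: (cvgr_gt _ fl); rewrite pmulr_rgt0 ?scal_gt0 // ltr0z.
  by apply: filterS => t.
have PV t : 0 <= t <= 1 -> Pi4 (- V t0 t) = (of_entry R x).2 *m ((F t1)^T *m F t).
  move=> t01; rewrite Pi4N -PQ !VP // mulmxA -(mulmxA (F t0)^T).
  by rewrite (mulmx1C (frenet_orth lc t101)) mulmx1.
have := end_facts_near.
have S1 := @signs x.1.2 x.1.1.2 (fun t => (- V t0 t).1).
have S2 := @signs x.2 x.1.1.2 (fun t => (- V t0 t).2).
have {S1} S1 : \forall t \near t1^'-, same_signs x.1.2 (- V t0 t).1.
  by apply: S1 => i; move: (wc1 i); rewrite /w; case: (x) => [[[[[? ?] ?] ?] ?] ?].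
have {S2} S2 : \forall t \near t1^'-, same_signs x.2 (- V t0 t).2.
  by apply: S2 => i; move: (wc2 i); rewrite /w; case: (x) => [[[[[? ?] ?] ?] ?] ?].
have {}t0t : \forall t \near t1^'-, t0 < t < t1.
  by apply: filterS2 t0t tt1 => t -> ->.
move=> ef; apply: filterS2 (filterI S1 S2) (filterI ef t0t) => t [s1 s2] [e3 /andP[t0t1 tt1']].
have t01 : 0 <= t <= 1 by rewrite (le_trans le0t0 (ltW t0t1)) (le_trans (ltW tt1')).
have := @spin_sign_end R x (- V t0 t) ((F t1)^T *m F t) xin ngx.
move: (PV t t01) s1 s2; case: (x) => [[[[[d p] es] n] zl] zr] /= P1 s1 s2.
by move/(_ s1 s2 e3 P1).
Unshelve. all: by end_near. Qed.

End SpinTracking.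

Section LiftedArcs.
Variable R : realType.
Variables (gamma : R -> 'cV[R]_4) (t0 t1 : R) (zt : R -> quat_pair R).
Hypothesis lc : Defs.locally_convex gamma.
Hypotheses (le0t0 : 0 <= t0) (lt01 : t0 < t1) (let1 : t1 <= 1).
Hypothesis lift : is_frenet_lift gamma zt.

Let t001 : 0 <= t0 <= 1. Proof. by rewrite le0t0 (le_trans (ltW lt01)). Qed.
Let t101 : 0 <= t1 <= 1. Proof. by rewrite let1 (le_trans le0t0) // ltW. Qed.

Lemma Pi4_lift_frame : Pi4 (spin_mul (spin_inv (zt t0)) (zt t1)) =
  (frenet gamma t0)^T *m frenet gamma t1.
Proof. by case: lift => _ _ sz Pz; rewrite Pi4M Pi4V ?Pz //; exact: sz. Qed.

Lemma convex_arc_spin x : convex_arc gamma t0 t1 -> x \in entries ->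
  (frenet gamma t0)^T *m frenet gamma t1 = (of_entry R x).2 ->
  spin_mul (spin_inv (zt t0)) (zt t1) = (of_entry R x).1.2.
Proof.
move=> cv xin; rewrite -Pi4_lift_frame; case: lift => cz _ sz Pz.
pose c t : R := Num.max 0 (Num.min 1 t).
have cc := clamp_continuous cz.
rewrite -{1 2}(clamp_id t001) -{1 2}(clamp_id t101).
apply: (@convex_spin_of_entry R gamma t0 t1 (zt \o c)) => //.
- move=> t i; apply: (continuous_comp (f := fst \o (zt \o c)) (g := fun M : 'cV[R]_4 => M i 0)).
    by apply: continuous_comp; [exact: cc | exact: cvg_fst].
  exact: coord_continuous.
- move=> t i; apply: (continuous_comp (f := snd \o (zt \o c)) (g := fun M : 'cV[R]_4 => M i 0)).
    by apply: continuous_comp; [exact: cc | exact: cvg_snd].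
  exact: coord_continuous.
- by move=> t t01; rewrite /= /c clamp_id //; exact: sz.
- by move=> t t01; rewrite /= /c clamp_id //; exact: Pz.
Qed.

End LiftedArcs.

(** * Existence of lifts *)

Section RotationSection.
Variable R : realType.
Implicit Types (u v x y : 'cV[R]_4) (P : 'M[R]_4) (z : quat_pair R).

Lemma quat_ext x y : x o0 0 = y o0 0 -> x o1 0 = y o1 0 -> x o2 0 = y o2 0 ->
  x o3 0 = y o3 0 -> x = y.
Proof.
move=> h0 h1 h2 h3; apply/matrixP => i j; rewrite (ord1 j); move: i; exact: forall_ord4.
Qed.

Lemma qmulZl c x y : qmul (c *: x) y = c *: qmul x y.
Proof. by apply: quat_ext; rewrite !(qmulE, mxE) /= ?mxE; ring. Qed.

Lemma qmulZr c x y : qmul x (c *: y) = c *: qmul x y.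
Proof. by apply: quat_ext; rewrite !(qmulE, mxE) /= ?mxE; ring. Qed.

Lemma qmulBl x y v : qmul (x - y) v = qmul x v - qmul y v.
Proof. by apply: quat_ext; rewrite !(qmulE, mxE) /= ?mxE; ring. Qed.

Lemma qmulBr x y v : qmul v (x - y) = qmul v x - qmul v y.
Proof. by apply: quat_ext; rewrite !(qmulE, mxE) /= ?mxE; ring. Qed.

Lemma qmul1l x : qmul (q1 R) x = x.
Proof. by rewrite qmulE /q1 !quat_entries [RHS]quat_eta; congr quat; ring. Qed.

Lemma qmul1r x : qmul x (q1 R) = x.
Proof. by rewrite qmulE /q1 !quat_entries [RHS]quat_eta; congr quat; ring. Qed.

Lemma qconjK x : qconj (qconj x) = x.
Proof. by rewrite !qconjE !quat_entries !opprK -quat_eta. Qed.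

Lemma qmul_conj_norm x : S3 x -> qmul x (qconj x) = q1 R.
Proof.
by move=> h; rewrite -{1}(qconjK x) qconj_mul_norm // /S3 /= dot_qconj.
Qed.

Lemma qmul_imaginary u : S3 u -> u o0 0 = 0 -> qmul u u = -1 *: q1 R.
Proof.
move=> hu u0; have {1}-> : u = - qconj u.
  by apply: quat_ext; rewrite !(mxE, qconjE) /= ?u0 ?opprK ?oppr0.
by rewrite -scaleN1r qmulZl qconj_mul_norm.
Qed.

(** For imaginary units, r = 1 - uv satisfies rv = u + v = ur, so conjugation by [r] carries [v] to
    [u]. It vanishes only for u = -v. *)
Definition rotor u v : 'cV[R]_4 := q1 R - qmul u v.

Definition qrot u v : 'cV[R]_4 := normalize (rotor u v).

Lemma qrot_conj u v : S3 u -> S3 v -> u o0 0 = 0 -> v o0 0 = 0 ->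
  dot (rotor u v) (rotor u v) != 0 -> qmul (qmul (qrot u v) v) (qconj (qrot u v)) = u.
Proof.
move=> hu hv u0 v0 r0; have S3r : S3 (qrot u v) by exact: dot_normalize.
have -> : qmul (qrot u v) v = qmul u (qrot u v).
  rewrite /qrot /normalize qmulZl qmulZr; congr (_ *: _).
  rewrite qmulBl qmulBr qmul1l qmul1r -qmulA qmul_imaginary // qmulA qmul_imaginary //.
  by rewrite qmulZr qmulZl qmul1l qmul1r !scaleN1r !opprK addrC.
by rewrite -qmulA qmul_conj_norm // qmul1r.
Qed.

Lemma det_Pi4 z : spin4 z -> \det (Pi4 z) = 1.
Proof.
(* Left and right multiplications are treated apart: each determinant is the fourth power of a
   norm. *)
move=> [h1 h2]; have -> : z = spin_mul (z.1, q1 R) (q1 R, z.2).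
  by rewrite /spin_mul /= qmul1l qmul1r; case: (z).
rewrite Pi4M det_mulmx !det4 !Pi4E /pi4_entry /= /q1 !quat_entries.
transitivity (dot z.1 z.1 ^+ 2 * dot z.2 z.2 ^+ 2); last by rewrite h1 h2 !expr1n mulr1.
by rewrite !dotE; congr (_ * _); ring.
Qed.

Lemma orth_Pi4 z : spin4 z -> (Pi4 z)^T *m Pi4 z = 1%:M.
Proof.
move=> sz; rewrite -Pi4V // -Pi4M spin_invE // /spin_mul /=.
case: sz => h1 h2; rewrite !qconj_mul_norm //.
by apply/matrixP; apply: forall_ord4; apply: forall_ord4;
  rewrite Pi4E /pi4_entry /= /q1 !quat_entries !mxE /=; ring.
Qed.

Lemma spin4_q1 x : S3 x -> spin4 (x, q1 R).
Proof. by move=> h; split=> //; rewrite /S3 /= dotE /q1 !quat_entries; ring. Qed.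

(* [P] is undone one column at a time: first [e_1], then [e_2], then [e_3]; a
   rotation fixing these three vectors is the identity. *)
Definition undo1 P : 'M[R]_4 := (Pi4 (col o0 P, q1 R))^T *m P.
Definition rot1 P : 'cV[R]_4 := qrot (col o1 (undo1 P)) (qi R).
Definition undo2 P : 'M[R]_4 := (Pi4 (rot1 P, rot1 P))^T *m undo1 P.
Definition rot2 P : 'cV[R]_4 := qrot (col o2 (undo2 P)) (qj R).

Definition spin_section P : quat_pair R :=
  spin_mul (col o0 P, q1 R) (spin_mul (rot1 P, rot1 P) (rot2 P, rot2 P)).

(** An open condition, true at the identity, which excludes the antipodal cases where a rotor is
    zero. *)
Definition spin_section_dom P : Prop :=
  0 < dot (rotor (col o1 (undo1 P)) (qi R)) (rotor (col o1 (undo1 P)) (qi R)) /\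
  0 < dot (rotor (col o2 (undo2 P)) (qj R)) (rotor (col o2 (undo2 P)) (qj R)).

Lemma SO4_Pi4_mul z P : spin4 z -> SO4 P -> SO4 ((Pi4 z)^T *m P).
Proof.
move=> sz [oP dP]; split.
  by rewrite trmx_mul trmxK mulmxA -(mulmxA P^T) (mulmx1C (orth_Pi4 sz)) mulmx1.
by rewrite det_mulmx det_tr det_Pi4 // dP mulr1.
Qed.

Lemma orth_col P i j : P^T *m P = 1%:M -> dot (col i P) (col j P) = (i == j)%:R.
Proof. by move=> oP; rewrite dotE !mxE -mul_trmx4 oP mxE. Qed.

Lemma SO4_fixes_123 (A : 'M[R]_4) : A^T *m A = 1%:M -> \det A = 1 ->
  col o0 A = q1 R -> col o1 A = qi R -> col o2 A = qj R -> A = 1%:M.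
Proof.
move=> oA dA c0 c1 c2; have c i j : A i j = (col j A) i 0 by rewrite mxE.
have h0 : (col o3 A) o0 0 = 0.
  have : dot (col o0 A) (col o3 A) = 0 by rewrite orth_col.
  by rewrite c0 dotE /q1 !quat_entries => <-; ring.
have h1 : (col o3 A) o1 0 = 0.
  have : dot (col o1 A) (col o3 A) = 0 by rewrite orth_col.
  by rewrite c1 dotE /qi !quat_entries => <-; ring.
have h2 : (col o3 A) o2 0 = 0.
  have : dot (col o2 A) (col o3 A) = 0 by rewrite orth_col.
  by rewrite c2 dotE /qj !quat_entries => <-; ring.
have h3 : (col o3 A) o3 0 = 1.
  rewrite -dA det4 !(c _ o0) !(c _ o1) !(c _ o2) !(c _ o3) c0 c1 c2 h0 h1 h2.
  by rewrite /q1 /qi /qj !quat_entries; ring.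
apply/matrixP => i j; rewrite c [RHS]mxE; move: j i; apply: forall_ord4; rewrite ?c0 ?c1 ?c2;
  by apply: forall_ord4; rewrite /q1 /qi /qj ?quat_entries ?h0 ?h1 ?h2 ?h3.
Qed.

Lemma spin_sectionP P : SO4 P -> spin_section_dom P ->
  spin4 (spin_section P) /\ Pi4 (spin_section P) = P.
Proof.
move=> sP [d1 d2].
have [oP _] := sP; have w1 : S3 (col o0 P) by rewrite /S3 /= orth_col.
have sz1 := spin4_q1 w1; have s1 := SO4_Pi4_mul sz1 sP; rewrite -/(undo1 P) in s1.
have [or1 _] := s1.
have PiK z (A B : 'M[R]_4) : spin4 z -> A = (Pi4 z)^T *m B -> B = Pi4 z *m A.
  by move=> sz ->; rewrite mulmxA (mulmx1C (orth_Pi4 sz)) mul1mx.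
have PiK' z (x y : 'cV[R]_4) : spin4 z -> Pi4 z *m x = y -> (Pi4 z)^T *m y = x.
  by move=> sz <-; rewrite mulmxA (orth_Pi4 sz) mul1mx.
have colT z (A : 'M[R]_4) i : col i ((Pi4 z)^T *m A) = (Pi4 z)^T *m col i A by rewrite !colE mulmxA.
have c10 : col o0 (undo1 P) = q1 R.
  rewrite /undo1 colT; apply: PiK' => //.
  by rewrite Pi4_act /= qmul1r -[RHS]qmul1r; congr qmul; rewrite qconjE /q1 !quat_entries oppr0.
have q1o0 (x : 'cV[R]_4) : dot (q1 R) x = x o0 0 by rewrite dotE /q1 !quat_entries; ring.
have qio1 (x : 'cV[R]_4) : dot (qi R) x = x o1 0 by rewrite dotE /qi !quat_entries; ring.
have qjo2 (x : 'cV[R]_4) : dot (qj R) x = x o2 0 by rewrite dotE /qj !quat_entries; ring.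
have Sqi : S3 (qi R) by rewrite /S3 /= qio1 /qi quat_entries.
have Sqj : S3 (qj R) by rewrite /S3 /= qjo2 /qj quat_entries.
have qi0 : (qi R) o0 0 = 0 by rewrite /qi quat_entries.
have qj0 : (qj R) o0 0 = 0 by rewrite /qj quat_entries.
have Sc (A : 'M[R]_4) i : A^T *m A = 1%:M -> S3 (col i A) by move=> oA; rewrite /S3 /= orth_col // eqxx.
have u0 : (col o1 (undo1 P)) o0 0 = 0 by rewrite -q1o0 -c10 orth_col.
have r1 := qrot_conj (Sc _ _ or1) Sqi u0 qi0 (lt0r_neq0 d1).
have S1 : S3 (rot1 P) by apply: dot_normalize; exact: lt0r_neq0.
have sr1 : spin4 (rot1 P, rot1 P) by [].
have s2 := SO4_Pi4_mul sr1 s1; rewrite -/(undo2 P) in s2; have [or2 _] := s2.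
have fix1 (z : 'cV[R]_4) : S3 z -> Pi4 (z, z) *m q1 R = q1 R.
  by move=> hz; rewrite Pi4_act /= qmul1r qmul_conj_norm.
have c20 : col o0 (undo2 P) = q1 R by rewrite /undo2 colT c10; apply: PiK' => //; exact: fix1.
have c21 : col o1 (undo2 P) = qi R.
  by rewrite /undo2 colT; apply: PiK' => //; rewrite Pi4_act.
have v0 : (col o2 (undo2 P)) o0 0 = 0 by rewrite -q1o0 -c20 orth_col.
have v1 : (col o2 (undo2 P)) o1 0 = 0 by rewrite -qio1 -c21 orth_col.
have r2 := qrot_conj (Sc _ _ or2) Sqj v0 qj0 (lt0r_neq0 d2).
have S2 : S3 (rot2 P) by apply: dot_normalize; exact: lt0r_neq0.
have sr2 : spin4 (rot2 P, rot2 P) by [].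
pose A3 := (Pi4 (rot2 P, rot2 P))^T *m undo2 P.
have [or3 d3] : SO4 A3 := SO4_Pi4_mul sr2 s2.
have c30 : col o0 A3 = q1 R by rewrite /A3 colT c20; apply: PiK' => //; exact: fix1.
have c32 : col o2 A3 = qj R.
  by rewrite /A3 colT; apply: PiK' => //; rewrite Pi4_act.
have c31 : col o1 A3 = qi R.
  rewrite /A3 colT c21; apply: PiK' => //; rewrite Pi4_act /=.
  (* The second rotor fixes [i]: since [v] is orthogonal to 1 and [i], the product of [v] and [j]
     lies in the span of 1 and [i], which commutes with [i]. *)
  have -> : qmul (rot2 P) (qi R) = qmul (qi R) (rot2 P).
    rewrite /rot2 /qrot /normalize qmulZl qmulZr; congr (_ *: _).
    move: v0 v1; rewrite /rotor; move: (col _ _) => v v0 v1.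
    rewrite qmulBl qmulBr qmul1l qmul1r; congr (_ - _).
    have -> : qmul v (qj R) = quat (- v o2 0) (- v o3 0) 0 0.
      by rewrite qmulE /qj !quat_entries v0 v1; congr quat; ring.
    by rewrite !qmulE /qi !quat_entries; congr quat; ring.
  by rewrite -qmulA qmul_conj_norm // qmul1r.
have A31 : A3 = 1%:M := SO4_fixes_123 or3 d3 c30 c31 c32.
split; first by apply: spin4M => //; exact: spin4M.
rewrite /spin_section !Pi4M [RHS](PiK _ _ _ sz1 (erefl (undo1 P))); congr (_ *m _).
rewrite [RHS](PiK _ _ _ sr1 (erefl (undo2 P))); congr (_ *m _).
by rewrite [RHS](PiK _ _ _ sr2 (erefl A3)) A31 mulmx1.
Qed.

End RotationSection.

Section LiftExistence.
Variable R : realType.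

Lemma cvg_mx (T : Type) (F : set_system T) {FF : Filter F} m n (f : T -> 'M[R]_(m, n)) (l : 'M[R]_(m, n)) :
  (forall i j, f t i j @[t --> F] --> l i j) -> f t @[t --> F] --> l.
Proof.
move=> h; apply/cvg_ballP => e e0.
have : \forall t \near F, forall i j, ball (l i j) e (f t i j).
  apply: filter_forall => i; apply: filter_forall => j.
  by move: (h i j) => /cvg_ballP; exact.
by apply: filterS.
Qed.

Lemma cvg_Pi4 (T : Type) (F : set_system T) {FF : Filter F} (f g : T -> 'cV[R]_4) (x y : 'cV[R]_4) :
  cvg_vec F f x -> cvg_vec F g y ->
  forall i j, Pi4 (f t, g t) i j @[t --> F] --> Pi4 (x, y) i j.
Proof.
move=> hf hg i j; under eq_fun do rewrite mxE; rewrite mxE.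
apply: cvg_qmul; last exact: cvg_qconj.
by apply: cvg_qmul => // k; exact: cvg_cst.
Qed.

Lemma cvg_spin_section (T : Type) (F : set_system T) {FF : Filter F} (A : T -> 'M[R]_4) (A0 : 'M[R]_4) :
  (forall i j, A t i j @[t --> F] --> A0 i j) -> spin_section_dom A0 ->
  [/\ cvg_vec F (fun t => (spin_section (A t)).1) (spin_section A0).1,
      cvg_vec F (fun t => (spin_section (A t)).2) (spin_section A0).2 &
      \forall t \near F, spin_section_dom (A t)].
Proof.
move=> hA [d1 d2].
have cst (x : 'cV[R]_4) : cvg_vec F (fun=> x) x by move=> i; exact: cvg_cst.
have ccol (B : T -> 'M[R]_4) (B0 : 'M[R]_4) k : (forall i j, B t i j @[t --> F] --> B0 i j) ->
    cvg_vec F (fun t => col k (B t)) (col k B0).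
  by move=> hB i; under eq_fun do rewrite mxE; rewrite mxE; exact: hB.
have cundo (f g : T -> 'cV[R]_4) (x y : 'cV[R]_4) (B : T -> 'M[R]_4) (B0 : 'M[R]_4) :
    cvg_vec F f x -> cvg_vec F g y -> (forall i j, B t i j @[t --> F] --> B0 i j) ->
    forall i j, ((Pi4 (f t, g t))^T *m B t) i j @[t --> F] --> ((Pi4 (x, y))^T *m B0) i j.
  by move=> hf hg hB; apply: cvg_trmx_mul => //; exact: cvg_Pi4.
have crotor (f : T -> 'cV[R]_4) (x v : 'cV[R]_4) : cvg_vec F f x ->
    cvg_vec F (fun t => rotor (f t) v) (rotor x v).
  move=> hf i; under eq_fun do rewrite mxE; rewrite mxE; apply: cvgD; first exact: cvg_cst.
  under eq_fun do rewrite mxE; rewrite mxE; apply: cvgN; exact: cvg_qmul.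
have c1 := cundo _ _ _ _ _ _ (ccol _ _ o0 hA) (cst (q1 R)) hA.
have r1 := crotor _ _ (qi R) (ccol _ _ o1 c1).
have n1 : cvg_vec F (fun t => rot1 (A t)) (rot1 A0).
  exact: cvg_normalize r1 (lt0r_neq0 d1).
have c2 := cundo _ _ _ _ _ _ n1 n1 c1.
have r2 := crotor _ _ (qj R) (ccol _ _ o2 c2).
have n2 : cvg_vec F (fun t => rot2 (A t)) (rot2 A0).
  exact: cvg_normalize r2 (lt0r_neq0 d2).
split.
- by apply: cvg_qmul; [exact: ccol | exact: cvg_qmul].
- by apply: cvg_qmul; [exact: cst | exact: cvg_qmul].
- have dr (f : T -> 'cV[R]_4) (x : 'cV[R]_4) : cvg_vec F f x -> 0 < dot x x ->
      \forall t \near F, 0 < dot (f t) (f t).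
    by move=> fx; apply: cvgr_gt; exact: cvg_dot.
  have p1 := dr _ _ r1 d1; have p2 := dr _ _ r2 d2.
  by apply: filterS2 p1 p2 => t.
Qed.

Lemma spin_section1 : spin_section_dom (1%:M : 'M[R]_4) /\ spin_section 1%:M = (q1 R, q1 R).
Proof.
have P1 : Pi4 (q1 R, q1 R) = 1%:M.
  by apply/matrixP; apply: forall_ord4; apply: forall_ord4;
    rewrite Pi4E /pi4_entry /= /q1 !quat_entries !mxE /=; ring.
have c0 : col o0 (1%:M : 'M[R]_4) = q1 R.
  by apply: quat_ext; rewrite !mxE.
have u1 : undo1 (1%:M : 'M[R]_4) = 1%:M by rewrite /undo1 c0 P1 trmx1 mulmx1.
have c1 : col o1 (1%:M : 'M[R]_4) = qi R by apply: quat_ext; rewrite !mxE.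
have c2 : col o2 (1%:M : 'M[R]_4) = qj R by apply: quat_ext; rewrite !mxE.
have S1 : dot (q1 R) (q1 R) = 1 by rewrite dotE /q1 !quat_entries; ring.
have two (u : 'cV[R]_4) : S3 u -> u o0 0 = 0 -> rotor u u = 2 *: q1 R.
  by move=> hu u0; rewrite /rotor qmul_imaginary // scaleN1r opprK scaler_nat mulr2n.
have d2 (u : 'cV[R]_4) : S3 u -> u o0 0 = 0 -> dot (rotor u u) (rotor u u) = 4.
  by move=> hu u0; rewrite two // dotZl dotZr S1; ring.
have rot_1 (u : 'cV[R]_4) : S3 u -> u o0 0 = 0 -> qrot u u = q1 R.
  move=> hu u0; rewrite /qrot /normalize d2 // two // scalerA.
  have -> : 4 = 2 ^+ 2 :> R by ring.
  by rewrite sqrtr_sqr ger0_norm // mulVf // scale1r.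
have Si : S3 (qi R) by rewrite /S3 /= dotE /qi !quat_entries; ring.
have Sj : S3 (qj R) by rewrite /S3 /= dotE /qj !quat_entries; ring.
have i0 : (qi R) o0 0 = 0 by rewrite /qi quat_entries.
have j0 : (qj R) o0 0 = 0 by rewrite /qj quat_entries.
have r1 : rot1 (1%:M : 'M[R]_4) = q1 R by rewrite /rot1 u1 c1 rot_1.
have u2 : undo2 (1%:M : 'M[R]_4) = 1%:M by rewrite /undo2 u1 r1 P1 trmx1 mulmx1.
have r2 : rot2 (1%:M : 'M[R]_4) = q1 R by rewrite /rot2 u2 c2 rot_1.
split; first by rewrite /spin_section_dom u1 u2 c1 c2 !d2.
by rewrite /spin_section r1 r2 c0 /spin_mul /= !qmul1l.
Qed.

Variable gamma : R -> 'cV[R]_4.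
Hypothesis lc : Defs.locally_convex gamma.
Local Notation F := (frenet gamma).

(** A Lebesgue number: the domain of the section is a neighbourhood of the identity, the value of
    the transported frame on the diagonal, and [0, 1] is compact. *)
Lemma frenet_uniform : exists2 d : R, 0 < d & forall s t, 0 <= s <= 1 -> 0 <= t <= 1 ->
  `|s - t| < d -> spin_section_dom ((F s)^T *m F t).
Proof.
pose P (d s : R) := forall t, 0 <= s <= 1 -> 0 <= t <= 1 -> `|s - t| < d ->
  spin_section_dom ((F s)^T *m F t).
have cI : compact [set t : R | 0 <= t <= 1].
  have -> : [set t : R | 0 <= t <= 1] = `[0, 1]%classic by apply/seteqP; split=> t; rewrite /= in_itv.
  exact: segment_compact.
have loc (x : R) : 0 <= x <= 1 -> \forall x' \near x & d \near (0 : R)^'+, P d x'.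
  move=> x01.
  have cF i j : F y i j @[y --> x] --> F x i j by exact: frenet_continuous.
  have cF1 i j : F p.1 i j @[p --> (x, x)] --> F x i j.
    exact: (cvg_comp fst (fun y => F y i j) cvg_fst (cF i j)).
  have cF2 i j : F p.2 i j @[p --> (x, x)] --> F x i j.
    exact: (cvg_comp snd (fun y => F y i j) cvg_snd (cF i j)).
  have [_ _ near_dom] : [/\ True, True & \forall p \near (x, x), spin_section_dom ((F p.1)^T *m F p.2)].
    have cA i j : ((F p.1)^T *m F p.2) i j @[p --> (x, x)] --> ((F x)^T *m F x) i j.
      exact: cvg_trmx_mul.
    have d0 : spin_section_dom ((F x)^T *m F x).
      by rewrite (frenet_orth lc x01); case: spin_section1.
    by have [_ _ ?] := cvg_spin_section cA d0.
  case: near_dom => -[Q1 Q2] /= [n1 /nbhs_ballP[e /= e0 be]] Q12.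
  have near1 : \forall x' \near x, Q1 x' /\ `|x - x'| < e / 2.
    by apply: filterI => //; apply/nbhs_ballP; exists (e / 2); rewrite /= ?divr_gt0.
  have near2 : \forall d \near (0 : R)^'+, d < e / 2 by apply: nbhs_right_lt; rewrite divr_gt0.
  exists ([set x' | Q1 x' /\ `|x - x'| < e / 2], [set d | d < e / 2]) => //.
  move=> [x' d] /= [[q1x xx'] de] t x'01 t01 x't; apply: (Q12 (x', t)); split=> //=.
  apply: be; rewrite /ball /=; have -> : x - t = (x - x') + (x' - t) by ring.
  by apply: (le_lt_trans (ler_normD _ _)); rewrite (splitr e) ltrD // (lt_trans x't).
have := (compact_near_coveringP _).1 cI R (0 : R)^'+ P _ loc.
move=> H; have {}H : \forall d \near (0 : R)^'+, [set t : R | 0 <= t <= 1] `<=` P d by exact: H.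
have g0 : \forall d \near (0 : R)^'+, 0 < d by exact: nbhs_right_gt.
have [d [d0 Hd]] : exists d : R, 0 < d /\ [set t : R | 0 <= t <= 1] `<=` P d.
  by apply: (@filter_ex _ _ (at_right_proper_filter 0)); apply: filterS2 g0 H.
by exists d => // s t s01 t01; exact: Hd.
Qed.

Hypothesis F0 : F 0 = 1%:M.

(** The frame is a telescoping product of increments over steps of length at most [n.+1%:R^-1 < d],
    each in the domain of the section; the lift is the product of their sections. *)
Lemma frenet_lift_exists : exists zt, is_frenet_lift gamma zt.
Proof.
have [d d0 Hd] := frenet_uniform.
have [n nd] : exists n : nat, n.+1%:R^-1 < d.
  by have [n nd] := ltr_add_invr d0; exists n; rewrite add0r in nd.
(* Time is stopped at k/(n+1). Each increment is then defined and continuous on all of [0, 1], and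
   it is the identity before its step begins, so nothing has to be glued. *)
pose c k t : R := Num.min t (k%:R / n.+1%:R).
pose G k t := (F (c k t))^T *m F (c k.+1 t).
pose zf := fix zf (k : nat) (t : R) {struct k} : quat_pair R :=
  if k is k'.+1 then spin_mul (zf k' t) (spin_section (G k' t)) else (q1 R, q1 R).
have n0 : 0 < n.+1%:R :> R by rewrite ltr0n.
have c01 k t : 0 <= t <= 1 -> 0 <= c k t <= 1.
  by move=> /andP[t0 t1]; rewrite /c le_min t0 ge_min t1 divr_ge0.
have cc k (t : R) : c k @ t --> c k t.
  rewrite /c; apply: (@continuous_min _ _ (fun x : R => x) (fun=> k%:R / n.+1%:R)).
    exact: cvg_id.
  exact: cvg_cst.
have domG k t : 0 <= t <= 1 -> spin_section_dom (G k t).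
  move=> t01; apply: Hd; [exact: c01 | exact: c01 |].
  apply: le_lt_trans nd; rewrite /c.
  have -> : k.+1%:R / n.+1%:R = k%:R / n.+1%:R + n.+1%:R^-1 :> R by rewrite -natr1 mulrDl mul1r.
  have gen (a b : R) : 0 <= b -> `|Num.min t a - Num.min t (a + b)| <= b.
    move=> b0; rewrite ler_norml !minEle.
    by apply/andP; case: (leP t a); case: (leP t (a + b)) => h1 h2; split; lra.
  by apply: gen; rewrite invr_ge0 ltW.
have SOG k t : 0 <= t <= 1 -> SO4 (G k t).
  move=> t01; have [oa da] := frenet_SO4 lc (c01 k _ t01); have [ob db] := frenet_SO4 lc (c01 k.+1 _ t01).
  split; last by rewrite det_mulmx det_tr da db mulr1.
  by rewrite trmx_mul trmxK mulmxA -(mulmxA _ (F (c k t))) (mulmx1C oa) mulmx1.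
have zP k t : 0 <= t <= 1 -> spin4 (zf k t) /\ Pi4 (zf k t) = F (c k t).
  move=> t01; elim: k => [|k [IH1 IH2]] /=.
    rewrite /c mul0r; have -> : Num.min t 0 = 0 by apply/min_idPr; case/andP: t01.
    rewrite F0 -spin_section1.2; apply: spin_sectionP; last exact: spin_section1.1.
    by split; rewrite ?trmx1 ?mulmx1 ?det1.
  have [s1 s2] := spin_sectionP (SOG k t t01) (domG k t t01); split; first exact: spin4M.
  rewrite Pi4M IH2 s2 /G mulmxA (mulmx1C (frenet_orth lc _)) ?mul1mx //; exact: c01.
exists (zf n.+1); split.
- apply: continuous_in_subspaceT => t; rewrite inE /= => t01.
  have cG k i j : G k x i j @[x --> t] --> G k t i j.
    have cFc l i' j' : F (c l x) i' j' @[x --> t] --> F (c l t) i' j'.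
      apply: (cvg_comp (c l) (fun y => F y i' j') (cc l t)).
      by apply: frenet_continuous => //; exact: c01.
    exact: cvg_trmx_mul.
  have czf k : cvg_vec (nbhs t) (fun x => (zf k x).1) (zf k t).1 /\ cvg_vec (nbhs t) (fun x => (zf k x).2) (zf k t).2.
    elim: k => [|k [IH1 IH2]]; first by split=> i; exact: cvg_cst.
    have [s1 s2 _] := cvg_spin_section (cG k) (domG k t t01).
    by split; exact: cvg_qmul.
  have [h1 h2] := czf n.+1.
  have cm (f : R -> 'cV[R]_4) : cvg_vec (nbhs t) f (f t) -> f x @[x --> t] --> f t.
    by move=> h; apply: cvg_mx => i j; rewrite (ord1 j); exact: h.
  suff : zf n.+1 x @[x --> t] --> zf n.+1 t by [].
  move: (zf n.+1) h1 h2 => f h1 h2.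
  rewrite (surjective_pairing (f t)); under eq_fun => x do rewrite (surjective_pairing (f x)).
  exact: cvg_pair (cm _ h1) (cm _ h2).
- elim: n.+1 => [//|k IH] /=; rewrite IH.
  have -> : G k 0 = 1%:M.
    rewrite /G /c; have m0 j : Num.min 0 (j%:R / n.+1%:R) = 0 :> R by apply/min_idPl; rewrite divr_ge0.
    by rewrite !m0 F0 trmx1 mulmx1.
  by rewrite spin_section1.2 /spin_mul /= !qmul1l.
- by move=> t /(zP n.+1)[].
- move=> t t01; have [_ ->] := zP n.+1 t t01; congr F; rewrite /c divff ?lt0r_neq0 //.
  by apply/min_idPl; case/andP: t01.
Qed.

End LiftExistence.

(** * Zeros of linear combinations of polynomials *)

Section ZeroCount.
Variable R : realType.
Implicit Types (g h p q : {poly R}) (x y z t : R).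

Definition wronsk h g : {poly R} := h * g^`() - h^`() * g.

(** Rolle's theorem for g/h, whose derivative is the Wronskian divided by h². *)
Lemma wronsk_root h g x y : x < y -> (forall t, x <= t <= y -> ~~ root h t) ->
  root g x -> root g y -> exists2 z, x < z < y & root (wronsk h g) z.
Proof.
move=> xy h0 /rootP gx /rootP gy.
have dq t : x <= t <= y -> is_derive t 1 (fun t => g.[t] / h.[t]) ((wronsk h g).[t] / h.[t] ^+ 2).
  move=> txy; have ht : h.[t] != 0 by exact: h0.
  have dg : is_derive t 1 (horner g) (g^`()).[t] by exact: is_derive_poly.
  have dh : is_derive t 1 (horner h) (h^`()).[t] by exact: is_derive_poly.
  have dV := is_deriveV ht dh.
  apply: is_derive_eq (is_deriveM dg dV) _.
  by rewrite /wronsk !hornerE /GRing.scale /=; field.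
have [] := @Rolle R (fun t => g.[t] / h.[t]) x y xy.
- by move=> t; rewrite in_itv /= => /andP[xt ty]; have [] := dq t _; rewrite ?(ltW xt) ?(ltW ty).
- apply: derivable_within_continuous => t; rewrite in_itv /= => txy.
  by have [] := dq t txy.
- by rewrite gx gy !mul0r.
move=> c; rewrite in_itv /= => cxy dc; exists c => //.
have cxy' : x <= c <= y by case/andP: cxy => a b; rewrite !ltW.
apply/rootP/eqP; have := dq c cxy'; have hc := h0 c cxy'.
move=> [_ e1]; case: dc => [_ e2]; move: e1; rewrite e2 => /esym/eqP.
by rewrite mulf_eq0 invr_eq0 sqrf_eq0 (negbTE (hc : h.[c] != 0)) orbF.
Qed.

Lemma mup_wronsk x h g : g != 0 -> wronsk h g != 0 -> (mup x g <= (mup x (wronsk h g)).+1)%N.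
Proof.
move=> g0 w0; case k: (mup x g) => [//|k']; rewrite ltnS mup_geq //.
have : ('X - x%:P) ^+ k'.+1 %| g by rewrite -mup_geq // k.
case/dvdpP => r ->; rewrite /wronsk derivM deriv_exp /= derivXsubC mul1r.
rewrite mulrDr dvdp_sub //; last by rewrite exprS !mulrA dvdp_mull.
rewrite dvdp_add //; first by rewrite exprS !mulrA dvdp_mull.
by rewrite !dvdp_mull // -mulr_natr dvdp_mulr.
Qed.

Definition unit_itv t := 0 < t < 1.

(** A bound through arbitrary finite lists, which presupposes no enumeration of the zeros; strict
    sorting makes the points distinct and ready for Rolle's theorem. *)
Definition zeros_le g m := forall s : seq R, sorted <%R s -> all unit_itv s ->
  (\sum_(x <- s) mup x g <= m)%N.

Lemma zeros_le0 g : (forall t, 0 < t < 1 -> ~~ root g t) -> zeros_le g 0.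
Proof.
move=> g0 s _ /allP s01; rewrite big_seq big1 // => x xs.
by apply: mupNroot; apply: g0; exact: s01.
Qed.

Lemma zeros_leW g m n : (m <= n)%N -> zeros_le g m -> zeros_le g n.
Proof. by move=> mn gm s ss s01; apply: leq_trans mn; exact: gm. Qed.

(** Passing to the Wronskian lowers each multiplicity by at most one and creates a zero in each gap,
    so one zero is lost in all. *)
Lemma zeros_le_wronsk h g m : g != 0 -> wronsk h g != 0 ->
  (forall t, 0 < t < 1 -> ~~ root h t) -> zeros_le (wronsk h g) m -> zeros_le g m.+1.
Proof.
have arith (A B a b c : nat) : (A <= B.+1)%N -> (a <= b.+1)%N -> (0 < c)%N ->
    (a + A <= (b + (c + B)).+1)%N by lia.
move=> g0 w0 h0 wm s0 ss0 s001.
(* Points that are not roots count for nothing and would interrupt the gaps. *)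
pose s := [seq x <- s0 | root g x].
have -> : (\sum_(x <- s0) mup x g = \sum_(x <- s) mup x g)%N.
  rewrite /s big_filter [RHS]big_mkcond /=; apply: eq_bigr => x _.
  by case: ifPn => // /mupNroot ->.
have : sorted <%R s by apply: sorted_filter ss0; exact: lt_trans.
have : all unit_itv s by apply/allP => x; rewrite mem_filter => /andP[_ /(allP s001)].
have : all (root g) s by exact: filter_all.
case: s => [|x s]; first by rewrite big_nil.
move=> gs s01 ps.
suff [s' [ps' s'01]] : exists s' : seq R, [/\ path <%R x s', all unit_itv (x :: s') &
    (\sum_(x <- x :: s) mup x g <= (\sum_(x <- x :: s') mup x (wronsk h g)).+1)%N].
  by move/leq_trans; apply; rewrite ltnS; apply: wm.
elim: s x gs s01 ps => [|y s IH] x /= /andP[gx gs] /andP[x01 s01].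
  by move=> _; exists [::]; rewrite /= x01 !big_seq1; split=> //; exact: mup_wronsk.
move=> /andP[xy ps]; have [s' [ps' s'01 le]] := IH y gs s01 ps.
have [] := @wronsk_root h g x y xy _ gx _.
- move=> t /andP[xt ty]; apply: h0; case/andP: x01 => x0 _; case/andP: s01 => /andP[_ y1] _.
  by rewrite (lt_le_trans x0 xt) (le_lt_trans ty y1).
- by case/andP: gs.
move=> z /andP[xz zy] wz; exists (z :: y :: s'); split; first by rewrite /= xz zy.
  apply/andP; split=> //; apply/andP; split; last exact: s'01.
  case/andP: x01 => x0 _; case/andP: s01 => /andP[_ y1] _.
  by rewrite /unit_itv (lt_trans x0 xz) (lt_trans zy y1).
rewrite big_cons [in leqRHS]big_cons [in leqRHS]big_cons.
have z1 : (0 < mup z (wronsk h g))%N by rewrite -XsubC_dvd // -root_factor_theorem.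
have x1 := mup_wronsk x g0 w0.
exact: arith le x1 z1.
Qed.

(** Converts multiplicity as divisibility into the vanishing of derivatives that [has_multiplicity]
    speaks of. *)
Lemma mup_derivn x g : g != 0 ->
  (forall j, (j < mup x g)%N -> (g^`(j)).[x] = 0) /\ (g^`(mup x g)).[x] != 0.
Proof.
move=> g0; have := mup_leq x (mup x g) g0; rewrite leqnn => /esym ndiv.
have /dvdpP[r gE] : ('X - x%:P) ^+ mup x g %| g by rewrite -mup_geq.
have r0 : ~~ root r x.
  apply: contra ndiv; rewrite -dvdp_XsubCl => /dvdpP[q rE].
  by rewrite [X in _ %| X]gE rE exprS -mulrA dvdp_mull.
suff gen : forall k (r g : {poly R}), g = r * ('X - x%:P) ^+ k -> ~~ root r x ->
    (forall j, (j < k)%N -> (g^`(j)).[x] = 0) /\ (g^`(k)).[x] != 0 by exact: gen gE r0.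
elim=> [|k IH] {}r {g g0 ndiv gE r0} g gE r0; first by rewrite gE mulr1.
pose r' : {poly R} := r *+ k.+1 + ('X - x%:P) * r^`().
have dE : g^`() = r' * ('X - x%:P) ^+ k.
  rewrite gE derivM deriv_exp derivXsubC mul1r /r' /= exprS.
  by rewrite -[_ ^+ k *+ _]mulr_natr -[r *+ _]mulr_natr; ring.
have r'0 : ~~ root r' x.
  rewrite rootE /r' !hornerE /= subrr mul0r addr0 hornerMn mulrn_eq0 /=; exact: r0.
have [h1 h2] := IH r' _ dE r'0; split=> [[_|j]|].
- by rewrite gE !hornerE /= subrr expr0n mulr0.
- by rewrite ltnS => /h1; rewrite -derivSn.
- by rewrite derivSn.
Qed.

End ZeroCount.

(** * Wronskians and Chebyshev systems *)

Section Chebyshev.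
Variable R : realType.
Implicit Types (f g h k : {poly R}) (t : R).

Definition wronsk3 f g h : {poly R} :=
  f * (g^`() * h^`(2) - g^`(2) * h^`()) - f^`() * (g * h^`(2) - g^`(2) * h)
  + f^`(2) * (g * h^`() - g^`() * h).

Definition wronsk4 f g h k : {poly R} :=
  f * wronsk3 g^`() h^`() k^`() - g * wronsk3 f^`() h^`() k^`()
  + h * wronsk3 f^`() g^`() k^`() - k * wronsk3 f^`() g^`() h^`().

(** With [wronsk_wronsk3], an instance of W(W(F,g), W(F,h)) = W(F) W(F,g,h) for a family F: a
    Wronskian of Wronskians is again one, up to a factor without zeros. This lets Rolle's theorem be
    iterated. *)
Lemma wronsk_wronsk f g h : wronsk (wronsk f g) (wronsk f h) = f * wronsk3 f g h.
Proof. by rewrite /wronsk /wronsk3 !derivB !derivM !derivSn !derivn0; ring. Qed.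

Lemma wronsk_wronsk3 f g h k :
  wronsk (wronsk3 f g h) (wronsk3 f g k) = wronsk f g * wronsk4 f g h k.
Proof.
rewrite /wronsk /wronsk4 /wronsk3 !(derivB, derivD, derivM) !derivSn !derivn0; ring.
Qed.

Definition no_zero f := forall t, 0 < t < 1 -> ~~ root f t.

Lemma no_zero_neq0 f : no_zero f -> f != 0.
Proof.
move=> nf; have half : 0 < (2^-1 : R) < 1 by apply/andP; split; lra.
by apply: contraTneq (nf _ half) => ->; rewrite root0.
Qed.

Lemma zeros_le_step h f k g m : wronsk h f = k * g -> no_zero h -> no_zero k ->
  g != 0 /\ zeros_le g m -> f != 0 /\ zeros_le f m.+1.
Proof.
move=> e nh nk [g0 gm]; have kg0 : k * g != 0 by rewrite mulf_neq0 // no_zero_neq0.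
have f0 : f != 0.
  by apply: contraNneq kg0 => f0; rewrite -e f0 /wronsk deriv0 !mulr0 subr0.
split=> //; apply: (@zeros_le_wronsk _ h); rewrite ?e // => s ss s01.
rewrite (eq_big_seq (fun x => mup x g)); first exact: gm.
by move=> x xs; rewrite mupMr //; apply: nk; exact: (allP s01).
Qed.

Variables p0 p1 p2 p3 : {poly R}.
Hypotheses (w1 : no_zero p3) (w2 : no_zero (wronsk p3 p2)) (w3 : no_zero (wronsk3 p3 p2 p1))
  (w4 : no_zero (wronsk4 p3 p2 p1 p0)).

Lemma chebyshev_zeros (a b c d : R) : [|| a != 0, b != 0, c != 0 | d != 0] ->
  let g := a *: p0 + b *: p1 + c *: p2 + d *: p3 in g != 0 /\ zeros_le g 3.
Proof.
move=> nz g.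
have nz0 e f : e != 0 -> no_zero f -> (e *: f != 0) /\ zeros_le (e *: f) 0.
  move=> e0 nf; split; first by rewrite scaler_eq0 negb_or e0 no_zero_neq0.
  by apply: zeros_le0 => t t01; rewrite rootZ // nf.
have weak f m n : (m <= n)%N -> f != 0 /\ zeros_le f m -> f != 0 /\ zeros_le f n.
  by move=> mn [f0 fm]; split=> //; exact: zeros_leW fm.
have one : no_zero 1 by move=> t _; rewrite root1.
have s1 m : wronsk p3 g != 0 /\ zeros_le (wronsk p3 g) m -> g != 0 /\ zeros_le g m.+1.
  by apply: (@zeros_le_step p3 g 1) => //; rewrite mul1r.
have s2 m : wronsk3 p3 p2 g != 0 /\ zeros_le (wronsk3 p3 p2 g) m ->
    wronsk p3 g != 0 /\ zeros_le (wronsk p3 g) m.+1.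
  by apply: (zeros_le_step (wronsk_wronsk _ _ _)).
have s3 m : wronsk4 p3 p2 p1 g != 0 /\ zeros_le (wronsk4 p3 p2 p1 g) m ->
    wronsk3 p3 p2 g != 0 /\ zeros_le (wronsk3 p3 p2 g) m.+1.
  by apply: (zeros_le_step (wronsk_wronsk3 _ _ _ _)).
(* The first nonzero coefficient decides after how many Wronskians [g] reduces to a nonzero multiple
   of a function without zeros: three if [a] is nonzero, fewer otherwise. *)
have [a0|a0] := eqVneq a 0; last first.
  apply: s1; apply: s2; apply: s3.
  have -> : wronsk4 p3 p2 p1 g = a *: wronsk4 p3 p2 p1 p0; last exact: nz0.
  by rewrite /g /wronsk4 /wronsk3 !(derivD, derivZ, derivSn, derivn0) -!mul_polyC; ring.
have [b0|b0] := eqVneq b 0; last first.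
  apply: (weak _ 2 3)%N => //; apply: s1; apply: s2.
  have -> : wronsk3 p3 p2 g = b *: wronsk3 p3 p2 p1; last exact: nz0.
  rewrite /g a0 scale0r add0r.
  by rewrite /wronsk3 !(derivD, derivZ, derivSn, derivn0) -!mul_polyC; ring.
have [c0|c0] := eqVneq c 0; last first.
  apply: (weak _ 1 3)%N => //; apply: s1.
  have -> : wronsk p3 g = c *: wronsk p3 p2; last exact: nz0.
  rewrite /g a0 b0 !scale0r !add0r.
  by rewrite /wronsk !(derivD, derivZ, derivSn, derivn0) -!mul_polyC; ring.
apply: (weak _ 0 3)%N => //; rewrite /g a0 b0 c0 !scale0r !add0r; apply: nz0 => //.
by move: nz; rewrite a0 b0 c0 !eqxx.
Qed.

End Chebyshev.

(** * Polynomial curves *)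

(** Missing roots are added one at a time. Each counts at least once, so the process stops after at
    most [m] additions. *)
Lemma zeros_list (R : realType) (g : {poly R}) m : g != 0 -> zeros_le g m ->
  exists s : seq R, [/\ uniq s, (forall t, t \in s <-> 0 < t < 1 /\ root g t) &
    (\sum_(t <- s) mup t g <= m)%N].
Proof.
move=> g0 gm; have bound (s : seq R) : uniq s -> all (@unit_itv R) s -> (\sum_(t <- s) mup t g <= m)%N.
  move=> us s01; have := @perm_sort _ <=%R s => /permPl ps.
  rewrite -(perm_big _ ps) gm ?sort_lt_sorted //.
  by rewrite (perm_all _ ps).
have size_bound (s : seq R) : uniq s -> all (fun t => unit_itv t && root g t) s -> (size s <= m)%N.
  move=> us /allP sg; apply: leq_trans (bound s us _); last by apply/allP => t /sg/andP[].
  rewrite -sum1_size !big_seq; apply: leq_sum => t /sg/andP[_ gt].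
  by rewrite -XsubC_dvd // dvdp_XsubCl.
suff ext : forall k (s : seq R), (m - size s <= k)%N -> uniq s ->
    all (fun t => unit_itv t && root g t) s ->
    exists s : seq R, [/\ uniq s, (forall t, t \in s <-> 0 < t < 1 /\ root g t) &
      (\sum_(t <- s) mup t g <= m)%N].
  exact: (ext m [::] (leq_subr _ _)).
elim=> [|k IH] s sk us sg.
all: have [full|/existsNP[t /not_implyP[[t01 gt] /negP ts]]] :=
  pselect (forall t, 0 < t < 1 /\ root g t -> t \in s).
all: try by exists s; split=> // [t|]; [split; [move=> /(allP sg)/andP|exact: full]
  |apply: bound => //; apply/allP => t /(allP sg)/andP[]].
all: have us' : uniq (t :: s) by rewrite /= ts us.
all: have sg' : all (fun t => unit_itv t && root g t) (t :: s) by rewrite /= sg gt /unit_itv t01.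
- by have := size_bound _ us' sg'; rewrite /= ltnNge -subn_eq0 -leqn0 sk.
- by apply: (IH (t :: s)) => //=; move: sk; clear; lia.
Qed.

Section Curve.
Variable R : realType.
Variable p : 'I_4 -> {poly R}.
Implicit Types (t : R) (q : {poly R}) (i j : 'I_4).

Let N : {poly R} := \sum_i p i ^+ 2.
Hypothesis N_gt0 : forall t, 0 < N.[t].

Let s t : R := (Num.sqrt N.[t])^-1.

Let s_gt0 t : 0 < s t. Proof. by rewrite invr_gt0 sqrtr_gt0. Qed.

Let s_sqr t : s t ^+ 2 * N.[t] = 1.
Proof. by rewrite /s exprVn sqr_sqrtr ?ltW // mulVf // gt_eqF. Qed.

Let is_derive_s t : is_derive t 1 s (- 2^-1 * (N^`()).[t] * s t ^+ 3).
Proof.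
have dN : is_derive t 1 (horner N) (N^`()).[t] by exact: is_derive_poly.
have dr := is_derive1_comp (is_derive1_sqrt (N_gt0 t)) dN.
have r0 : Num.sqrt N.[t] != 0 by rewrite gt_eqF // sqrtr_gt0.
apply: is_derive_eq (is_deriveV (f := Num.sqrt \o horner N) r0 dr) _.
by rewrite /s /GRing.scale /=; field.
Qed.

(* The derivatives of [q / sqrt N] have the form [q' / (sqrt N) ^ (2 n + 1)]. *)
Fixpoint curve_num n q : {poly R} :=
  if n is n'.+1 then (curve_num n' q)^`() * N - (n'.*2.+1%:R / 2) *: (curve_num n' q * N^`()) else q.

Let is_derive_poly_s q m t : is_derive t 1 (fun t => q.[t] * s t ^+ m.+1)
  ((q^`() * N - (m.+1%:R / 2) *: (q * N^`())).[t] * s t ^+ m.+3).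
Proof.
have -> : (fun t => q.[t] * s t ^+ m.+1) = horner q * s ^+ m.+1.
  by apply/funext => x; rewrite exprfctE.
apply: is_derive_eq (is_deriveM (is_derive_poly q t) (is_deriveX m.+1 (is_derive_s t))) _.
rewrite exprfctE.
rewrite -[LHS]/(q.[t] * (m.+1%:R * s t ^+ m * (- 2^-1 * (N^`()).[t] * s t ^+ 3)) + s t ^+ m.+1 * (q^`()).[t]).
rewrite hornerD hornerN hornerZ !hornerM (exprS _ m.+2) (exprS _ m.+1) (exprS _ m).
transitivity (s t ^+ m * s t * ((q^`()).[t] * (s t ^+ 2 * N.[t]) -
  m.+1%:R / 2 * (q.[t] * (N^`()).[t]) * s t ^+ 2)); last by ring.
by rewrite s_sqr; set c : R := m.+1%:R; field.
Qed.

Let curve_num_derive n q t : is_derive t 1 (fun t => (curve_num n q).[t] * s t ^+ n.*2.+1)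
  ((curve_num n.+1 q).[t] * s t ^+ n.+1.*2.+1).
Proof. exact: is_derive_poly_s. Qed.

Lemma derive1n_curve n q : derive1n n (fun t => q.[t] * s t) =
  fun t => (curve_num n q).[t] * s t ^+ n.*2.+1.
Proof.
elim: n => [//|n IH]; rewrite derive1nS IH; apply/funext => t.
by rewrite derive1E; have [_ ->] := curve_num_derive n q t.
Qed.

Definition curve t : 'cV[R]_4 := \col_i ((p i).[t] * s t).

Let curve_coord i : (fun t => curve t i 0) = fun t => (p i).[t] * s t.
Proof. by apply/funext => t; rewrite mxE. Qed.

Lemma smooth_curve : smooth curve.
Proof.
apply: smooth_of_coord => i n t; rewrite curve_coord derive1n_curve.
by have [] := curve_num_derive n (p i) t.
Qed.

(** Coefficients of the [n]-th numerator on the derivatives of [q]. They do not depend on [q], so a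
    single triangular matrix relates the jets of all coordinates before and after normalization;
    frames and contacts with hyperplanes can be read on the polynomials. *)
Fixpoint curve_coef n k : {poly R} :=
  if n is n'.+1 then
    (if k is k'.+1 then curve_coef n' k' * N else 0) +
    ((curve_coef n' k)^`() * N - (n'.*2.+1%:R / 2) *: (curve_coef n' k * N^`()))
  else (k == 0%N)%:R.

Lemma curve_coef_small n k : (n < k)%N -> curve_coef n k = 0.
Proof.
elim: n k => [|n IH] [|k] //=; rewrite ltnS => nk.
by rewrite !IH ?mul0r ?deriv0 ?mul0r ?scaler0 ?subr0 ?addr0 // ltnW.
Qed.

Lemma curve_coef_diag n : curve_coef n n = N ^+ n.
Proof.
elim: n => [//|n IH] /=; rewrite IH (curve_coef_small (ltnSn n)) deriv0 !mul0r scaler0 subr0 addr0.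
by rewrite exprSr.
Qed.

Lemma curve_numE n m q : (n < m)%N ->
  curve_num n q = \sum_(k < m) q^`(k) * curve_coef n k.
Proof.
elim: n m => [|n IH] [|m] //= nm.
  rewrite big_ord_recl /= mulr1 big1 ?addr0 // => k _; exact: mulr0.
pose e : R := n.*2.+1%:R / 2.
under [RHS]eq_bigr do rewrite mulrDr.
rewrite big_split /= [X in _ = X + _]big_ord_recl /= mulr0 add0r.
have nm' : (n < m)%N by [].
rewrite -/e (IH _ (leqW nm')) raddf_sum !mulr_suml scaler_sumr -sumrB /=.
rewrite [X in _ = X + _](_ : _ = \sum_(k < m.+1) (q^`(k))^`() * (curve_coef n k * N)); last first.
  by rewrite big_ord_recr /= (curve_coef_small nm') mul0r mulr0 addr0.
rewrite -big_split /=; apply: eq_bigr => k _.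
by rewrite derivM -!mul_polyC; ring.
Qed.

Definition curve_upper t : 'M[R]_4 :=
  \matrix_(k, j) ((curve_coef j k).[t] * s t ^+ (j.*2.+1)).

Lemma Up4plus_curve_upper t : Up4plus (curve_upper t).
Proof.
split=> [i j ji|i]; rewrite mxE; first by rewrite curve_coef_small // horner0 mul0r.
by rewrite curve_coef_diag horner_exp mulr_gt0 // exprn_gt0.
Qed.

Definition poly_jet t : 'M[R]_4 := \matrix_(i, j) ((p i)^`(j)).[t].

Lemma jet_curve t : jet_mx curve t = poly_jet t *m curve_upper t.
Proof.
apply/matrixP => i j; rewrite jet_mxE; last exact: smooth_curve.
rewrite curve_coord derive1n_curve (curve_numE _ (ltn_ord j)) horner_sum mulr_suml mxE.
by apply: eq_bigr => k _; rewrite !mxE hornerM mulrA.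
Qed.

Lemma curve_S3 t : S3 (curve t).
Proof.
rewrite /S3 /= dotE -(s_sqr t) /N horner_sum sum_ord4 !mxE !horner_exp; ring.
Qed.

Lemma det_jet_curve t : 0 < \det (poly_jet t) -> 0 < \det (jet_mx curve t).
Proof.
by move=> d; rewrite jet_curve det_mulmx mulr_gt0 // Up4plus_det_gt0 //; exact: Up4plus_curve_upper.
Qed.

Lemma frenet_curve t Q V : Q^T *m Q = 1%:M -> Up4plus V -> poly_jet t = Q *m V ->
  frenet curve t = Q.
Proof.
move=> oQ uV e; rewrite /frenet; apply: (@gram_schmidt_factor _ _ _ (V *m curve_upper t)) => //.
  by apply: Up4plusM => //; exact: Up4plus_curve_upper.
by rewrite jet_curve e mulmxA.
Qed.

Lemma convex_arc_curve : no_zero (p o3) -> no_zero (wronsk (p o3) (p o2)) ->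
  no_zero (wronsk3 (p o3) (p o2) (p o1)) -> no_zero (wronsk4 (p o3) (p o2) (p o1) (p o0)) ->
  convex_arc curve 0 1.
Proof.
move=> h1 h2 h3 h4 H /hyperplane_lform[n n0 nH].
have nz : [|| n 0 o0 != 0, n 0 o1 != 0, n 0 o2 != 0 | n 0 o3 != 0].
  apply: contraNT n0; rewrite !negb_or !negbK => /and4P[/eqP a /eqP b /eqP c /eqP d].
  by apply/eqP/matrixP => i j; rewrite (ord1 i) [RHS]mxE; move: j; apply: forall_ord4.
pose g : {poly R} := n 0 o0 *: p o0 + n 0 o1 *: p o1 + n 0 o2 *: p o2 + n 0 o3 *: p o3.
have [g0 gz] : g != 0 /\ zeros_le g 3 := chebyshev_zeros h1 h2 h3 h4 nz.
have [l [ul lE lm]] := zeros_list g0 gz.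
(* When the lower derivatives of [g] vanish, only the diagonal coefficient of the triangular factor
   contributes, and it is positive. *)
have jH t (j : 'I_4) : (forall k : 'I_4, (k < j)%N -> (g^`(k)).[t] = 0) ->
    (derive1n j curve t \in H) = ((g^`(j)).[t] == 0).
  move=> lo; have [ul_low ul_pos] := Up4plus_curve_upper t.
  have -> : (derive1n j curve t \in H) = ((n *m jet_mx curve t) 0 j == 0).
    rewrite nH; have -> : n *m derive1n j curve t = col j (n *m jet_mx curve t).
      rewrite colE -mulmxA -colE; congr (_ *m _); apply/matrixP => i k.
      by rewrite !mxE (ord1 k).
    apply/eqP/eqP => [/matrixP/(_ 0 0)|h]; first by rewrite !mxE.
    by apply/matrixP => i k; rewrite (ord1 i) (ord1 k) mxE h mxE.
  have gE k : (n *m poly_jet t) 0 k = (g^`(k)).[t].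
    by rewrite /g mxE sum_ord4 !derivnD !derivnZ !hornerD !hornerZ !mxE.
  rewrite jet_curve mulmxA mxE (bigD1 j) //= big1 => [|k kj].
    by rewrite addr0 gE mulf_eq0 (gt_eqF (ul_pos j)) orbF.
  rewrite gE; have [kj'|jk] := ltnP k j; first by rewrite lo // mul0r.
  by rewrite ul_low ?mulr0 // ltn_neqAle eq_sym val_eqE kj.
exists l, (fun t => mup t g); split=> //.
- by move=> t; rewrite lE; have -> : (curve t \in H) = root g t := jH t o0 (fun k => ltac:(by [])).
- move=> t tl; have m3 : (mup t g <= 3)%N.
    by apply: leq_trans lm; rewrite (big_rem t) //= leq_addr.
  have m1 : (0 < mup t g)%N.
    by have [_ gt] := (lE t).1 tl; rewrite -XsubC_dvd // dvdp_XsubCl.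
  have [lo hi] := mup_derivn t g0.
  have jH' (j : nat) : (j <= mup t g)%N -> (derive1n j curve t \in H) = ((g^`(j)).[t] == 0).
    move=> jm; have j4 : (j < 4)%N by rewrite ltnS (leq_trans jm).
    apply: (jH t (Ordinal j4)) => k kj; apply: lo; exact: leq_trans kj jm.
  by split=> // [j jm|]; rewrite jH' ?(ltnW jm) ?leqnn // lo.
Qed.

End Curve.

(** * Polynomials as lists of coefficients *)

Section ListPolynomials.
Variable K : comNzRingType.
Implicit Types (l : seq K).

Fixpoint ladd l l' : seq K :=
  match l, l' with
  | [::], _ => l'
  | _, [::] => l
  | a :: r, b :: r' => (a + b) :: ladd r r'
  end.

Definition lscale a l : seq K := [seq a * b | b <- l].

Definition lsub l l' : seq K := ladd l (lscale (-1) l').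

Fixpoint lmul l l' : seq K :=
  if l is a :: r then ladd (lscale a l') (0 :: lmul r l') else [::].

Fixpoint lder l : seq K := if l is _ :: r then ladd r (0 :: lder r) else [::].

Definition leval l (a : K) : K := foldr (fun b acc => acc * a + b) 0 l.

(* [\sum_k l_k X ^ k b ^ (M - k)] *)
Fixpoint lhom (b : seq K) M l : seq K :=
  if l is a :: r then ladd (lscale a (iter M (lmul b) [:: 1])) (0 :: lhom b M.-1 r) else [::].

Definition lwronsk f g : seq K := lsub (lmul f (lder g)) (lmul (lder f) g).

Definition lwronsk3 f g h : seq K :=
  let f1 := lder f in let g1 := lder g in let h1 := lder h in
  let f2 := lder f1 in let g2 := lder g1 in let h2 := lder h1 in
  ladd (lsub (lmul f (lsub (lmul g1 h2) (lmul g2 h1))) (lmul f1 (lsub (lmul g h2) (lmul g2 h))))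
    (lmul f2 (lsub (lmul g h1) (lmul g1 h))).

Definition lwronsk4 f g h k : seq K :=
  let f1 := lder f in let g1 := lder g in let h1 := lder h in let k1 := lder k in
  lsub (ladd (lsub (lmul f (lwronsk3 g1 h1 k1)) (lmul g (lwronsk3 f1 h1 k1)))
    (lmul h (lwronsk3 f1 g1 k1))) (lmul k (lwronsk3 f1 g1 h1)).

Variables (R : comNzRingType) (m : {rmorphism K -> R}).

Definition lpoly l : {poly R} := foldr (fun a q => q * 'X + (m a)%:P) 0 l.

Lemma lpolyD l l' : lpoly (ladd l l') = lpoly l + lpoly l'.
Proof.
elim: l l' => [|a l IH] [|b l'] //=; rewrite ?add0r ?addr0 //.
by rewrite IH rmorphD polyCD; ring.
Qed.

Lemma lpolyZ a l : lpoly (lscale a l) = (m a)%:P * lpoly l.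
Proof. by elim: l => [|b l IH] /=; rewrite ?mulr0 // IH rmorphM polyCM; ring. Qed.

Lemma lpolyB l l' : lpoly (lsub l l') = lpoly l - lpoly l'.
Proof. by rewrite lpolyD lpolyZ rmorphN1 polyCN mulN1r. Qed.

Lemma lpolyM l l' : lpoly (lmul l l') = lpoly l * lpoly l'.
Proof.
elim: l => [|a l IH] /=; first by rewrite mul0r.
by rewrite lpolyD lpolyZ /= IH rmorph0 polyC0; ring.
Qed.

Lemma lpoly_deriv l : lpoly (lder l) = (lpoly l)^`().
Proof.
elim: l => [|a l IH] /=; first by rewrite deriv0.
by rewrite lpolyD /= IH derivMXaddC rmorph0 polyC0 addr0.
Qed.

Lemma lpoly_derivn n l : lpoly (iter n lder l) = (lpoly l)^`(n).
Proof. by elim: n => //= n IH; rewrite lpoly_deriv IH -derivnS. Qed.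

Lemma lpoly_eval l a : (lpoly l).[m a] = m (leval l a).
Proof.
elim: l => [|b l IH] /=; first by rewrite horner0 rmorph0.
by rewrite hornerMXaddC IH rmorphD rmorphM.
Qed.

Lemma lpoly_1subX (t : R) : (lpoly [:: 1; -1]).[t] = 1 - t.
Proof.
by rewrite /= rmorphN !rmorph1 mul0r add0r hornerD hornerM !hornerC hornerX mulN1r addrC.
Qed.

Lemma lpoly_X3 (t : R) : (lpoly [:: 0; 0; 0; 1]).[t] = t ^+ 3.
Proof.
by rewrite /= !rmorph1 !rmorph0 mul0r add0r !(hornerD, hornerM, hornerC, hornerX); ring.
Qed.

End ListPolynomials.

Section ListWronskians.
Variables (K : comNzRingType) (R : realType) (m : {rmorphism K -> R}).
Implicit Types (f g h k : seq K).

Lemma lpoly_wronsk f g : lpoly m (lwronsk f g) = wronsk (lpoly m f) (lpoly m g).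
Proof. by rewrite lpolyB !lpolyM !lpoly_deriv. Qed.

Lemma lpoly_wronsk3 f g h :
  lpoly m (lwronsk3 f g h) = wronsk3 (lpoly m f) (lpoly m g) (lpoly m h).
Proof. by rewrite lpolyD lpolyB !lpolyM !lpolyB !lpolyM !lpoly_deriv. Qed.

Lemma lpoly_wronsk4 f g h k :
  lpoly m (lwronsk4 f g h k) = wronsk4 (lpoly m f) (lpoly m g) (lpoly m h) (lpoly m k).
Proof. by rewrite lpolyB lpolyD lpolyB !lpolyM !lpoly_wronsk3 !lpoly_deriv. Qed.

End ListWronskians.

Local Notation Z := BinNums.Z.

(** * Certificates of positivity on the unit interval *)

Section Positivity.
Variable R : realType.
Variable m : {rmorphism Z -> R}.
Hypothesis m_gt0 : forall z : Z, 0 < z -> 0 < m z.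

Let m_ge0 (z : Z) : 0 <= z -> 0 <= m z.
Proof. by rewrite le_eqVlt => /predU1P[<-|/m_gt0/ltW//]; rewrite rmorph0. Qed.

Definition lpos (l : seq Z) : bool := all (fun a => 0 <= a) l && has (fun a => 0 < a) l.

Lemma lpos_gt0 l (x : R) : lpos l -> 0 < x -> 0 < (lpoly m l).[x].
Proof.
case/andP=> + + x0.
have nn (k : seq Z) : all (fun a => 0 <= a) k -> 0 <= (lpoly m k).[x].
  elim: k => [|a k IH] /=; first by rewrite horner0.
  move=> /andP[a0 k0]; rewrite hornerMXaddC addr_ge0 ?m_ge0 // mulr_ge0 ?IH // ltW //.
elim: l => [//|a l IH] /= /andP[a0 l0] /orP[a1|l1]; rewrite hornerMXaddC.
  by rewrite ltr_wpDl ?m_gt0 // mulr_ge0 ?nn // ltW.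
by rewrite ltr_wpDr ?m_ge0 // mulr_gt0 // IH.
Qed.

Lemma lhom_eval b M l x t : x = t * (lpoly m b).[x] -> (size l <= M.+1)%N ->
  (lpoly m (lhom b M l)).[x] = (lpoly m b).[x] ^+ M * (lpoly m l).[t].
Proof.
move=> xt; have pow k : (lpoly m (iter k (lmul b) [:: 1])).[x] = (lpoly m b).[x] ^+ k.
  elim: k => [|k IH]; last by rewrite iterS lpolyM hornerM IH exprS.
  by rewrite /= mul0r add0r rmorph1 hornerC.
elim: l M => [|a l IH] M /=; first by rewrite !horner0 mulr0.
case: M => [|M].
  case: l {IH} => [_|//]; rewrite lpolyD lpolyZ /= !mul0r !add0r rmorph0 rmorph1 hornerD hornerM !hornerC.
  by rewrite expr0; ring.
move=> szl; rewrite lpolyD lpolyZ hornerD hornerM hornerC pow /= rmorph0 addr0 hornerMX IH //.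
by rewrite hornerMXaddC exprS; set B := (lpoly m b).[x] in xt *; rewrite [in LHS]xt; ring.
Qed.

(** With b = 1 + X, [lhom] computes (1+x)^M l(x/(1+x)), and x = t/(1-t) runs over the positive
    numbers as t runs over ]0, 1[. *)
Definition unit_pos (l : seq Z) : bool := lpos (lhom [:: 1; 1] (size l).-1 l).

Lemma unit_pos_gt0 l (t : R) : unit_pos l -> 0 < t < 1 -> 0 < (lpoly m l).[t].
Proof.
move=> pl /andP[t0 t1]; have u0 : 0 < 1 - t by rewrite subr_gt0.
have x0 : 0 < t / (1 - t) by rewrite divr_gt0.
have b1 : (lpoly m [:: 1; 1]).[t / (1 - t)] = (1 - t)^-1.
  rewrite /= mul0r add0r rmorph1 hornerD hornerM !hornerC hornerX.
  by field; rewrite gt_eqF.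
have := lpos_gt0 pl x0; rewrite (@lhom_eval _ _ _ _ t) ?b1 ?leqSpred //.
by rewrite pmulr_rgt0 // exprn_gt0 // invr_gt0.
Qed.

End Positivity.

(** * Curves reaching the listed matrices *)

Section Realization.

(* Entry [(D, F)] stands for the curve with homogeneous coordinates
   [sum_k F_ik t ^ k (1 - t) ^ (D - k)] for [i < 3] and [t ^ 3 (1 - t) ^ a] for
   [i = 3], where [a] is dictated by the permutation.  They were found by a
   computer search. *)
Definition curves : seq (nat * seq (seq int)) :=
[:: (6%N, [:: [:: 1; 0; 0; 0; 0; 0; -1]; [:: 0; 1; 0; 0; 0; 1]; [:: 0; 0; 1; 0; -1]]);
  (6%N, [:: [:: 1; 0; 0; 0; 0; 1]; [:: 0; 1; 0; 0; 0; 0; 1]; [:: 0; 0; 1; 0; -1]]);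
  (6%N, [:: [:: 1; 0; 0; 0; 0; 0; -1]; [:: 0; 1; 0; 0; -1]; [:: 0; 0; 1; 0; 0; -1]]);
  (5%N, [:: [:: 1; 0; 0; 0; 0; -1]; [:: 0; 1; 0; 0; 1]; [:: 0; 0; 1]]);
  (5%N, [:: [:: 1; 0; 0; 0; 0; -1]; [:: 0; 1; 1]; [:: 0; 0; 1; 0; -1]]);
  (5%N, [:: [:: 1; 0; 0; 0; 0; -1]; [:: 0; 1; 0; -1]; [:: 0; 0; 1]]);
  (6%N, [:: [:: 1; 1; 0; 0; -1]; [:: 0; 1; 0; 0; -1; 0; 1]; [:: 0; 0; 1; 0; 0; -1]]);
  (6%N, [:: [:: 1; 0; 0; 0; 0; 1]; [:: 0; 1; 1; 0; -1]; [:: 0; 0; 1; 0; -1; 0; -1]]);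
  (5%N, [:: [:: 1; 0; 0; 0; 1]; [:: 0; 1; 0; 0; 0; 1]; [:: 0; 0; 1]]);
  (6%N, [:: [:: 1; 0; 0; 0; -1]; [:: 0; 1; 0; 0; 0; -1]; [:: 0; 0; 1; 0; 0; 0; -1]]);
  (4%N, [:: [:: 1; 0; 0; 0; -1]; [:: 0; 1]; [:: 0; 0; 1]]);
  (5%N, [:: [:: 1; 0; 1]; [:: 0; 1; 0; 0; 0; 1]; [:: 0; 0; 1; 0; -1]]);
  (5%N, [:: [:: 1; 0; 0; 0; 1]; [:: 0; 1; 0; -1]; [:: 0; 0; 1]]);
  (5%N, [:: [:: 1; 0; 0; -1]; [:: 0; 1; 0; 0; 0; 1]; [:: 0; 0; 1]]);
  (5%N, [:: [:: 1; 0; 0; 0; 1]; [:: 0; 1; 1]; [:: 0; 0; 1; 0; 0; -1]]);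
  (5%N, [:: [:: 1; 1; 1]; [:: 0; 1; 1; 0; -1]; [:: 0; 0; 1; 0; 0; -1]]);
  (4%N, [:: [:: 1; 1]; [:: 0; 1; 0; 0; 1]; [:: 0; 0; 1]]);
  (4%N, [:: [:: 1; 0; -1]; [:: 0; 1]; [:: 0; 0; 1; 0; -1]]);
  (5%N, [:: [:: 1; 0; 0; -1]; [:: 0; 1; 0; -1; -1]; [:: 0; 0; 1]]);
  (4%N, [:: [:: 1; 0; 0; 1]; [:: 0; 1]; [:: 0; 0; 1]]);
  (4%N, [:: [:: 1; 1]; [:: 0; 1; 0; -1]; [:: 0; 0; 1]]);
  (4%N, [:: [:: 1; 1]; [:: 0; 1; 1]; [:: 0; 0; 1; 0; -1]]);
  (4%N, [:: [:: 1; 0; -1]; [:: 0; 1]; [:: 0; 0; 1; 1]]);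
  (3%N, [:: [:: 1]; [:: 0; 1]; [:: 0; 0; 1]])].

Definition toZ (l : seq int) : seq Z := [seq Z_of_int a | a <- l].

Definition curve_poly (p : seq nat) (c : nat * seq (seq int)) (i : nat) : seq Z :=
  if i == 3%N then lmul [:: 0; 0; 0; 1] (iter (inv_list p 3) (lmul [:: 1; -1]) [:: 1])
  else lhom [:: 1; -1] c.1 (toZ (nth [::] c.2 i)).

(** The tests give, in order: the identity as frame at 0 (coordinate [i] vanishes to order [i]), the
    listed matrix as frame at 1 (coordinate [p k] vanishes to order [k], with sign [e k]), and the
    signs of the Wronskians. Reversing the order of 2 or 3 functions changes the sign, that of 4
    does not, whence the two factors -1. The last Wronskian is tested at 0 and 1 as well, for local
    convexity on the closed interval. *)
Definition curve_ok (x : entry) (c : nat * seq (seq int)) : bool :=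
  let: (d, p, e, n, zl, zr) := x in
  let f i := curve_poly p c i in
  let f0 := f 0%N in let f1 := f 1%N in let f2 := f 2%N in let f3 := f 3%N in
  let w := lwronsk4 f3 f2 f1 f0 in
  [&& all (fun i => all (fun j => leval (iter j (@lder _) (f i)) 0 == 0) (iota 0 i) &&
        (0 < leval (iter i (@lder _) (f i)) 0)) (iota 0 4),
      all (fun k => let g := f (nth 0%N p k) in
        all (fun j => leval (iter j (@lder _) g) 1 == 0) (iota 0 k) &&
        (0 < Z_of_int (nth 0 e k) * leval (iter k (@lder _) g) 1)) (iota 0 4),
      unit_pos (lscale (-1) (lwronsk f3 f2)),
      unit_pos (lscale (-1) (lwronsk3 f3 f2 f1)) &
      [&& unit_pos w, 0 < leval w 0 & 0 < leval w 1]].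

Lemma curves_ok : all (fun x => has (curve_ok x) curves) entries.
Proof. by vm_compute. Qed.

Variable R : realType.

Lemma wronsk4_det (P : 'I_4 -> {poly R}) t :
  \det (poly_jet P t) = (wronsk4 (P o3) (P o2) (P o1) (P o0)).[t].
Proof.
rewrite det4 !mxE /wronsk4 /wronsk3 -!derivSn !(hornerD, hornerN, hornerM) /=.
move: (P o0).[t] (P o0)^`().[t] ((P o0)^`())^`().[t] (((P o0)^`())^`())^`().[t] => a0 a1 a2 a3.
move: (P o1).[t] (P o1)^`().[t] ((P o1)^`())^`().[t] (((P o1)^`())^`())^`().[t] => b0 b1 b2 b3.
move: (P o2).[t] (P o2)^`().[t] ((P o2)^`())^`().[t] (((P o2)^`())^`())^`().[t] => c0 c1 c2 c3.
move: (P o3).[t] (P o3)^`().[t] ((P o3)^`())^`().[t] (((P o3)^`())^`())^`().[t] => d0 d1 d2 d3; ring.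
Qed.

Lemma entry_curve x : x \in entries -> exists gamma,
  [/\ LS3 gamma, convex_arc gamma 0 1 & frenet gamma 1 = (of_entry R x).2].
Proof.
move=> xin; have [sz Pz] := Pi4_of_entry R xin.
have oQ := orth_Pi4 sz; rewrite Pz in oQ.
have /hasP[c _] := allP curves_ok _ xin.
have ep : {in entries, forall x : entry, let: (d, p, e, n, zl, zr) := x in
    perm_eq p (iota 0 4) && all (fun a => (a == 1) || (a == -1)) e && (size e == 4%N)}.
  by apply/allP; vm_compute.
move/(_ _ xin) : ep.
case: x {xin sz Pz} oQ => [[[[[d p] e] n] zl] zr] oQ /andP[/andP[pp ee] se] ok.
rewrite [_.2]/(sgmx R p e) in oQ *; pose f := curve_poly p c.
have [start fin w2 w3 /and3P[w4 w40 w41]] := and5P ok.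
pose m : {rmorphism Z -> R} := intr \o int_of_Z.
have m0 (z : Z) : 0 < z -> 0 < m z by rewrite /m /= ltr0z; lia.
pose P (i : 'I_4) : {poly R} := lpoly m (f i).
have jetE (i j : nat) z : ((lpoly m (f i))^`(j)).[m z] = m (leval (iter j (@lder _) (f i)) z).
  by rewrite -lpoly_derivn lpoly_eval.
have fin0 (k j : 'I_4) : (j < k)%N -> (lpoly m (f (nth 0%N p k)))^`(j).[1] = 0.
  move=> jk; rewrite -(rmorph1 m) jetE.
  have /(allP fin)/andP[/allP h _] : (k : nat) \in iota 0 4 by rewrite mem_iota ltn_ord.
  by rewrite (eqP (h j _)) ?rmorph0 // mem_iota.
have fin1 (k : 'I_4) : 0 < (nth 0 e k)%:~R * (lpoly m (f (nth 0%N p k)))^`(k).[1].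
  rewrite -(rmorph1 m) jetE.
  have /(allP fin)/andP[_ h] : (k : nat) \in iota 0 4 by rewrite mem_iota ltn_ord.
  by have := m0 _ h; rewrite rmorphM {1}/m /= Z_of_intK.
have st0 (i j : 'I_4) : (j < i)%N -> (P i)^`(j).[0] = 0.
  move=> ji; rewrite -(rmorph0 m) jetE.
  have /(allP start)/andP[/allP h _] : (i : nat) \in iota 0 4 by rewrite mem_iota ltn_ord.
  by rewrite (eqP (h j _)) ?rmorph0 // mem_iota.
have st1 (i : 'I_4) : 0 < (P i)^`(i).[0].
  rewrite -(rmorph0 m) jetE.
  have /(allP start)/andP[_ h] : (i : nat) \in iota 0 4 by rewrite mem_iota ltn_ord.
  exact: m0.
have P3 t : (P o3).[t] = t ^+ 3 * (1 - t) ^+ inv_list p 3.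
  have pw a : (lpoly m (iter a (lmul [:: 1; -1]) [:: 1])).[t] = (1 - t) ^+ a.
    elim: a => [|a IH]; first by rewrite /= mul0r add0r rmorph1 hornerC.
    rewrite iterS lpolyM hornerM IH exprS; congr (_ * _).
    exact: lpoly_1subX.
  have -> : P o3 = lpoly m (lmul [:: 0; 0; 0; 1] (iter (inv_list p 3) (lmul [:: 1; -1]) [:: 1])) by [].
  rewrite lpolyM hornerM pw; congr (_ * _).
  exact: lpoly_X3.
(* Positivity on the whole line, since smoothness is required there. Away from 0 and 1 the last
   coordinate is nonzero; at 0 the first one is, and at 1 the one whose index is the image of the
   first. *)
have N0 t : 0 < (\sum_i P i ^+ 2).[t].
  have sq i : 0 <= (P i).[t] ^+ 2 by exact: sqr_ge0.
  suff [i Pi] : exists i, (P i).[t] != 0.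
    rewrite horner_sum (bigD1 i) //=; apply: ltr_wpDr; last by rewrite horner_exp exprn_even_gt0.
    by apply: sumr_ge0 => k _; rewrite horner_exp.
  have [->|t0] := eqVneq t 0; first by exists o0; have := st1 o0; rewrite derivn0 => /lt0r_neq0.
  have [->|t1] := eqVneq t 1.
    have p0 : (nth 0%N p 0 < 4)%N.
      have : nth 0%N p 0 \in p by apply: mem_nth; rewrite (perm_size pp).
      by rewrite (perm_mem pp) mem_iota.
    exists (Ordinal p0); have := fin1 o0; rewrite derivn0 => /lt0r_neq0.
    by rewrite mulf_eq0 negb_or => /andP[].
  exists o3; rewrite P3 mulf_neq0 ?expf_neq0 // subr_eq0 eq_sym //.
have nz2 : no_zero (wronsk (P o3) (P o2)).
  move=> t t01; have := unit_pos_gt0 m0 w2 t01.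
  rewrite lpolyZ lpoly_wronsk hornerM hornerC rmorphN1 mulN1r oppr_gt0 => h.
  by rewrite /root lt_eqF.
have nz3 : no_zero (wronsk3 (P o3) (P o2) (P o1)).
  move=> t t01; have := unit_pos_gt0 m0 w3 t01.
  rewrite lpolyZ lpoly_wronsk3 hornerM hornerC rmorphN1 mulN1r oppr_gt0 => h.
  by rewrite /root lt_eqF.
have pos4 t : 0 <= t <= 1 -> 0 < (wronsk4 (P o3) (P o2) (P o1) (P o0)).[t].
  rewrite -lpoly_wronsk4; case/andP; rewrite le_eqVlt => /predU1P[<- _|t0].
    by rewrite -(rmorph0 m) lpoly_eval m0.
  rewrite le_eqVlt => /predU1P[->|t1]; first by rewrite -(rmorph1 m) lpoly_eval m0.
  by apply: unit_pos_gt0 w4 _ => //; rewrite t0.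
have nz4 : no_zero (wronsk4 (P o3) (P o2) (P o1) (P o0)).
  by move=> t /andP[t0 t1]; rewrite /root gt_eqF // pos4 // !ltW.
have nz1 : no_zero (P o3).
  move=> t /andP[t0 t1]; rewrite /root P3 mulf_neq0 ?expf_neq0 ?(gt_eqF t0) //.
  by rewrite subr_eq0 gt_eqF.
exists (curve P); split.
- split.
    split=> [|t _|t t01]; first exact: smooth_curve.
      exact: curve_S3.
    by apply: det_jet_curve => //; rewrite wronsk4_det pos4.
  (* At 0 the polynomial jet is itself in [Up4plus]. *)
  apply: (frenet_curve N0 (V := poly_jet P 0)); rewrite ?trmx1 ?mul1mx //.
  by split=> [i j ji|i]; rewrite mxE; [exact: st0|exact: st1].
- exact: convex_arc_curve.
(* At 1, [Q^T] moves coordinate [p k] to row [k] and corrects its sign, which makes the jet upper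
   triangular with positive diagonal. *)
- apply: (frenet_curve N0 (V := (sgmx R p e)^T *m poly_jet P 1)) => //; last first.
    by rewrite mulmxA (mulmx1C oQ) mul1mx.
  have VE (k j : 'I_4) : ((sgmx R p e)^T *m poly_jet P 1) k j =
      (nth 0 e k)%:~R * (lpoly m (f (nth 0%N p k)))^`(j).[1].
    have pk : (nth 0%N p k < 4)%N.
      have : nth 0%N p k \in p by apply: mem_nth; rewrite (perm_size pp).
      by rewrite (perm_mem pp) mem_iota.
    rewrite mxE (bigD1 (Ordinal pk)) //= big1 => [|i ik].
      by rewrite addr0 !mxE /ent eqxx.
    rewrite !mxE /ent; case: eqP => [e1|]; last by rewrite mul0r.
    by case/eqP: ik; apply: val_inj.
  by split=> [i j ji|i]; rewrite VE; [rewrite fin0 // mulr0 | exact: fin1].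
Qed.

End Realization.

(** * Bruhat cells *)

Section LU.
Variable R : realType.
Implicit Types (A L V W : 'M[R]_4) (i j k : 'I_4).

(** One step of Gaussian elimination with pivot [A k k]. The rational formulas make the lower factor
    a continuous function of the matrix. *)
Definition lu_step k A : 'M[R]_4 := \matrix_(i, j) (A i j - A i k * A k j / A k k).

Fixpoint lu_iter n A : 'M[R]_4 := if n is n'.+1 then lu_step (inord n') (lu_iter n' A) else A.

Definition lu_lower A : 'M[R]_4 := \matrix_(i, k) (lu_iter k A i k / lu_iter k A k k).

Definition unip_lower L : Prop := (forall i j, (i < j)%N -> L i j = 0) /\ forall i, L i i = 1.

(** Elimination removes the rank one terms of the product L V one by one: at stage [n] column [n] of
    [L] and row [n] of [V] are exposed. *)
Lemma lu_iterE L V n : unip_lower L -> Up4plus V -> (n <= 4)%N ->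
  forall i j, lu_iter n (L *m V) i j = \sum_(r < 4 | (n <= r)%N) L i r * V r j.
Proof.
move=> [lL dL] [uV dV]; elim: n => [|n IH] n4 i j; first by rewrite mxE.
have {}IH := IH (ltnW n4); rewrite /= mxE; set k : 'I_4 := inord n.
have kE : k = n :> nat by rewrite inordK.
have split_k a b : lu_iter n (L *m V) a b = L a k * V k b + \sum_(r < 4 | (n < r)%N) L a r * V r b.
  rewrite IH (bigD1 k) /= ?kE //; congr (_ + _); apply: eq_bigl => r.
  by rewrite ltn_neqAle andbC -val_eqE /= kE eq_sym.
have Mk a : lu_iter n (L *m V) a k = L a k * V k k.
  rewrite split_k big1 ?addr0 // => r nr; rewrite uV ?mulr0 //; by rewrite kE.
have kM b : lu_iter n (L *m V) k b = V k b.
  rewrite split_k dL mul1r big1 ?addr0 // => r nr; rewrite lL ?mul0r //; by rewrite kE.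
by rewrite split_k Mk !kM [X in _ - X]mulrAC mulfK ?lt0r_neq0 // addrAC subrr add0r.
Qed.

Lemma lu_lowerP L V : unip_lower L -> Up4plus V -> lu_lower (L *m V) = L.
Proof.
move=> uL uV; have [lL dL] := uL; have [uV' dV] := uV.
have E k a : lu_iter k (L *m V) a k = L a k * V k k.
  rewrite (lu_iterE uL uV (ltnW (ltn_ord k))) (bigD1 k) //= big1 ?addr0 // => r /andP[kr rk].
  by rewrite uV' ?mulr0 // ltn_neqAle kr eq_sym andbT.
by apply/matrixP => i k; rewrite mxE !E dL mul1r mulfK // lt0r_neq0.
Qed.

Lemma lu_iter_pivot L V k : unip_lower L -> Up4plus V -> lu_iter k (L *m V) k k != 0.
Proof.
move=> uL uV; have [lL dL] := uL; have [uV' dV] := uV.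
rewrite (lu_iterE uL uV (ltnW (ltn_ord k))) (bigD1 k) //= big1 => [|r /andP[kr rk]].
  by rewrite addr0 dL mul1r lt0r_neq0.
by rewrite uV' ?mulr0 // ltn_neqAle kr eq_sym andbT.
Qed.

Lemma cvg_lu_iter (T : Type) (F : set_system T) {FF : Filter F} (B : T -> 'M[R]_4) (A : 'M[R]_4) n :
  (forall k, (k < n)%N -> lu_iter k A k k != 0) -> (n <= 4)%N ->
  (forall i j, B t i j @[t --> F] --> A i j) ->
  forall i j, lu_iter n (B t) i j @[t --> F] --> lu_iter n A i j.
Proof.
move=> + + hB; elim: n => [|n IH] piv n4 i j //=.
have kE : (inord n : 'I_4) = n :> nat by rewrite inordK.
have {}IH := IH (fun k kn => piv k (leqW kn)) (ltnW n4).
under eq_fun do rewrite mxE; rewrite mxE.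
apply: cvgB; first exact: IH.
apply: cvgM; first by apply: cvgM; exact: IH.
apply: cvgV; last exact: IH.
by have := piv (inord n); rewrite kE => /(_ (ltnSn n)).
Qed.

Variable p : 'I_4 -> nat.
Hypothesis p_inj : injective p.

(* [W] is conjugate, by the permutation [p], to an upper triangular matrix. *)
Lemma lu_exists W : (forall i j, (p j < p i)%N -> W i j = 0) -> (forall i, 0 < W i i) ->
  exists L V, [/\ W = L *m V, unip_lower L, Up4plus V &
    forall i j, (p j < p i)%N -> L i j = 0].
Proof.
move=> pW dW.
(* The zero pattern survives a step because a product through the pivot [k] is nonzero only if p i
   <= p k <= p j. For i = j this forces i = k, so the later pivots keep their original, positive
   values. *)
have inv n : (n <= 4)%N -> [/\ forall i j, (i < n)%N || (j < n)%N -> lu_iter n W i j = 0,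
    forall i j, (p j < p i)%N -> lu_iter n W i j = 0,
    forall i, (n <= i)%N -> lu_iter n W i i = W i i &
    forall i j, W i j = \sum_(r < 4 | (r < n)%N)
      lu_iter r W i r / lu_iter r W r r * lu_iter r W r j + lu_iter n W i j].
  elim: n => [_|n IH n4]; first by split=> // i j; rewrite big_pred0 ?add0r.
  have [z1 z2 dg sm] := IH (ltnW n4); set k : 'I_4 := inord n.
  have kE : k = n :> nat by rewrite inordK.
  have piv : lu_iter n W k k != 0 by rewrite dg ?kE // lt0r_neq0.
  split=> [i j|i j ji|i ni|i j] /=.
  - rewrite mxE -/k !ltnS; have [->|ik] := eqVneq i k.
      by move=> _; rewrite mulrAC divff // mul1r subrr.
    have [->|jk] := eqVneq j k; first by move=> _; rewrite mulfK // subrr.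
    case/orP => h.
      have {}h : (i < n)%N by rewrite ltn_neqAle h andbT -kE val_eqE.
      by rewrite (z1 i j) ?(z1 i k) ?h // !mul0r subrr.
    have {}h : (j < n)%N by rewrite ltn_neqAle h andbT -kE val_eqE.
    by rewrite (z1 i j) ?(z1 k j) ?h ?orbT // mulr0 mul0r subrr.
  - rewrite mxE -/k z2 //; have [ki|ik] := ltnP (p k) (p i); first by rewrite z2 // !mul0r subrr.
    by rewrite (z2 k j) ?mulr0 ?mul0r ?subrr // (leq_trans ji).
  - rewrite mxE -/k (dg _ (ltnW ni)); have ik : i != k by rewrite -val_eqE /= kE gtn_eqF.
    suff -> : lu_iter n W i k * lu_iter n W k i = 0 by rewrite mul0r subr0.
    have : p i != p k by rewrite (inj_eq p_inj).
    by rewrite neq_ltn => /orP[h|h]; rewrite (z2 _ _ h) ?mulr0 ?mul0r.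
  - rewrite mxE -/k sm; symmetry; rewrite (bigD1 k) /= ?kE //.
    rewrite (eq_bigl (fun r : 'I_4 => (r < n)%N)) => [|r]; last first.
      by rewrite ltnS (ltn_neqAle r) andbC -val_eqE /= kE.
    ring.
have [_ _ _ WE] := inv 4%N isT.
pose V : 'M[R]_4 := \matrix_(r, j) lu_iter r W r j.
exists (lu_lower W), V; split.
- apply/matrixP => i j; rewrite WE [X in _ + X](_ : _ = 0) ?addr0; last first.
    by have [z _ _ _] := inv 4%N isT; rewrite z // ltn_ord.
  rewrite mxE; apply: eq_big => [r|r _]; first by rewrite ltn_ord.
  by rewrite !mxE.
- split=> [i j ij|i]; rewrite mxE.
    by have [z _ _ _] := inv j (ltnW (ltn_ord j)); rewrite z ?ij // mul0r.
  have [_ _ dg _] := inv i (ltnW (ltn_ord i)); by rewrite divff // dg // lt0r_neq0.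
- split=> [i j ji|i]; rewrite mxE.
    by have [z _ _ _] := inv i (ltnW (ltn_ord i)); rewrite z // ji orbT.
  by have [_ _ dg _] := inv i (ltnW (ltn_ord i)); rewrite dg.
- move=> i j ji; rewrite mxE; have [_ z _ _] := inv j (ltnW (ltn_ord j)); by rewrite z // mul0r.
Qed.

End LU.

(** Pairs (row, column): the places below the diagonal left free by the zero pattern of the lower
    factor. *)
Definition inversions (p : seq nat) : seq (nat * nat) :=
  [seq ab <- [seq (a, b) | a <- iota 0 4, b <- iota 0 4] |
    (ab.2 < ab.1)%N && (nth 0%N p ab.1 < nth 0%N p ab.2)%N].

(** * Coordinates on a Bruhat cell *)

Section BruhatDimension.
Variable R : realType.
Variables (p : seq nat) (e : seq int) (d : nat).
Hypothesis p_perm : perm_eq p (iota 0 4).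
Hypothesis e_sign : all (fun a => (a == 1) || (a == -1)) e.
Hypothesis e_size : size e = 4%N.
Implicit Types (i j a b : 'I_4) (x : 'rV[R]_d) (P U L : 'M[R]_4).

Local Notation Q := (sgmx R p e).
Hypothesis Q_SO4 : SO4 Q.

Hypothesis d_inv : size (inversions p) = d.
Local Notation S := (inversions p).

Let p_lt i : (nth 0%N p i < 4)%N.
Proof.
have : nth 0%N p i \in p by apply: mem_nth; rewrite (perm_size p_perm) size_iota.
by rewrite (perm_mem p_perm) mem_iota.
Qed.

Let pi i : 'I_4 := Ordinal (p_lt i).

Let pi_inj : injective pi.
Proof.
move=> i j /(congr1 val) /= /eqP; rewrite nth_uniq ?(perm_size p_perm) ?size_iota //.
  by move/eqP/val_inj.
by rewrite (perm_uniq p_perm) iota_uniq.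
Qed.

Let p_inj : injective (fun i : 'I_4 => nth 0%N p i).
Proof. by move=> i j h; apply: pi_inj; apply: val_inj. Qed.

Let eps i : R := (nth 0 e i)%:~R.

Let eps_sqr i : eps i * eps i = 1.
Proof.
have : nth 0 e i \in e by apply: mem_nth; rewrite e_size.
by move/(allP e_sign) => /orP[] /eqP; rewrite /eps => ->; rewrite ?rmorphN ?mulrNN mulr1.
Qed.

Let QE i a : Q i a = if i == pi a then eps a else 0.
Proof. by rewrite mxE /ent -val_eqE /=; case: eqP. Qed.

Let conjE U a b : (Q^T *m U *m Q) a b = eps a * U (pi a) (pi b) * eps b.
Proof.
rewrite mxE (bigD1 (pi b)) //= big1 => [|j jb]; last by rewrite QE (negbTE jb) mulr0.
rewrite addr0 QE eqxx; congr (_ * _).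
rewrite mxE (bigD1 (pi a)) //= big1 => [|i ia]; last by rewrite mxE QE (negbTE ia) mul0r.
by rewrite addr0 mxE QE eqxx.
Qed.

Let QT : Q^T *m Q = 1%:M. Proof. by case: Q_SO4. Qed.
Let QQT : Q *m Q^T = 1%:M. Proof. exact: mulmx1C. Qed.

Let in_inversions i j : ((i : nat, j : nat) \in S) = (j < i)%N && (nth 0%N p i < nth 0%N p j)%N.
Proof.
rewrite mem_filter andb_idr // => _; apply/allpairsP; exists (i : nat, j : nat).
by rewrite !mem_iota !ltn_ord.
Qed.

Let S_uniq : uniq S.
Proof. by apply: filter_uniq; apply: allpairs_uniq => [||[? ?] [? ?]]; rewrite ?iota_uniq. Qed.

Definition low x : 'M[R]_4 :=
  \matrix_(i, j) ((i == j)%:R + \sum_(k < d) x 0 k *+ ((i : nat, j : nat) == nth (0, 0)%N S k)).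

Let low_out x i j : (i : nat, j : nat) \notin S -> low x i j = (i == j)%:R.
Proof.
move=> ijS; rewrite mxE big1 ?addr0 // => k _; case: eqP => [ij|_]; last by rewrite mulr0n.
by case/negP: ijS; rewrite ij mem_nth // d_inv.
Qed.

Let low_in x i j (k : 'I_d) : (i : nat, j : nat) = nth (0, 0)%N S k -> low x i j = x 0 k.
Proof.
move=> ijk; have /andP[ji _] : (j < i)%N && (nth 0%N p i < nth 0%N p j)%N.
  by rewrite -in_inversions ijk mem_nth // d_inv.
rewrite mxE -val_eqE (gtn_eqF ji) add0r (bigD1 k) //= ijk eqxx mulr1n big1 ?addr0 // => l lk.
by rewrite nth_uniq ?d_inv // eq_sym val_eqE (negbTE lk) mulr0n.
Qed.

Let low_unip x : unip_lower (low x).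
Proof.
split=> [i j ij|i]; rewrite low_out ?eqxx // ?in_inversions ?ltnn //.
  by rewrite -val_eqE ltn_eqF.
by rewrite ltnNge (ltnW ij).
Qed.

Let low_pattern x i j : (nth 0%N p j < nth 0%N p i)%N -> low x i j = 0.
Proof.
move=> pji; rewrite low_out ?in_inversions ?negb_and -?leqNgt ?(ltnW pji) ?orbT //.
by case: eqP pji => // ->; rewrite ltnn.
Qed.

Definition low_coord L : 'rV[R]_d :=
  \row_k L (inord (nth (0, 0)%N S k).1) (inord (nth (0, 0)%N S k).2).

Let S_ord (k : 'I_d) : let ab := nth (0, 0)%N S k in
  ((inord ab.1 : 'I_4) : nat, (inord ab.2 : 'I_4) : nat) = ab.
Proof.
have : nth (0, 0)%N S k \in S by rewrite mem_nth // d_inv.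
rewrite mem_filter => /andP[_ /allpairsP[[a b] [+ + ->]]]; rewrite !mem_iota => ha hb.
by rewrite /= !inordK.
Qed.

Let low_coordK x : low_coord (low x) = x.
Proof.
by apply/matrixP => i k; rewrite (ord1 i) mxE; apply: low_in; exact: S_ord.
Qed.

Let coord_lowK L : unip_lower L -> (forall i j, (nth 0%N p j < nth 0%N p i)%N -> L i j = 0) ->
  low (low_coord L) = L.
Proof.
move=> [lL dL] pL; apply/matrixP => i j.
have [ijS|ijS] := boolP ((i : nat, j : nat) \in S).
  have kd : (index (i : nat, j : nat) S < d)%N by rewrite -d_inv index_mem.
  have ijk : (i : nat, j : nat) = nth (0, 0)%N S (Ordinal kd) by rewrite nth_index.
  by rewrite (low_in _ ijk) mxE -ijk /= !inord_val.
rewrite low_out //; case: eqVneq => [->|ij]; first by rewrite dL.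
have [ij'|ji] := ltnP i j; first by rewrite lL.
rewrite pL //; move: ijS; rewrite in_inversions ltn_neqAle ji andbT eq_sym val_eqE ij /=.
by rewrite -leqNgt leq_eqVlt => /predU1P[/p_inj/eqP|//]; rewrite eq_sym (negbTE ij).
Qed.

Let det_low x : 0 < \det (Q *m low x).
Proof.
have [l1 d1] := low_unip x; rewrite det_mulmx; have [_ ->] := Q_SO4.
rewrite mul1r -det_tr det_upper => [|i j ji]; rewrite ![_^T _ _]mxE ?d1 ?mulr1 ?ltr01 //.
exact: l1.
Qed.

Definition cell_param x : 'M[R]_4 := gram_schmidt (Q *m low x).
Definition cell_coord P : 'rV[R]_d := low_coord (lu_lower (Q^T *m P)).

Let cell_factor x : exists2 V, Up4plus V & Q^T *m cell_param x = low x *m V.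
Proof.
have dx := lt0r_neq0 (det_low x); have uU := Up4plus_gs_upper dx.
exists (invmx (gs_upper (Q *m low x))); first exact: Up4plusV.
apply: (can_inj (mulmxK (Up4plus_unit uU))).
by rewrite mulmxKV ?Up4plus_unit // -mulmxA gram_schmidtK // mulmxA QT mul1mx.
Qed.

(** With [L] for [low x], Q L V = (Q L Q^T) Q V, and the zero pattern of [L] is the one for which Q
    L Q^T is upper triangular. *)
Let cell_param_in x : bruhat_cell Q (cell_param x).
Proof.
split; first exact: SO4_gram_schmidt.
have [V uV E] := cell_factor x; exists (Q *m low x *m Q^T), V; split=> //.
  have cE a b : (Q *m low x *m Q^T) (pi a) (pi b) = eps a * low x a b * eps b.
    have := conjE (Q *m low x *m Q^T) a b.
    rewrite !mulmxA QT mul1mx -mulmxA QT mulmx1 => ->.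
    by rewrite !mulrA eps_sqr mul1r -mulrA eps_sqr mulr1.
  have surj i : exists a, i = pi a.
    by have [g _ gK] := injF_bij pi_inj; exists (g i); rewrite gK.
  split=> [i j|i].
    have [a ->] := surj i; have [b ->] := surj j => ji.
    by rewrite cE low_pattern // mulr0 mul0r.
  have [a ->] := surj i; rewrite cE; have [_ ->] := low_unip x.
  by rewrite mulr1 eps_sqr.
by rewrite -[LHS]mul1mx -QQT -mulmxA E !mulmxA -[_ *m Q^T *m Q]mulmxA QT mulmx1.
Qed.

(** If P = U Q U', then Q^T P = (Q^T U Q) U', and [lu_exists] applies to the conjugate of [U]. *)
Let cell_lower P : bruhat_cell Q P -> exists2 V, Up4plus V &
  Q^T *m P = low (cell_coord P) *m V.
Proof.
move=> [_ [U [U' [uU uU' PE]]]]; have [lU dU] := uU.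
have [L [V [WE uL uV pL]]] : exists L V, [/\ Q^T *m U *m Q = L *m V, unip_lower L, Up4plus V &
    forall i j, (nth 0%N p j < nth 0%N p i)%N -> L i j = 0].
  apply: (lu_exists p_inj) => [i j ji|i]; rewrite conjE; first by rewrite lU ?mulr0 ?mul0r.
  by rewrite mulrAC eps_sqr mul1r.
have E : Q^T *m P = L *m (V *m U') by rewrite PE !mulmxA WE.
have uVU := Up4plusM uV uU'.
by exists (V *m U') => //; rewrite /cell_coord E lu_lowerP // coord_lowK.
Qed.

Let cvg_cell_param x i j : cell_param y i j @[y --> x] --> cell_param x i j.
Proof.
apply: (@cvg_gram_schmidt R _ (nbhs x) _ (fun y => Q *m low y) (Q *m low x)).
  exact: lt0r_neq0 (det_low x).
move=> k l; under eq_fun do rewrite mxE; rewrite mxE; apply: cvg_bigsum => r.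
apply: cvgM; first exact: cvg_cst.
under eq_fun do rewrite mxE; rewrite mxE; apply: cvgD; first exact: cvg_cst.
apply: cvg_bigsum => n; apply: cvgMn; exact: coord_continuous.
Qed.

Let cvg_cell_coord P (i : 'I_1) (k : 'I_d) : bruhat_cell Q P -> cell_coord P' i k @[P' --> P] --> cell_coord P i k.
Proof.
move=> PC; have [V uV E] := cell_lower PC; have uL := low_unip (cell_coord P).
under eq_fun do rewrite mxE; rewrite mxE; set a := inord _; set b := inord _.
have cQ n l : (Q^T *m P') n l @[P' --> P] --> (Q^T *m P) n l.
  apply: (@cvg_trmx_mul R _ (nbhs P) _ (fun=> Q) id Q P) => k' l'; first exact: cvg_cst.
  exact: coord_continuous.
have clu m l n : (m < 4)%N -> lu_iter m (Q^T *m P') l n @[P' --> P] --> lu_iter m (Q^T *m P) l n.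
  move=> m4; apply: (@cvg_lu_iter R _ (nbhs P) _ (fun P' => Q^T *m P') (Q^T *m P) m) => //.
    by move=> c _; rewrite E; exact: lu_iter_pivot.
  exact: ltnW.
under eq_fun do rewrite mxE; rewrite mxE.
have piv : lu_iter b (Q^T *m P) b b != 0 by rewrite E; exact: lu_iter_pivot.
exact: cvgM (clu _ _ _ (ltn_ord b)) (cvgV piv (clu _ _ _ (ltn_ord b))).
Qed.

Lemma bruhat_cell_dimension : has_dimension (bruhat_cell Q) d.
Proof.
split; first by exists (cell_param 0); exact: cell_param_in.
(* One chart covers the cell, so the neighbourhood is the whole space. *)
move=> P PC; exists setT; split; [exact: openT | by [] |].
exists cell_param, cell_coord; split.
- by move=> x; apply: (@cvg_mx R _ (nbhs x)) => i j; exact: cvg_cell_param.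
- apply: continuous_in_subspaceT => P'; rewrite inE => -[PC' _].
  by apply: (@cvg_mx R _ (nbhs P')) => i j; exact: cvg_cell_coord.
- by move=> x; split.
- move=> x; have [V uV E] := cell_factor x.
  by rewrite /cell_coord E lu_lowerP // low_coordK.
- move=> P' [PC' _]; have [V uV E] := cell_lower PC'; have [[oP' _] _] := PC'.
  apply: (@gram_schmidt_factor _ _ _ (invmx V)) => //; first exact: Up4plusV.
  have -> : low (cell_coord P') = Q^T *m P' *m invmx V by rewrite E mulmxK // Up4plus_unit.
  by rewrite !mulmxA QQT mul1mx.
Qed.

End BruhatDimension.

(** * Assembling the classification *)

Section Assembly.
Variable R : realType.

Definition entry_valid (x : entry) : bool := let: (d, p, e, n, zl, zr) := x in
  [&& perm_eq p (iota 0 4), all (fun a => (a == 1) || (a == -1)) e, size e == 4%N &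
      size (inversions p) == d].

Lemma entries_valid : all entry_valid entries.
Proof. by vm_compute. Qed.

Lemma entry_SO4 x : x \in entries -> SO4 (of_entry R x).2.
Proof.
by move=> /(Pi4_of_entry R)[sz <-]; split; [exact: orth_Pi4 | exact: det_Pi4].
Qed.

Lemma entry_B4plus x : x \in entries -> B4plus (of_entry R x).2.
Proof.
move=> xin; split; last by have [] := entry_SO4 xin.
have := allP entries_valid _ xin; case: x {xin} => [[[[[d p] e] n] zl] zr].
case/and4P => pp se ze _ /=.
have p_lt (i : 'I_4) : (nth 0%N p i < 4)%N.
  have : nth 0%N p i \in p by apply: mem_nth; rewrite (perm_size pp) size_iota.
  by rewrite (perm_mem pp) mem_iota.
have p_inj : injective (fun i : 'I_4 => Ordinal (p_lt i)).
  move=> i j /(congr1 val) /= /eqP; rewrite nth_uniq ?(perm_size pp) ?size_iota //.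
    by move/eqP/val_inj.
  by rewrite (perm_uniq pp) iota_uniq.
exists (perm p_inj), (fun j => (nth 0 e j)%:~R); split=> [j|].
  have : nth 0 e j \in e by apply: mem_nth; rewrite (eqP ze).
  by move/(allP se) => /orP[] /eqP ->; [left | right; rewrite rmorphN].
by apply/matrixP => i j; rewrite !mxE permE /ent -val_eqE /=; case: eqP.
Qed.

Lemma entry_dimension x : x \in entries -> has_dimension (bruhat_cell (of_entry R x).2) x.1.1.1.1.1.
Proof.
move=> xin; have := entry_SO4 xin; have := allP entries_valid _ xin.
case: x {xin} => [[[[[d p] e] n] zl] zr] /and4P[pp se /eqP ze /eqP inv] Q.
exact: bruhat_cell_dimension.
Qed.

(** The lists of entries are images of integer lists, whose distinctness is decided by
    computation. *)
Lemma entry_matrices_uniq : uniq [seq (of_entry R x).2 | x <- entries].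
Proof.
pose f (Q : 'M[R]_4) : seq R := [seq Q ij.1 ij.2 | ij <- [seq (i, j) | i <- enum 'I_4, j <- enum 'I_4]].
pose g (x : entry) : seq int := let: (d, p, e, n, zl, zr) := x in
  [seq ent p e ij.1 ij.2 | ij <- [seq (i, j) | i <- iota 0 4, j <- iota 0 4]].
apply: (@map_uniq _ _ f); rewrite -map_comp.
have -> : [seq (f \o (fun x => (of_entry R x).2)) x | x <- entries] = [seq map intr x | x <- [seq g x | x <- entries]].
  rewrite -map_comp; apply: eq_map => -[[[[[d p] e] n] zl] zr].
  rewrite /f /g /= enum_ord4 /=; by rewrite !mxE.
rewrite map_inj_uniq; first by vm_compute.
by apply: inj_map; exact: intr_inj.
Qed.

(** Their images under [Pi4] are already distinct. *)
Lemma entry_spins_uniq : uniq [seq (of_entry R x).1.2 | x <- entries].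
Proof.
apply: (@map_uniq _ _ (@Pi4 R)); rewrite -map_comp.
rewrite (eq_in_map _ (fun x => (of_entry R x).2) entries).1; first exact: entry_matrices_uniq.
by move=> x /(Pi4_of_entry R)[].
Qed.

End Assembly.

Theorem theoremE (R : realType) :
  [/\ @convex_mx R `&` @B4plus R =
        [set` [seq e.2 | e <- convex_list R]],
      @convex_spin R `&` @B4plus_spin R =
        [set` [seq e.1.2 | e <- convex_list R]],
      size (convex_list R) = 24%N /\
        sorted leq [seq e.1.1 | e <- convex_list R],
      uniq [seq e.2 | e <- convex_list R] /\
        uniq [seq e.1.2 | e <- convex_list R] &
      forall (d : nat) (z : quat_pair R) (Q : 'M[R]_4),
        (d, z, Q) \in convex_list R ->
        Pi4 z = Q /\ has_dimension (bruhat_cell Q) d].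
Proof.
rewrite convex_listE; split.
- apply/seteqP; split=> Q.
    move=> [[sQ [gamma [t0 [t1 [[[lc F0] h0 h1 h2] [cv QE]]]]]] bQ].
    have t001 : 0 <= t0 <= 1 by rewrite h0 (le_trans (ltW h1)).
    rewrite (orth_trmx_unit (frenet_orth lc t001)) in QE.
    have [x xin ->] := convex_B4plus_entry lc h0 h1 h2 cv (esym QE) bQ.
    by apply/mapP; exists (of_entry R x) => //; exact: map_f.
  move=> /mapP[_ /mapP[x xin ->] ->]; split; last exact: entry_B4plus.
  split; first exact: entry_SO4.
  have [gamma [lg cv F1]] := entry_curve R xin.
  exists gamma, 0, 1; split; first by split; rewrite ?lexx ?ltr01.
  by split=> //; have [_ ->] := lg; rewrite invmx1 mul1mx.
- apply/seteqP; split=> z.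
    move=> [[sz [gamma [zt [t0 [t1 [[[lc F0] h0 h1 h2] [cv [lift zE]]]]]]]] [_ bz]].
    have PE := Pi4_lift_frame h0 h1 h2 lift; rewrite zE in PE.
    have [x xin QE] := convex_B4plus_entry lc h0 h1 h2 cv PE bz.
    rewrite -zE (convex_arc_spin lc h0 h1 h2 lift cv xin) -?PE //.
    by apply/mapP; exists (of_entry R x) => //; exact: map_f.
  move=> /mapP[_ /mapP[x xin ->] ->].
  have [sx Px] := Pi4_of_entry R xin; split; last by split=> //; rewrite Px; exact: entry_B4plus.
  split=> //; have [gamma [lg cv F1]] := entry_curve R xin.
  have [lc F0] := lg; have [zt lift] := frenet_lift_exists lc F0.
  exists gamma, zt, 0, 1; split; first by split; rewrite ?lexx ?ltr01.
  split=> //; split=> //; apply: (convex_arc_spin lc) => //; rewrite ?lexx ?ltr01 //.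
  by rewrite F0 F1 trmx1 mul1mx.
- by rewrite size_map; split.
- by split; rewrite -map_comp; [exact: entry_matrices_uniq | exact: entry_spins_uniq].
- move=> d z Q /mapP[x xin E]; have [_ Px] := Pi4_of_entry R xin.
  have := entry_dimension R xin; move: Px; rewrite -E /=.
  by case: x xin E => [[[[[d' p] e] n] zl] zr] _ [-> _ _] /=.
Qed.
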